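(* Let $(L,F)$ be a gfqi-equipped knot, and let $(\bar L,\bar F)$ be its Legendrian mirror. Then, in the set of gfqi-concordance classes of gfqi-equipped knots with the operation $[L,F]+[L',F']=[L\#L',F\#F']$, $$[\bar L,\bar F]+[L,F]=[L,F]+[\bar L,\bar F]=[\mathcal{O},F_{\mathcal{O}}],$$ where $\mathcal{O}\subset J^1(\mathbb{R})$ is the zero section and $F_{\mathcal{O}}$ is its unique equivalence class of gfqi's.
   Context: **One-jet spaces.** For a smooth manifold $M$ (possibly with boundary), with local coordinates $x$, $J^1(M)=\mathbb{R}\times T^*M$ has coordinates $(u,x,y)$, $y$ dual to $x$, and contact structure $\ker(du-y\,dx)$. A Legendrian submanifold of $J^1(M)$ is a smooth submanifold of dimension $\dim M$ everywhere tangent to this contact structure. The front of $L\subset J^1(M)$ is its image under $(u,x,y)\mapsto(u,x)$. The zero section is $\{u=0,y=0\}$; in $J^1(\mathbb{R})$ it is denoted $\mathcal{O}$. On $J^1(\mathbb{R})$ use coordinates $(u,q,p)$; on $J^1(\mathbb{R}\times[0,1])$ use $(u,q,t,p,s)$, with $p,s$ dual to $q,t$ and contact form $du-p\,dq-s\,dt$. **Generating functions.** A generating function (gf) for a Legendrian submanifold $L\subset J^1(M)$ is a smooth function $F:M\times\mathbb{R}^k\to\mathbb{R}$ (some $k$) such that $0$ is a regular value of $\partial_wF$ and $L$ is the contour of $F$: $$L=\{(u,x,y)\mid \exists w\in\mathbb{R}^k:\ \partial_wF(x,w)=0,\ u=F(x,w),\ y=\partial_xF(x,w)\}.$$ Two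 operations on gf's: *stabilization* replaces $F$ by $F\oplus Q'$ on $M\times\mathbb{R}^k\times\mathbb{R}^{k'}$, $(x,w,w')\mapsto F(x,w)+Q'(w')$, with $Q'$ a non-degenerate quadratic form on $\mathbb{R}^{k'}$; *fiberwise diffeomorphism* replaces $F$ by $F\circ\Phi$ with $\Phi(x,w)=(x,\phi_x(w))$ a diffeomorphism of $M\times\mathbb{R}^k$, each $\phi_x$ a diffeomorphism of $\mathbb{R}^k$. Equivalence of gf's is the equivalence relation generated by: $F\sim F'$ if both are obtained from a common gf $F_0$ by successive stabilizations and fiberwise diffeomorphisms. A gf is quadratic at infinity (gfqi) if it is equivalent to one of the form $f+Q$ with $f$ compactly supported on $M\times\mathbb{R}^k$ and $Q$ a non-degenerate quadratic form on $\mathbb{R}^k$. By a theorem of Théret and Viterbo, the zero section $\mathcal{O}$ has a unique equivalence class of gfqi's, denoted $F_{\mathcal{O}}$ (the class of a non-degenerate quadratic form in $w$). **gfqi-equipped knots.** A Legendrian knot is a connected Legendrian submanifold of $J^1(\mathbb{R})$. A gfqi-equipped knot is a pair $(L,F)$ with $L$ a Legendrian knot and $F$ an equivalence class of gfqi's for $L$. Such an $L$ coincides with $\mathcal{O}$ outside a compact set; its support is the smallest connected open $U\subset\mathbb{R}$ such that $L$ and $\mathcal{O}$ coincide over $\mathbb{R}\setminus U$. **gfqi-concordance.** For $\mathcal{L}\subset J^1(\mathbb{R}\times[0,1])$ the slice at $t_0$ is $\mathcal{L}_{\lceil t=t_0}=\{(u,q,p)\mid \exists s:\ (u,q,t_0,p,s)\in\mathcal{L}\}$.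 A Legendrian cobordism between $L_0$ and $L_1\subset J^1(\mathbb{R})$ is a Legendrian submanifold $\mathcal{L}\subset J^1(\mathbb{R}\times[0,1])$ with $\mathcal{L}_{\lceil t=0}=L_0$ and $\mathcal{L}_{\lceil t=1}=L_1$. A gfqi-cobordism between $(L_0,F_0)$ and $(L_1,F_1)$ is a pair $(\mathcal{L},\mathcal{F})$ with $\mathcal{L}$ a Legendrian cobordism between $L_0$ and $L_1$ and $\mathcal{F}$ a gfqi equivalence class for $\mathcal{L}$ with $\mathcal{F}|_{t=0}=F_0$ and $\mathcal{F}|_{t=1}=F_1$. It is a gfqi-concordance if $\mathcal{L}$ is diffeomorphic to $\mathbb{R}\times[0,1]$. Gfqi-concordance is an equivalence relation on gfqi-equipped knots; $[L,F]$ denotes the class of $(L,F)$. **Connected sum.** $L\# L'$ is the concatenation of $L$ then $L'$: after replacing representatives $F,F'$ by $F(\cdot+T,\cdot)$ and $F'(\cdot-T,\cdot)$ with $T$ large, so that the support of $L$ lies to the left of, and is disjoint from, that of $L'$, $L\#L'$ equals $L$ over the support of $L$, $L'$ over the support of $L'$, and $\mathcal{O}$ elsewhere. It is equipped with the class $F\#F'$ of $(q,w,w')\mapsto F(q,w)+F'(q,w')$. **Mirror.** The Legendrian mirror $\bar L$ of $L$ is the Legendrian knot whose front is the image of the front of $L$ under $(u,q)\mapsto(u,-q)$ (so $\bar L=\{(u,-q,-p)\mid (u,q,p)\in L\}$). It is equipped with the class $\bar F$ of $\bar F(q,w)=F(-q,w)$. *)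

(* Defs.v *)
From HB Require Import structures.
From Stdlib Require Import Relation_Operators.
From mathcomp Require Import all_boot all_order all_algebra.
From mathcomp Require Import all_classical all_reals all_analysis.
Set Implicit Arguments.
Unset Strict Implicit.
Unset Printing Implicit Defensive.
Import Order.TTheory GRing.Theory Num.Theory.
Import numFieldNormedType.Exports.
Local Open Scope classical_set_scope.
Local Open Scope ring_scope.

(* The base manifold M is a closed subset D of R^n: setT in 'rV_1 for the line,
   [strip] in 'rV_2 for R x [0,1].  A smooth map on M, or on M x R^k, is the
   restriction of a smooth map of the ambient space (for a closed subset this
   is the same as being locally extendable), so maps are globally smooth
   functions of which only the values over D matter. *)

Section Smooth.
Context {R : realType}.

Fixpoint Ck (V W : normedModType R) (k : nat) (f : V -> W) : Prop :=
  match k with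
  | 0 => continuous f
  | k'.+1 => (forall x, differentiable f x) /\ forall v, Ck k' ('D_v f)
  end.

Definition smooth (V W : normedModType R) (f : V -> W) := forall k, Ck k f.

Definition grad n (f : 'rV[R]_n -> R) (x : 'rV[R]_n) : 'rV[R]_n :=
  \row_i 'D_(delta_mx 0 i) f x.

(* Diffeomorphism between subsets A and B; psi is the inverse of phi. *)
Definition diffeo_between (V W : normedModType R) (A : set V) (B : set W)
    (phi : V -> W) (psi : W -> V) :=
  [/\ smooth phi, smooth psi, phi @` A = B & {in A, cancel phi psi}].

Definition diffeomorphic (V W : normedModType R) (A : set V) (B : set W) :=
  exists phi psi, diffeo_between A B phi psi.

End Smooth.

(* J^1(R^n), with points (u, x, y). *)
Definition J1 (R : realType) (n : nat) : normedModType R :=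
  (R * 'rV[R]_n * 'rV[R]_n)%type.

Section Legendrian.
Context {R : realType}.

(* Embedded n-dimensional submanifolds of J^1(D), given by local
   parametrizations by open subsets of D, tangent to ker(du - y dx).  The
   condition on interiors says that the boundary of L is the part of L lying
   over the boundary of D. *)
Definition legendrian n (D : set 'rV[R]_n) (L : set (J1 R n)) :=
  (forall z, L z -> D z.1.2) /\
  forall z, L z -> exists (U : set (J1 R n)) (V : set 'rV[R]_n) phi psi,
    [/\ open U, U z, open V, diffeo_between (V `&` D) (U `&` L) phi psi &
      forall a, V a -> D a ->
        (interior D a <-> interior D (phi a).1.2) /\
        forall v, let dphi : J1 R n := 'D_v phi a in
          dphi.1.1 = ((phi a).2 *m dphi.1.2^T) 0 0].

Definition zero_section n : set (J1 R n) :=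
  [set z : J1 R n | z.1.1 = 0 /\ z.2 = 0].

End Legendrian.

Section GeneratingFunctions.
Context {R : realType}.

Record gf n := GF {
  gf_dim : nat;
  gf_fun :> 'rV[R]_n -> 'rV[R]_gf_dim -> R }.

Definition smooth_family n k (V : normedModType R)
    (F : 'rV[R]_n -> 'rV[R]_k -> V) :=
  smooth (fun z : 'rV[R]_n * 'rV[R]_k => F z.1 z.2).

Definition quad k (A : 'M[R]_k) (w : 'rV[R]_k) : R := (w *m A *m w^T) 0 0.

Definition nondegenerate_mx k (A : 'M[R]_k) := A^T = A /\ A \in unitmx.

Definition gf_dw n (F : gf n) (z : 'rV[R]_n * 'rV[R]_(gf_dim F)) :=
  grad (F z.1) z.2.

Definition is_gf n (D : set 'rV[R]_n) (F : gf n) :=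
  smooth_family F /\
  forall z : 'rV[R]_n * 'rV[R]_(gf_dim F),
    D z.1 -> gf_dw z = 0 -> range ('d (@gf_dw n F) z) = setT.

Definition contour n (D : set 'rV[R]_n) (F : gf n) : set (J1 R n) :=
  [set z : J1 R n | D z.1.2 /\ exists w, [/\ gf_dw (F := F) (z.1.2, w) = 0,
     z.1.1 = F z.1.2 w & z.2 = grad (F^~ w) z.1.2]].

(* Both steps preserve and reflect the regularity condition of [is_gf]. *)
Inductive gf_step n (D : set 'rV[R]_n) : gf n -> gf n -> Prop :=
| Stabilization k k' (F : 'rV[R]_n -> 'rV[R]_k -> R) (A : 'M[R]_k')
    (G : 'rV[R]_n -> 'rV[R]_(k + k') -> R) :
    smooth_family F -> smooth_family G -> nondegenerate_mx A ->
    (forall x w, D x -> G x w = F x (lsubmx w) + quad A (rsubmx w)) ->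
    gf_step D (GF F) (GF G)
| FiberwiseDiffeo k (F G : 'rV[R]_n -> 'rV[R]_k -> R)
    (phi psi : 'rV[R]_n -> 'rV[R]_k -> 'rV[R]_k) :
    smooth_family F -> smooth_family G ->
    smooth_family phi -> smooth_family psi ->
    (forall x, D x -> cancel (phi x) (psi x) /\ cancel (psi x) (phi x)) ->
    (forall x w, D x -> G x w = F x (phi x w)) ->
    gf_step D (GF F) (GF G).

Definition gf_sim n (D : set 'rV[R]_n) (F G : gf n) :=
  exists F0, clos_refl_trans _ (gf_step D) F0 F /\
             clos_refl_trans _ (gf_step D) F0 G.

Definition gf_equiv n (D : set 'rV[R]_n) : gf n -> gf n -> Prop :=
  clos_refl_sym_trans _ (gf_sim D).

Definition gf_class n (D : set 'rV[R]_n) (F : gf n) : set (gf n) :=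
  [set G | gf_equiv D F G].

Definition is_gfqi n (D : set 'rV[R]_n) (F : gf n) :=
  is_gf D F /\
  exists k (f : 'rV[R]_n -> 'rV[R]_k -> R) (A : 'M[R]_k)
      (K : set ('rV[R]_n * 'rV[R]_k)),
    [/\ smooth_family f, compact K,
      forall x w, D x -> ~ K (x, w) -> f x w = 0,
      nondegenerate_mx A &
      gf_equiv D F (GF (fun x w => f x w + quad A w))].

Definition is_gfqi_class n (D : set 'rV[R]_n) (L : set (J1 R n))
    (C : set (gf n)) :=
  exists F, [/\ is_gfqi D F, contour D F = L & C = gf_class D F].

(* The classes induced by operations on representatives. *)
Definition class_map n m (D : set 'rV[R]_m) (op : gf n -> gf m)
    (C : set (gf n)) : set (gf m) :=
  [set G | exists2 F, C F & gf_equiv D (op F) G].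

Definition class_map2 n m (D : set 'rV[R]_m) (op : gf n -> gf n -> gf m)
    (C C' : set (gf n)) : set (gf m) :=
  [set G | exists F F', [/\ C F, C' F' & gf_equiv D (op F F') G]].

End GeneratingFunctions.
Arguments gf R n : clear implicits.

Section Knots.
Context {R : realType}.

(* A Legendrian together with a set of generating functions; the conditions
   making it a gfqi-equipped knot are in [gfqi_equipped_knot]. *)
Definition equipped n : Type := (set (J1 R n) * set (gf R n))%type.

Definition gfqi_equipped_knot (X : equipped 1) :=
  [/\ legendrian setT X.1, connected X.1 & is_gfqi_class setT X.1 X.2].

(* By a theorem of Theret and Viterbo the class of non-degenerate quadratic
   forms is the only class of gfqi's of the zero section. *)
Definition zero_knot : equipped 1 :=
  (@zero_section R 1,
   [set G | exists k (A : 'M[R]_k), nondegenerate_mx A /\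
      gf_equiv setT (GF (fun (_ : 'rV[R]_1) w => quad A w)) G]).

(* Coordinates (q, t) on R x [0,1]: q has index 0, t has index 1. *)
Definition strip : set 'rV[R]_2 := [set x : 'rV[R]_2 | 0 <= x 0 1 <= 1].

Definition at_t (x : 'rV[R]_1) (t : R) : 'rV[R]_2 :=
  row_mx x (const_mx t : 'rV[R]_1).

Definition slice (t : R) (L : set (J1 R 2)) : set (J1 R 1) :=
  [set z : J1 R 1 | exists s, L (z.1.1, at_t z.1.2 t, at_t z.2 s)].

Definition gf_slice (t : R) (F : gf R 2) : gf R 1 :=
  GF (fun x => F (at_t x t)).

Definition gfqi_cobordism (X0 X1 : equipped 1) (Y : equipped 2) :=
  [/\ legendrian strip Y.1, is_gfqi_class strip Y.1 Y.2,
    slice 0 Y.1 = X0.1 /\ slice 1 Y.1 = X1.1 &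
    class_map setT (gf_slice 0) Y.2 = X0.2 /\
    class_map setT (gf_slice 1) Y.2 = X1.2].

Definition gfqi_concordant (X0 X1 : equipped 1) :=
  [/\ gfqi_equipped_knot X0, gfqi_equipped_knot X1 &
    exists2 Y, gfqi_cobordism X0 X1 Y & diffeomorphic strip Y.1].

Definition gf_mirror (F : gf R 1) : gf R 1 := GF (fun x => F (- x)).

Definition mirror (X : equipped 1) : equipped 1 :=
  ((fun z : J1 R 1 => (z.1.1, - z.1.2, - z.2)) @` X.1,
   class_map setT gf_mirror X.2).

(* If F generates L, then (q, w) |-> F (q + T, w) generates [translate T L]. *)
Definition translate (T : R) (L : set (J1 R 1)) : set (J1 R 1) :=
  [set z : J1 R 1 | L (z.1.1, z.1.2 + const_mx T, z.2)].

Definition gf_translate (T : R) (F : gf R 1) : gf R 1 :=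
  GF (fun x => F (x + const_mx T)).

Definition qcoord (z : J1 R 1) : R := z.1.2 0 0.

Definition trivial_off (L : set (J1 R 1)) (U : set R) :=
  forall z, ~ U (qcoord z) -> (L z <-> zero_section z).

(* The smallest connected open U such that L is the zero section off U, as the
   intersection of all of them: a smallest one need not exist when L has a
   cusp over an endpoint. *)
Definition supp (L : set (J1 R 1)) : set R :=
  [set q | forall U : set R, open U -> connected U -> trivial_off L U -> U q].

Definition concat (L L' : set (J1 R 1)) : set (J1 R 1) :=
  [set z : J1 R 1 | [\/ supp L (qcoord z) /\ L z, supp L' (qcoord z) /\ L' z |
    [/\ ~ supp L (qcoord z), ~ supp L' (qcoord z) & zero_section z]]].

Definition gf_sum (F F' : gf R 1) : gf R 1 :=
  GF (fun x (w : 'rV[R]_(gf_dim F + gf_dim F')) =>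
        F x (lsubmx w) + F' x (rsubmx w)).

Definition supports_separated (T : R) (L L' : set (J1 R 1)) :=
  forall q q', supp (translate T L) q -> supp (translate (- T) L') q' -> q < q'.

(* X # X', meaningful when T separates the supports. *)
Definition connected_sum (T : R) (X X' : equipped 1) : equipped 1 :=
  (concat (translate T X.1) (translate (- T) X'.1),
   class_map2 setT
     (fun F F' => gf_sum (gf_translate T F) (gf_translate (- T) F')) X.2 X'.2).

(* [X] + [X'] = [Z].  Concordance being an equivalence relation, equality of
   the classes of X # X' and Z is concordance of X # X' and Z. *)
Definition class_sum_eq (X X' Z : equipped 1) :=
  \forall T \near +oo, supports_separated T X.1 X'.1 /\
    gfqi_concordant (connected_sum T X X') Z.

End Knots.
Arguments equipped R n : clear implicits.

(* Main.v *)
(* A knot equipped with a gfqi is generated by some F = f + Q with f compactly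
   supported and Q a quadratic form: contours and regularity are invariant under
   equivalence.  It is the zero section outside a compact set, and being a
   connected curve it is globally parametrized by a line.

   Let chi be smooth with chi q = |q| for |q| >= 1.  For large T the sum of the
   mirror of F and F is supported, over each q, in one of the two fibre factors.
   A rotation exchanging these factors across q = 0 makes it the stabilization of
   the pullback of F by q |-> chi q - T.  This is the restriction to t = 0 of the
   pullback of F by h (q, t) = chi q - T + c t, which is a submersion, so that
   pulling back preserves regularity.  If c is large then chi q - T + c avoids the
   support of f, so the restriction to t = 1 is the quadratic form Q.

   The generated cobordism is fibred over the curve L, its fibre over the point
   with parameter s being {h = x s}.  Rescaling q by a factor depending on s
   identifies this with {h = s}, and these level sets foliate the strip. *)
Require Import Defs.
From HB Require Import structures.
From Stdlib Require Import Relation_Operators.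
From mathcomp Require Import all_boot all_order all_algebra.
From mathcomp Require Import all_classical all_reals all_analysis.
From mathcomp Require Import ring lra.
Set Implicit Arguments.
Unset Strict Implicit.
Unset Printing Implicit Defensive.
Import Order.TTheory GRing.Theory Num.Theory.
Import numFieldNormedType.Exports.
Local Open Scope classical_set_scope.
Local Open Scope ring_scope.

(** * Smooth maps on open sets *)

(** A Legendrian comes with local parametrizations only, whereas [diffeomorphic] asks for two maps
    that are smooth on the ambient spaces. The work on curves serves to obtain a global parameter of
    L together with a smooth function [delta] on J^1 that recovers it; the strip is then
    parametrized by one explicit formula. The function chi q - T can have critical points only on
    |q| <= 1, where chi differs from |q|; T is large enough to send this zone to where f vanishes.
    On the strip the slope c in t takes over. The rescaling of q is dictated by the edge t = 0: it
    has to carry {chi q - T = s} to {chi q - T = x s}, and t is then solved from h = x s. It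
    respects the edge t = 1 as well, because h > M there, so that x s = s and the factor is 1. Hence
    the closed strip and its interior are preserved. The sum in the other order is the same
    statement for the mirror, since mirroring twice gives back the knot. *)

Section ScaleBilinear.
Context {R : realType} {W : normedModType R}.

Lemma scaler_is_bilinear :
  bilinear_for
    (GRing.Scale.Law.clone _ _ *:%R _) (GRing.Scale.Law.clone _ _ *:%R _)
    (@GRing.scale R W).
Proof.
split=> [u'|u] a x y /=.
- by rewrite scalerDl scalerA.
- by rewrite scalerDr !scalerA mulrC.
Qed.
HB.instance Definition _ := bilinear_isBilinear.Build R R W W _ _
  (@GRing.scale R W) scaler_is_bilinear.

Global Instance is_diff_scale (p : R * W) :
  is_diff p (fun q => q.1 *: q.2) (fun q => p.1 *: q.2 + q.1 *: p.2).
Proof.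
apply: DiffDef; last by rewrite diff_bilin // => ?; apply: scale_continuous.
by apply: differentiable_bilin =>?; apply: scale_continuous.
Qed.

Global Instance is_diffZ2 (V : normedModType R) (a da : V -> R) (f df : V -> W) x :
  is_diff x a da -> is_diff x f df ->
  is_diff x (fun y => a y *: f y) (fun v => a x *: df v + da v *: f x).
Proof.
move=> dax dfx.
have -> : (fun y => a y *: f y) = (fun p => p.1 *: p.2) \o (fun y => (a y, f y)).
  by [].
by apply: is_diff_eq.
Qed.

End ScaleBilinear.

Section CkOn.
Context {R : realType}.
Implicit Types U V W : normedModType R.

(** The local form of [Ck]: transition maps, reciprocals and inverse functions are smooth only on an
    open set. *)
Fixpoint CkOn V W (O : set V) (k : nat) (f : V -> W) : Prop :=
  match k with
  | 0 => forall x, O x -> {for x, continuous f}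
  | k'.+1 => (forall x, O x -> differentiable f x) /\
             forall v, CkOn O k' ('D_v f)
  end.

Definition smooth_on V W (O : set V) (f : V -> W) := forall k, CkOn O k f.

Lemma Ck_CkOn V W k (f : V -> W) : Ck k f <-> CkOn setT k f.
Proof.
elim: k f => [|k IH] f /=; first by split => [h x _|h x]; exact: h.
split=> [[h1 h2]|[h1 h2]]; split.
- by move=> x _; apply: h1.
- by move=> v; apply/IH.
- by move=> x; apply: h1.
- by move=> v; apply/IH.
Qed.

Lemma smooth_onT V W (f : V -> W) : smooth f <-> smooth_on setT f.
Proof. by split=> h k; apply/Ck_CkOn. Qed.

(** The first order expansion of f at x is also one of g, and [diff_unique] identifies its linear
    part with the differential of g. *)
Lemma near_eq_differentiable V W (f g : V -> W) x :
  (\near x, f x = g x) -> differentiable f x -> differentiable g x.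
Proof.
move=> fg /diff_locallyP[df1 df2].
have fx : f x = g x by exact: nbhs_singleton fg.
have E : g \o shift x = cst (g x) + 'd f x +o_ 0 id.
  apply/eqaddoP => e e0.
  move/eqaddoP : df2 => /(_ e e0) H.
  have fg0 : \forall y \near (0 : V), f (y + x) = g (y + x).
    by move: fg; rewrite (near_shift 0 x) subr0.
  near=> y.
  have -> : ((g \o shift x) - (cst (g x) + 'd f x)) y =
            ((f \o shift x) - (cst (f x) + 'd f x)) y.
    by rewrite !fctE /= fx; congr (_ - _); rewrite -(near fg0 y).
  by near: y.
by apply/diff_locallyP; rewrite (diff_unique df1 E).
Unshelve. all: by end_near. Qed.

Lemma CkOn_eq V W (O : set V) k (f g : V -> W) : open O ->
  (forall x, O x -> f x = g x) -> CkOn O k f -> CkOn O k g.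
Proof.
move=> oO; elim: k f g => [|k IH] f g fg /=.
  move=> cf x Ox; rewrite /prop_for /continuous_at -fg//.
  apply: cvg_trans (cf x Ox); apply: near_eq_cvg.
  by near=> y; apply: fg; near: y; exact: open_nbhs_nbhs.
have nE x : O x -> \near x, f x = g x.
  by move=> Ox; near=> y; apply: fg; near: y; exact: open_nbhs_nbhs.
move=> [h1 h2]; split.
  by move=> x Ox; apply: near_eq_differentiable (h1 _ Ox); exact: nE.
move=> v; apply: IH (h2 v) => x Ox; apply: near_eq_derive; exact: nE.
Unshelve. all: by end_near. Qed.

Lemma CkOn_sub V W (O O' : set V) k (f : V -> W) :
  O' `<=` O -> CkOn O k f -> CkOn O' k f.
Proof.
move=> sO; elim: k f => [|k IH] f /=; first by move=> h x /sO; exact: h.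
by move=> [h1 h2]; split=> [x /sO|v]; [exact: h1|exact: IH].
Qed.

Lemma CkOn_local V W (O : set V) k (f : V -> W) :
  (forall x, O x -> exists2 N, open_nbhs x N & CkOn N k f) -> CkOn O k f.
Proof.
elim: k f => [|k IH] f /= h.
  by move=> x /h[N [_ Nx] c]; exact: c.
split.
  by move=> x /h[N [_ Nx] [c _]]; exact: c.
by move=> v; apply: IH => x /h[N oN [_ c]]; exists N.
Qed.

Lemma CkOn_cont V W (O : set V) k (f : V -> W) x :
  CkOn O k f -> O x -> {for x, continuous f}.
Proof.
case: k => [|k] /=; first exact.
by move=> [h _] /h /differentiable_continuous.
Qed.

Lemma CkOnW V W (O : set V) k (f : V -> W) : CkOn O k.+1 f -> CkOn O k f.
Proof.
elim: k f => [|k IH] f.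
  by move=> [h _] x /h /differentiable_continuous.
by move=> [h1 h2]; split=> // v; apply: IH.
Qed.

Lemma CkOn_cst V W (O : set V) k (a : W) : CkOn O k (fun=> a : W).
Proof.
elim: k a => [|k IH] a /=; first by move=> x _; exact: cst_continuous.
split=> [x _|v]; first exact: differentiable_cst.
rewrite (_ : 'D_v _ = (fun=> 0)); first exact: IH.
by apply/funext => x; exact: derive_cst.
Qed.

Lemma CkOn_lin V W (O : set V) k (f : {linear V -> W}) :
  continuous f -> CkOn O k f.
Proof.
move=> cf; case: k => [x _|k]; first exact: cf.
split=> [x _|v]; first exact: linear_differentiable.
rewrite (_ : 'D_v f = (fun=> f v)); first exact: CkOn_cst.
apply/funext => x; rewrite deriveE ?diff_lin//; exact: linear_differentiable.
Qed.

Lemma CkOnD V W (O : set V) k (f g : V -> W) : open O ->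
  CkOn O k f -> CkOn O k g -> CkOn O k (fun x => f x + g x).
Proof.
move=> oO; elim: k f g => [|k IH] f g /=.
  by move=> cf cg x Ox; apply: continuousD; [exact: cf|exact: cg].
move=> [f1 f2] [g1 g2]; split.
  by move=> x Ox; apply: differentiableD; [exact: f1|exact: g1].
move=> v; apply: (CkOn_eq oO) (IH _ _ (f2 v) (g2 v)) => x Ox /=.
by rewrite deriveD//; apply/diff_derivable; [exact: f1|exact: g1].
Qed.

Lemma CkOnZ V W (O : set V) k (a : V -> R) (f : V -> W) : open O ->
  CkOn O k a -> CkOn O k f -> CkOn O k (fun x => a x *: f x).
Proof.
move=> oO; elim: k a f => [|k IH] a f.
  by move=> /= cf cg x Ox; apply: continuousZ; [exact: cf|exact: cg].
move=> Ha Hf.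
have [a1 a2] := Ha; have [f1 f2] := Hf.
have da x : O x -> is_diff x (fun x => a x *: f x)
    (fun v => a x *: 'd f x v + 'd a x v *: f x).
  by move=> Ox; apply: is_diffZ2; apply: differentiableP; [exact: (a1 x Ox)|exact: (f1 x Ox)].
split => [x Ox|v]; first by case: (da x Ox).
apply: (CkOn_eq oO (f := fun x => a x *: 'D_v f x + 'D_v a x *: f x)).
  move=> x Ox; have dax := @ex_diff _ _ _ _ _ _ _ (da x Ox).
  rewrite (deriveE _ dax) (deriveE _ (a1 x Ox)) (deriveE _ (f1 x Ox)).
  exact/esym/(congr1 (@^~ v) (@diff_val _ _ _ _ _ _ _ (da x Ox))).
by apply: CkOnD => //; [exact: (IH _ _ (CkOnW Ha) (f2 v))|exact: (IH _ _ (a2 v) (CkOnW Hf))].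
Qed.

Lemma CkOn_sum V W (O : set V) k n (f : 'I_n -> V -> W) : open O ->
  (forall i, CkOn O k (f i)) -> CkOn O k (fun x => \sum_i f i x).
Proof.
move=> oO; elim: n f => [|n IH] f h.
  rewrite (_ : (fun _ => _) = (fun=> 0)); first exact: CkOn_cst.
  by apply/funext => x; rewrite big_ord0.
rewrite (_ : (fun _ => _) = (fun x => \sum_(i < n) f (widen_ord (leqnSn n) i) x
   + f ord_max x)); last by apply/funext => x; rewrite big_ord_recr.
by apply: CkOnD => //; exact: IH.
Qed.

Lemma CkOn_pair V W W' (O : set V) k (f : V -> W) (g : V -> W') : open O ->
  CkOn O k f -> CkOn O k g -> CkOn O k (fun x => (f x, g x)).
Proof.
move=> oO; elim: k f g => [|k IH] f g.
  by move=> /= cf cg x Ox; apply: cvg_pair; [exact: cf|exact: cg].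
move=> [f1 f2] [g1 g2].
have df x : O x -> differentiable (fun x => (f x, g x)) x.
  by move=> Ox; apply: differentiable_pair; [exact: f1|exact: g1].
split=> // v; apply: (CkOn_eq oO) (IH _ _ (f2 v) (g2 v)) => x Ox /=.
rewrite (deriveE _ (df x Ox)) (deriveE _ (f1 x Ox)) (deriveE _ (g1 x Ox)).
by rewrite diff_pair//; [exact: f1|exact: g1].
Qed.

Lemma CkOn_linl V W W' (O : set V) k (f : V -> W) (l : {linear W -> W'}) :
  open O -> continuous l -> CkOn O k f -> CkOn O k (fun x => l (f x)).
Proof.
move=> oO cl; elim: k f => [|k IH] f.
  by move=> /= cf x Ox; apply: continuous_comp; [exact: cf|exact: cl].
move=> [f1 f2].
have dl y : differentiable l y by exact: linear_differentiable.
have df x : O x -> differentiable (l \o f) x.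
  by move=> Ox; apply: differentiable_comp => //; exact: f1.
split=> // v; apply: (CkOn_eq oO) (IH _ (f2 v)) => x Ox /=.
rewrite (deriveE _ (df x Ox)) (deriveE _ (f1 x Ox)).
have /(congr1 (@^~ v))/= -> := diff_comp (f1 x Ox) (dl (f x)).
by have /(congr1 (@^~ ('d f x v))) -> := diff_lin (f x) cl.
Qed.

(* In finite dimension 'D_v (g \o f) is a sum of products of functions to which
   the induction hypothesis of [CkOn_comp] applies. *)
Class findim V : Prop := FinDim {
  findimP : exists n (e : 'I_n -> V) (c : 'I_n -> {linear V -> R}),
    (forall i, continuous (c i)) /\ forall v, v = \sum_i c i v *: e i }.

Lemma CkOn_comp U V W (fU : findim V) (O : set U) (O' : set V) k
    (f : U -> V) (g : V -> W) : open O ->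
  (forall x, O x -> O' (f x)) ->
  CkOn O k f -> CkOn O' k g -> CkOn O k (fun x => g (f x)).
Proof.
move=> oO fO; case: fU => -[n [e [c [cc ce]]]].
elim: k g => [|k IH] g.
  move=> /= cf cg x Ox; apply: continuous_comp; first exact: cf.
  by apply: cg; exact: fO.
move=> Hf [g1 g2]; have [f1 f2] := Hf.
have df x : O x -> differentiable (g \o f) x.
  by move=> Ox; apply: differentiable_comp => //; [exact: f1|apply: g1; exact: fO].
split=> // v.
apply: (CkOn_eq oO
  (f := fun x => \sum_i c i ('D_v f x) *: 'D_(e i) g (f x))).
  move=> x Ox; have dg := g1 _ (fO _ Ox).
  rewrite (deriveE _ (df x Ox)).
  have /(congr1 (@^~ v))/= -> := diff_comp (f1 x Ox) dg.
  rewrite -(deriveE _ (f1 x Ox)) [in RHS](ce ('D_v f x)) linear_sum.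
  by apply: eq_bigr => i _; rewrite linearZ/= (deriveE _ dg).
apply: CkOn_sum => // i; apply: CkOnZ => //.
  exact: (CkOn_linl oO (cc i) (f2 v)).
exact: (IH _ (CkOnW Hf) (g2 (e i))).
Qed.

Global Instance findim_R : findim R.
Proof.
split; exists 1%N, (fun=> 1), (fun=> idfun); split.
  by move=> i x.
by move=> v; rewrite big_ord1 /= [_ *: _]mulr1.
Qed.

Lemma coord_is_linear m n (i : 'I_m) (j : 'I_n) :
  linear (fun M : 'M[R]_(m, n) => M i j : R).
Proof. by move=> a u v; rewrite !mxE. Qed.

Definition coord_lin m n (i : 'I_m) (j : 'I_n) : {linear 'M[R]_(m, n) -> R} :=
  HB.pack (fun M : 'M[R]_(m, n) => M i j : R)
    (GRing.isLinear.Build _ _ _ _ _ (coord_is_linear i j)).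

Global Instance findim_rV n : findim 'rV[R]_n.
Proof.
split; exists n, (fun i => delta_mx 0 i), (fun i => coord_lin 0 i); split.
  by move=> i; exact: coord_continuous.
by move=> v; rewrite {1}(row_sum_delta v).
Qed.

Section prod_lin.
Variables (V W : normedModType R).

Lemma fst_is_linear (c : {linear V -> R}) : linear (fun z : V * W => c z.1).
Proof. by move=> a u v /=; rewrite linearP. Qed.
Lemma snd_is_linear (c : {linear W -> R}) : linear (fun z : V * W => c z.2).
Proof. by move=> a u v /=; rewrite linearP. Qed.

Definition fst_lin (c : {linear V -> R}) : {linear (V * W)%type -> R} :=
  HB.pack (fun z : V * W => c z.1)
    (GRing.isLinear.Build _ _ _ _ _ (fst_is_linear c)).
Definition snd_lin (c : {linear W -> R}) : {linear (V * W)%type -> R} :=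
  HB.pack (fun z : V * W => c z.2)
    (GRing.isLinear.Build _ _ _ _ _ (snd_is_linear c)).
End prod_lin.

Global Instance findim_prod V W (fV : findim V) (fW : findim W) :
  findim (V * W)%type.
Proof.
case: fV => -[n [e [c [cc ce]]]]; case: fW => -[m [e' [c' [cc' ce']]]].
split; exists (n + m)%N.
exists (fun i => match fintype.split i with inl j => (e j, 0) | inr j => (0, e' j) end).
exists (fun i => match fintype.split i with inl j => fst_lin W (c j)
                                  | inr j => snd_lin V (c' j) end).
split.
  move=> i; case: (fintype.split i) => j /= x.
    by apply: (@continuous_comp _ _ _ fst (c j)); [exact: cvg_fst|exact: cc].
  by apply: (@continuous_comp _ _ _ snd (c' j)); [exact: cvg_snd|exact: cc'].
move=> [v w]; rewrite big_split_ord /=.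
under eq_bigr do rewrite (unsplitK (inl _)) /=.
under [X in _ + X]eq_bigr do rewrite (unsplitK (inr _)) /=.
apply/pair_equal_spec; rewrite !raddf_sum /=; split.
  rewrite {1}(ce v) [X in _ + X]big1 ?addr0// => i _.
  by rewrite scaler0.
rewrite {1}(ce' w) [X in X + _]big1 ?add0r// => i _.
by rewrite scaler0.
Qed.

End CkOn.

Section SmoothOn.
Context {R : realType}.
Implicit Types (U V W : normedModType R).

Lemma smooth_on_eq V W (O : set V) (f g : V -> W) : open O ->
  (forall x, O x -> f x = g x) -> smooth_on O f -> smooth_on O g.
Proof. by move=> oO fg h k; exact: CkOn_eq (h k). Qed.

Lemma smooth_on_sub V W (O O' : set V) (f : V -> W) :
  O' `<=` O -> smooth_on O f -> smooth_on O' f.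
Proof. by move=> oO h k; exact: CkOn_sub (h k). Qed.

Lemma smooth_on_local V W (O : set V) (f : V -> W) :
  (forall x, O x -> exists2 N, open_nbhs x N & smooth_on N f) -> smooth_on O f.
Proof. by move=> h k; apply: CkOn_local => x /h[N oN s]; exists N. Qed.

Lemma smooth_on_cont V W (O : set V) (f : V -> W) x :
  smooth_on O f -> O x -> {for x, continuous f}.
Proof. by move=> /(_ 0%N); exact: CkOn_cont. Qed.

Lemma smooth_on_diff V W (O : set V) (f : V -> W) x :
  smooth_on O f -> O x -> differentiable f x.
Proof. by move=> /(_ 1%N)[h _]; exact: h. Qed.

Lemma smooth_diff V W (f : V -> W) : smooth_on setT f ->
  forall x, differentiable f x.
Proof. by move=> sf x; exact: (smooth_on_diff sf (I : setT x)). Qed.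

Lemma smooth_on_D V W (O : set V) (f : V -> W) v :
  smooth_on O f -> smooth_on O ('D_v f).
Proof. by move=> h k; have [_] := h k.+1; exact. Qed.

Lemma smooth_on_cst V W (O : set V) (a : W) : smooth_on O (fun=> a : W).
Proof. by move=> k; exact: CkOn_cst. Qed.

Lemma smooth_on_lin V W (O : set V) (f : {linear V -> W}) :
  continuous f -> smooth_on O f.
Proof. by move=> cf k; exact: CkOn_lin. Qed.

Lemma smooth_on_id V (O : set V) : smooth_on O (fun x => x).
Proof. by apply: (@smooth_on_lin _ _ _ idfun) => x. Qed.

Lemma smooth_on_fst V W (O : set (V * W)) : smooth_on O (fun x => x.1).
Proof. by apply: (@smooth_on_lin _ _ _ fst) => x; exact: cvg_fst. Qed.

Lemma smooth_on_snd V W (O : set (V * W)) : smooth_on O (fun x => x.2).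
Proof. by apply: (@smooth_on_lin _ _ _ snd) => x; exact: cvg_snd. Qed.

Lemma smooth_on_coord m n (O : set 'M[R]_(m, n)) i j :
  smooth_on O (fun x => x i j : R).
Proof.
by apply: (@smooth_on_lin _ _ _ (coord_lin i j)) => x; exact: coord_continuous.
Qed.

Lemma smooth_onD V W (O : set V) (f g : V -> W) : open O ->
  smooth_on O f -> smooth_on O g -> smooth_on O (fun x => f x + g x).
Proof. by move=> oO hf hg k; exact: CkOnD. Qed.

Lemma smooth_onZ V W (O : set V) (f : V -> R) (g : V -> W) : open O ->
  smooth_on O f -> smooth_on O g -> smooth_on O (fun x => f x *: g x).
Proof. by move=> oO hf hg k; exact: CkOnZ. Qed.

Lemma smooth_onM V (O : set V) (f g : V -> R) : open O ->
  smooth_on O f -> smooth_on O g -> smooth_on O (fun x => f x * g x).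
Proof. exact: smooth_onZ. Qed.

Lemma smooth_onN V W (O : set V) (f : V -> W) : open O ->
  smooth_on O f -> smooth_on O (fun x => - f x).
Proof.
move=> oO hf; under eq_fun do rewrite -scaleN1r.
by apply: smooth_onZ => //; exact: smooth_on_cst.
Qed.

Lemma smooth_onB V W (O : set V) (f g : V -> W) : open O ->
  smooth_on O f -> smooth_on O g -> smooth_on O (fun x => f x - g x).
Proof. by move=> oO hf hg; apply: smooth_onD => //; exact: smooth_onN. Qed.

Lemma smooth_on_sum V W (O : set V) n (f : 'I_n -> V -> W) : open O ->
  (forall i, smooth_on O (f i)) -> smooth_on O (fun x => \sum_i f i x).
Proof. by move=> oO h k; apply: CkOn_sum => // i; exact: h. Qed.

Lemma smooth_on_pair V W W' (O : set V) (f : V -> W) (g : V -> W') : open O ->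
  smooth_on O f -> smooth_on O g -> smooth_on O (fun x => (f x, g x)).
Proof. by move=> oO hf hg k; exact: CkOn_pair. Qed.

Lemma smooth_on_comp U V W (fV : findim V) (O : set U) (O' : set V)
    (f : U -> V) (g : V -> W) : open O ->
  (forall x, O x -> O' (f x)) ->
  smooth_on O f -> smooth_on O' g -> smooth_on O (fun x => g (f x)).
Proof. by move=> oO fO hf hg k; exact: (CkOn_comp _ oO fO (hf k) (hg k)). Qed.

Lemma smooth_on_compT U V W (fV : findim V) (O : set U)
    (f : U -> V) (g : V -> W) : open O ->
  smooth_on O f -> smooth_on setT g -> smooth_on O (fun x => g (f x)).
Proof. by move=> oO; exact: smooth_on_comp. Qed.

Lemma smooth_comp U V W (fV : findim V) (f : U -> V) (g : V -> W) :
  smooth_on setT f -> smooth_on setT g -> smooth_on setT (fun x => g (f x)).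
Proof. exact: (smooth_on_compT _ openT). Qed.

Lemma smooth_on_row V n (O : set V) (f : V -> 'rV[R]_n) : open O ->
  (forall i, smooth_on O (fun x => f x 0 i : R)) -> smooth_on O f.
Proof.
move=> oO h; rewrite (_ : f = fun x => \sum_i f x 0 i *: delta_mx 0 i).
  by apply: smooth_on_sum => // i; apply: smooth_onZ => //; exact: smooth_on_cst.
by apply/funext => x; rewrite {1}(row_sum_delta (f x)).
Qed.

Lemma smooth_on_inv (O : set R) : (forall x, O x -> x != 0) -> open O ->
  smooth_on O (fun x => x^-1).
Proof.
move=> h0 oO; elim => [|k IH].
  by move=> x Ox; apply: inv_continuous; exact: h0.
have di x : O x -> is_derive x 1 GRing.inv (- (x^-1 * x^-1) : R).
  move=> Ox; have x0 := h0 _ Ox.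
  apply: is_derive_eq (@is_deriveV R id x 1 1 x0 (is_derive_id _ _)) _.
  by rewrite /= scaleNr [_ *: _]mulr1 -exprVn expr2.
split=> [x /di [/derivable1_diffP//]|v].
apply: (@CkOn_eq _ _ _ O _ (fun x : R => - v * (x^-1 * x^-1) : R) _ oO).
  move=> x Ox /=; have dx : differentiable (@GRing.inv R) x.
    by have [/derivable1_diffP] := di _ Ox.
  rewrite (deriveE _ dx) -[v in RHS]mulr1 -[v * 1]/(v *: 1) linearZ /=.
  by rewrite -(deriveE _ dx); have [_ ->] := di _ Ox; rewrite scalerN mulNr.
apply: (@CkOnZ _ _ R) => //; first exact: CkOn_cst.
by apply: (@CkOnZ _ _ R).
Qed.

Lemma smooth_onV V (O : set V) (f : V -> R) : open O ->
  (forall x, O x -> f x != 0) -> smooth_on O f -> smooth_on O (fun x => (f x)^-1).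
Proof.
move=> oO h0 hf.
apply: (@smooth_on_comp _ _ _ _ _ [set x : R | x != 0]) => //.
apply: smooth_on_inv => //.
Qed.

End SmoothOn.

Ltac smooth_arith := repeat match goal with
  | |- smooth_on _ (fun x => @GRing.add _ _ _) => apply: (smooth_onD openT)
  | |- smooth_on _ (fun x => @GRing.opp _ _) => apply: (smooth_onN openT)
  | |- smooth_on _ (@GRing.opp _) => apply: (smooth_onN openT)
  | |- smooth_on _ (fun x => @GRing.mul _ _ _) => apply: (smooth_onM openT)
  | |- smooth_on _ (fun x => (_, _)) => apply: (smooth_on_pair openT)
  | |- _ => first [exact: smooth_on_cst | exact: smooth_on_id | exact: smooth_on_coord
                  | assumption]
  end.

(** * Smooth steps *)

Section RealFunctions.
Context {R : realType}.
Implicit Types (O : set R).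

Lemma deriveR1 (V : normedModType R) (f : R -> V) x v : differentiable f x ->
  'D_v f x = v *: 'D_1 f x.
Proof. by move=> df; rewrite !(deriveE _ df) -linearZ/= [_ *: _]mulr1. Qed.

Lemma CkOn_step1 (V : normedModType R) O k (f df : R -> V) : open O ->
  (forall x, O x -> is_derive x 1 f (df x)) -> CkOn O k df -> CkOn O k.+1 f.
Proof.
move=> oO h sdf.
have dif x : O x -> differentiable f x by move=> /h[/derivable1_diffP].
split=> // v; apply: (CkOn_eq oO (f := fun x => v *: df x)).
  by move=> x Ox; rewrite (deriveR1 _ (dif x Ox)); have [_ ->] := h x Ox.
by apply: CkOnZ => //; exact: CkOn_cst.
Qed.

Lemma smooth_cos_sin : smooth_on setT (@cos R) /\ smooth_on setT (@sin R).
Proof.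
suff H k : CkOn setT k (@cos R) /\ CkOn setT k (@sin R).
  by split=> k; case: (H k).
elim: k => [|k [IHc IHs]].
  by split=> x _; [exact: continuous_cos|exact: continuous_sin].
split; last exact: (CkOn_step1 openT _ IHc).
apply: (CkOn_step1 openT (df := fun x => - sin x)) => //.
under eq_fun do rewrite -mulN1r.
by apply: (@CkOnZ _ _ R) => //; [exact: openT|exact: CkOn_cst].
Qed.

(** The functions x^(-n) e^(-1/x), extended by 0. Up to linear combinations the family is closed
    under differentiation, so smoothness follows by induction on the order for all n at once. *)
Definition flat n (x : R) : R := if 0 < x then x^-1 ^+ n * expR (- x^-1) else 0.

Lemma flat_ge0 n x : 0 <= flat n x.
Proof.
by rewrite /flat; case: ifP => // x0; rewrite mulr_ge0// ?expR_ge0// exprn_ge0// invr_ge0 ltW.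
Qed.

Lemma flat_gt0 n x : 0 < x -> 0 < flat n x.
Proof. by move=> x0; rewrite /flat x0 mulr_gt0// ?expR_gt0// exprn_gt0// invr_gt0. Qed.

Lemma flat_le0 n x : x <= 0 -> flat n x = 0.
Proof. by move=> x0; rewrite /flat ltNge x0. Qed.

(** Turns the difference quotient of [flat n] at 0 into [flat n.+1], so that differentiability at 0
    reduces to a limit. *)
Lemma flatS n x : flat n x = x * flat n.+1 x.
Proof.
rewrite /flat; case: ifPn => [x0|_]; last by rewrite mulr0.
by rewrite exprS !mulrA divff ?mul1r// gt_eqF.
Qed.

(** This is e^y >= y^(n+1) / (n+1)! at y = 1/x. *)
Lemma flat_le n x : 0 < x -> flat n x <= n.+1`!%:R * x.
Proof.
move=> x0; have ix : 0 <= x^-1 by rewrite invr_ge0 ltW.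
have := @expR_ge1Dxn R x^-1 n ix.
rewrite /flat x0 expRN => H.
have f0 : 0 < n.+1`!%:R :> R by rewrite ltr0n fact_gt0.
rewrite ler_pdivrMr ?expR_gt0//.
have {}H : x^-1 ^+ n.+1 <= n.+1`!%:R * expR x^-1.
  by rewrite mulrC -ler_pdivrMr//; apply: le_trans H; rewrite lerDr.
rewrite mulrAC -ler_pdivrMr//; apply: le_trans H.
by rewrite exprSr.
Qed.

Lemma is_derive_flat (n : nat) (x : R) :
  is_derive x (1 : R) (flat n) (flat n.+2 x - n%:R * flat n.+1 x).
Proof.
have [x0|x0|<-] := ltgtP 0 x.
- apply: (@near_eq_is_derive R R R (fun y : R => y^-1 ^+ n * expR (- y^-1) : R) (flat n) x 1).
    near=> y; rewrite /flat ifT//; near: y; exact: lt_nbhsr.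
  have xN0 : x != 0 by rewrite gt_eqF.
  have dV : is_derive x 1 (fun y : R => y^-1) (- x^-1 ^+ 2).
    apply: is_derive_eq (@is_deriveV R id x 1 1 xN0 (is_derive_id _ _)) _.
    by rewrite /= scaleNr [_ *: _]mulr1 -exprVn.
  have dX := @is_deriveX _ _ _ n _ _ _ dV.
  have dE : is_derive x 1 (fun y : R => expR (- y^-1)) (x^-1 ^+ 2 * expR (- x^-1)).
    have dN : is_derive x 1 (fun y : R => - y^-1) (x^-1 ^+ 2).
      by apply: is_derive_eq (is_deriveN dV) _; rewrite opprK.
    apply: is_derive_eq (@is_derive1_comp _ expR _ x _ _ _ dN) _.
    by rewrite mulrC.
  rewrite (_ : (fun y : R => y^-1 ^+ n * expR (- y^-1)) = ([eta GRing.inv] ^+ n) *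
    (fun y : R => expR (- y^-1))); last by apply/funext => y; rewrite !fctE.
  apply: is_derive_eq (is_deriveM dX dE) _; rewrite !fctE.
  rewrite /flat x0 /= /GRing.scale/=.
  case: n {dX} => [|n].
    by rewrite /=; ring.
  by rewrite /= !exprS; ring.
- apply: (@near_eq_is_derive R R R (cst 0) (flat n) x 1).
    near=> y; rewrite flat_le0//; apply: ltW; near: y; exact: lt_nbhsl.
  by rewrite !flat_le0 ?ltW// mulr0 subr0; exact: is_derive_cst.
rewrite !flat_le0// mulr0 subr0.
have dq h : h != 0 -> h^-1 *: (flat n (h *: 1 + 0) - flat n 0) = flat n.+1 h.
  move=> h0; rewrite [h *: _]mulr1 addr0 (@flat_le0 n 0)// subr0.
  by rewrite (flatS n h) /GRing.scale/= mulrA mulVf// mul1r.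
have L : h^-1 *: (flat n (h *: 1 + 0) - flat n 0) @[h --> 0^'] --> (0:R).
  apply/cvgrPdist_le => e e0 /=; near=> h.
  have h0 : h != 0 by near: h; exact: nbhs_dnbhs_neq.
  rewrite dq// sub0r normrN ger0_norm ?flat_ge0//.
  have [hp|hn] := ltP 0 h; last by rewrite flat_le0// ltW.
  apply: le_trans (flat_le _ hp) _.
  have f0 : 0 < n.+2`!%:R :> R by rewrite ltr0n fact_gt0.
  rewrite mulrC -ler_pdivlMr//; apply: le_trans (ler_norm h) _.
  near: h; apply: dnbhs0_le; exact: divr_gt0.
by apply: DeriveDef; [apply/cvg_ex; exists 0|exact/cvg_lim].
Unshelve. all: by end_near. Qed.

Lemma smooth_flat n : smooth_on setT (flat n).
Proof.
move=> k; elim: k n => [|k IH] n.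
  move=> x _; apply: differentiable_continuous.
  by have [/derivable1_diffP] := is_derive_flat n x.
apply: (CkOn_step1 openT (df := fun x => flat n.+2 x - n%:R * flat n.+1 x)).
  by move=> x _; exact: is_derive_flat.
apply: CkOnD => //; first exact: openT.
under eq_fun do rewrite -mulNr.
by apply: (@CkOnZ _ _ R) => //; [exact: openT|exact: CkOn_cst].
Qed.

Definition sstep (x : R) : R := flat 0 x / (flat 0 x + flat 0 (1 - x)).

Lemma sstep_den_gt0 x : 0 < flat 0 x + flat 0 (1 - x).
Proof.
have [x0|x0] := ltP 0 x; first by rewrite ltr_wpDr ?flat_ge0 ?flat_gt0.
by rewrite ltr_wpDl ?flat_ge0// flat_gt0// subr_gt0; lra.
Qed.

Lemma smooth_sstep : smooth_on setT sstep.
Proof.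
have sf := smooth_flat 0.
apply: smooth_onM => //; first exact: openT.
apply: smooth_onV; first exact: openT.
  by move=> x _; rewrite gt_eqF// sstep_den_gt0.
apply: smooth_onD => //; first exact: openT.
apply: smooth_on_compT => //; first exact: openT.
by apply: smooth_onB; [exact: openT|exact: smooth_on_cst|exact: smooth_on_id].
Qed.

Lemma sstep0 x : x <= 0 -> sstep x = 0.
Proof. by move=> x0; rewrite /sstep flat_le0// mul0r. Qed.

Lemma sstep1 x : 1 <= x -> sstep x = 1.
Proof.
move=> x1; have := sstep_den_gt0 x.
rewrite /sstep (@flat_le0 0 (1 - x)) ?subr_le0// addr0 => h.
by rewrite divff// gt_eqF.
Qed.

Lemma sstep_ge0 x : 0 <= sstep x.
Proof. by rewrite divr_ge0 ?flat_ge0// ltW// sstep_den_gt0. Qed.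

Lemma sstep_le1 x : sstep x <= 1.
Proof. by rewrite ler_pdivrMr ?sstep_den_gt0// mul1r lerDl flat_ge0. Qed.

End RealFunctions.

(** * Monotone functions and inverse functions on the line *)

Section RealPrelim.
Context {R : realType}.

(** With f = [flat 0], f' = [flat 2] and h the denominator, the quotient rule gives (f'(x) f(1 - x)
    + f(x) f'(1 - x)) / h^2, and every factor is nonnegative. *)
Lemma sstep_derive (x : R) : exists2 d, is_derive x (1:R) (@sstep R) d & 0 <= d.
Proof.
pose f := @flat R 0; pose h (x : R) := f x + f (1 - x).
have hx0 : h x != 0 by rewrite gt_eqF// sstep_den_gt0.
have df := is_derive_flat 0 x.
have dg : is_derive x (1:R) (fun x => f (1 - x)) (- flat 2 (1 - x)).
  have d1 : is_derive x (1:R) (fun x : R => 1 - x) (-1).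
    have := is_deriveB (is_derive_cst (1:R) x 1) (is_derive_id x (1:R)).
    by rewrite sub0r.
  apply: is_derive_eq (@is_derive1_comp _ f _ x _ _ (is_derive_flat 0 _) d1) _.
  by rewrite mul0r subr0 mulrN1.
have dh : is_derive x (1:R) h (flat 2 x - flat 2 (1 - x)).
  by apply: is_derive_eq (is_deriveD df dg) _; rewrite mul0r subr0.
have dV := @is_deriveV _ _ _ _ _ hx0 dh.
have dM := is_deriveM df dV.
exists (((flat 2 x) * f (1 - x) + f x * flat 2 (1 - x)) * (h x) ^- 2).
  apply: is_derive_eq dM _.
  rewrite mul0r subr0 /GRing.scale /=.
  have -> : (h x)^-1 = h x * (h x)^-2 by rewrite expr2 invfM mulrA divff// mul1r.
  by rewrite /h -/f; ring.
by rewrite mulr_ge0 ?addr_ge0 ?mulr_ge0 ?flat_ge0// invr_ge0 exprn_ge0// ltW// sstep_den_gt0.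
Qed.

(** The exit point is the infimum of the points right of x0 outside W; it lies outside W because W
    is open. *)
Lemma first_exit (W : set R) x0 m : open W -> W x0 -> ~ W m -> x0 < m ->
  exists e, [/\ x0 < e, e <= m, ~ W e & forall x, x0 <= x < e -> W x].
Proof.
move=> oW W0 Wm x0m.
pose E := [set x | x0 <= x /\ ~ W x].
have hE : has_inf E.
  by split; [exists m; split => //; exact: ltW|exists x0 => x []].
have infle y : E y -> inf E <= y by move=> Ey; apply: ge_inf => //; case: hE.
have Ee : ~ W (inf E).
  move=> We; have : nbhs (inf E) W by exact: open_nbhs_nbhs.
  move=> /nbhs_ballP[e /= e0 be].
  have [x [x0x Wx] xe] := inf_adherent e0 hE.
  have hx := infle x (conj x0x Wx).
  by apply: Wx; apply: be; rewrite /ball/= ltr_norml; apply/andP; split; lra.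
have x0e : x0 <= inf E by apply: lb_le_inf; [case: hE|move=> x []].
exists (inf E); split => //.
- by rewrite lt_neqAle x0e andbT; apply/eqP => h; apply: Ee; rewrite -h.
- by apply: infle; split => //; exact: ltW.
- move=> x /andP[x0x xe]; apply: contrapT => Wx.
  by have := infle x (conj x0x Wx); rewrite leNgt xe.
Qed.

Lemma last_entry (W : set R) x0 m : open W -> W x0 -> ~ W m -> m < x0 ->
  exists e, [/\ e < x0, m <= e, ~ W e & forall x, e < x <= x0 -> W x].
Proof.
move=> oW W0 Wm x0m.
have oW' : open [set x | W (- x)].
  apply: (@open_comp _ _ (@GRing.opp R) W) => // x _.
  exact: opp_continuous.
have [||||e [h1 h2 h3 h4]] := @first_exit [set x | W (- x)] (- x0) (- m).
- exact: oW'.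
- by rewrite /= opprK.
- by rewrite /= opprK.
- by rewrite ltrN2.
exists (- e); split => //; [lra|lra|].
by move=> x xe; rewrite -(opprK x); apply: h4; lra.
Qed.

(** The mean value theorem gives one point where the derivative is positive; a nonpositive value
    elsewhere would produce a zero by the intermediate value theorem. *)
Lemma pos_derive (f df : R -> R) (a b : R) : a <= b ->
  (forall x : R, a <= x <= b -> is_derive x (1:R) f (df x)) ->
  (forall x : R, a <= x <= b -> {for x, continuous df}) ->
  (forall x, a <= x <= b -> df x != 0) -> f a < f b ->
  forall x, a <= x <= b -> 0 < df x.
Proof.
move=> ab dfx cdf n0 fab x xab.
have ab' : a < b by rewrite lt_neqAle ab andbT; apply: contraTN fab => /eqP ->; rewrite ltxx.
have [||c cab fE] := @MVT R f df a b ab'.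
- by move=> y; rewrite in_itv/= => /andP[h1 h2]; apply: dfx; rewrite !ltW.
- apply: derivable_within_continuous => y; rewrite in_itv/= => h.
  by have [] := dfx y h.
have {}cab : a <= c <= b by move: cab; rewrite in_itv/= => /andP[h1 h2]; rewrite !ltW.
have h : 0 < b - a by lra.
have dc : 0 < df c by rewrite -(pmulr_lgt0 _ h) -fE subr_gt0.
rewrite ltNge; apply/negP => dx.
have sub : forall u v, a <= u -> v <= b -> {within `[u, v], continuous df}.
  move=> u v au vb; apply: continuous_in_subspaceT => y; rewrite inE/= in_itv/= => /andP[h1 h2].
  by apply: cdf; lra.
have [xc|cx] := leP x c.
  have [||y] := @IVT R df x c 0 xc; first by apply: sub; lra.
    by rewrite ge_min dx/= le_max (ltW dc) orbT.
  rewrite in_itv/= => /andP[h1 h2] y0.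
  have /n0 : a <= y <= b by lra.
  by rewrite y0 eqxx.
have [||y] := @IVT R df c x 0 (ltW cx); first by apply: sub; lra.
  by rewrite ge_min dx/= orbT le_max (ltW dc).
rewrite in_itv/= => /andP[h1 h2] y0.
have /n0 : a <= y <= b by lra.
by rewrite y0 eqxx.
Qed.

Lemma pos_derive_lt (f : R -> R) (I : set R) : is_interval I ->
  (forall x, I x -> exists2 d, is_derive x (1:R) f d & 0 < d) ->
  forall x y, I x -> I y -> x < y -> f x < f y.
Proof.
move=> iI h x y Ix Iy xy.
have hd z : x <= z <= y -> is_derive z (1:R) f ('D_1 f z) /\ 0 < 'D_1 f z.
  move=> /(iI _ _ Ix Iy) /h [d dd d0].
  by have [/derivableP ? dE] := dd; split => //; rewrite dE.
have [||c cab fE] := @MVT R f ('D_1 f) x y xy.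
- by move=> z; rewrite in_itv/= => /andP[h1 h2]; have [|] := hd z _ => //; rewrite !ltW.
- apply: derivable_within_continuous => z; rewrite in_itv/= => hz.
  by have [[]] := hd z hz.
have {}cab : x <= c <= y by move: cab; rewrite in_itv/= => /andP[h1 h2]; rewrite !ltW.
by rewrite -subr_gt0 fE mulr_gt0 ?subr_gt0//; have [] := hd c cab.
Qed.

(** The image is open by the intermediate value theorem. Smoothness is a bootstrap: r' = 1 / s'(r)
    is as regular as r itself. *)
Lemma smooth_on_inverse (s r : R -> R) (I : set R) : is_interval I -> open I ->
  smooth_on I s ->
  (forall x, I x -> exists2 d, is_derive x (1:R) s d & 0 < d) ->
  (forall x, I x -> r (s x) = x) ->
  open (s @` I) /\ smooth_on (s @` I) r.
Proof.
move=> iI oI ss ds rs.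
have nI x : I x -> nbhs x I by move=> Ix; exact: open_nbhs_nbhs.
have rsn x : I x -> {near x, cancel s r}.
  by move=> Ix; near=> y; apply: rs; near: y; exact: nI.
have scn x : I x -> {near x, continuous s}.
  move=> Ix; near=> y; apply: (smooth_on_cont ss); near: y; exact: nI.
have oJ : open (s @` I).
  rewrite openE => _ [x Ix <-].
  have /nbhs_ballP[e /= e0 be] := nI x Ix.
  have Ie y : x - e < y < x + e -> I y.
    by move=> he; apply: be; rewrite /ball/= ltr_norml; lra.
  have Im : I (x - e / 2) by apply: Ie; lra.
  have Ip : I (x + e / 2) by apply: Ie; lra.
  have mono := pos_derive_lt iI ds.
  have l1 : s (x - e / 2) < s x by apply: mono => //; lra.
  have l2 : s x < s (x + e / 2) by apply: mono => //; lra.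
  have h : \forall y \near s x, s (x - e / 2) < y < s (x + e / 2).
    near=> y; apply/andP; split; near: y; [exact: lt_nbhsr|exact: lt_nbhsl].
  apply: filterS h => y /andP[h1 h2].
  have le : x - e / 2 <= x + e / 2 by lra.
  have [||z] := @IVT R s _ _ y le.
  - apply: continuous_in_subspaceT => z; rewrite inE/= in_itv/= => hz.
    by apply: (smooth_on_cont ss); apply: Ie; lra.
  - by rewrite ge_min le_max (ltW h1) (ltW h2) orbT.
  - rewrite in_itv/= => hz <-; exists z => //; apply: Ie; lra.
split => // k.
have dr x : I x -> is_derive (s x) (1:R) r (('D_1 s x)^-1).
  move=> Ix; have [d dd d0] := ds x Ix.
  have [_ ->] := dd; apply: is_derive_inverse (rsn x Ix) (scn x Ix) dd _.
  by rewrite gt_eqF.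
elim: k => [|k IH].
  move=> _ [x Ix <-]; apply: differentiable_continuous.
  by have [/derivable1_diffP] := dr x Ix.
apply: (CkOn_step1 oJ (df := fun y => ('D_1 s (r y))^-1)).
  by move=> _ [x Ix <-]; rewrite rs//; exact: dr.
have sD : smooth_on I (fun x => ('D_1 s x)^-1).
  apply: smooth_onV => //; last exact: smooth_on_D.
  by move=> x Ix; have [d [_ ->] d0] := ds x Ix; rewrite gt_eqF.
apply: (CkOn_comp _ oJ _ IH (sD k)).
by move=> _ [x Ix <-]; rewrite rs.
Unshelve. all: by end_near. Qed.

End RealPrelim.

(** * Connected curves that are lines near both ends *)

Section Arcs.
Context {R : realType} {J : normedModType R} {fJ : findim J} (L : set J).
Implicit Types (I : set R) (gam phi : R -> J) (g k : J -> R).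

Lemma open_preimI (V W : normedModType R) (O : set V) (N : set W) (f : V -> W) :
  open O -> open N -> smooth_on O f -> open (O `&` f @^-1` N).
Proof.
rewrite !openE => oO oN sf x [Ox Nx]; apply: filterI; first exact: oO.
exact: (smooth_on_cont sf Ox (oN _ Nx)).
Qed.

Lemma near_open (V : normedModType R) (x : V) (P : V -> Prop) :
  (\forall z \near x, P z) -> exists N, [/\ open N, N x & forall y, N y -> P y].
Proof.
move=> h; exists ([set z | P z]^°); split; [exact: open_interior|exact: h|].
by move=> y /interior_subset.
Qed.

Definition smooth_along (z : J) (g : J -> R) := exists N psi,
  [/\ open N, N z, smooth_on N psi & forall y, N y -> L y -> g y = psi y].

(* The inverse g of gam need not be continuous on J; it extends smoothly from L
   near each point of the arc. *)
Record arc I gam g : Prop := Arc {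
  arc_open : open I;
  arc_smooth : smooth_on I gam;
  arc_in : forall s, I s -> L (gam s);
  arc_can : forall s, I s -> g (gam s) = s;
  arc_along : forall s, I s -> smooth_along (gam s) g;
  arc_near : forall s, I s ->
    \forall z \near gam s, L z -> exists2 t, I t & gam t = z }.

Lemma arc_sub I I' gam g : arc I gam g -> open I' -> I' `<=` I -> arc I' gam g.
Proof.
move=> A oI' sI; split => //.
- exact: smooth_on_sub sI (arc_smooth A).
- by move=> s /sI; exact: (arc_in A).
- by move=> s /sI; exact: (arc_can A).
- by move=> s /sI; exact: (arc_along A).
move=> s I's; have Is := sI _ I's.
have [N [psi [oN Ns spsi gpsi]]] := arc_along A Is.
have psis : psi (gam s) = s by rewrite -(gpsi _ Ns (arc_in A Is)) (arc_can A Is).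
(* Points of L near [gam s] lie on the arc, and their parameters, read by the continuous function
   [psi], stay in the open set I'. *)
have nI : \forall z \near gam s, I' (psi z).
  by apply: (smooth_on_cont spsi Ns); rewrite psis; exact: open_nbhs_nbhs.
near=> z => Lz.
have [t It tz] : exists2 t, I t & gam t = z.
  by move: Lz; near: z; exact: (arc_near A).
exists t => //; rewrite -(arc_can A It) tz gpsi//.
  by near: z.
by near: z; exact: open_nbhs_nbhs.
Unshelve. all: by end_near. Qed.

Lemma arc_reparam I I2 gam g (rho r : R -> R) : arc I gam g -> open I2 ->
  smooth_on I2 rho -> smooth_on I r ->
  (forall s, I2 s -> I (rho s) /\ r (rho s) = s) ->
  (forall s, I s -> I2 (r s) /\ rho (r s) = s) ->
  arc I2 (fun s => gam (rho s)) (fun z => r (g z)).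
Proof.
move=> A oI2 srho sr h1 h2; split => //.
- apply: (smooth_on_comp _ oI2 _ srho (arc_smooth A)).
  by move=> s /h1[].
- by move=> s /h1[h _]; exact: (arc_in A).
- by move=> s /h1[h e]; rewrite (arc_can A).
- move=> s /h1[h e].
  have [N [psi [oN Ns spsi gpsi]]] := arc_along A h.
  exists (N `&` psi @^-1` I), (fun z => r (psi z)).
  have oN' : open (N `&` psi @^-1` I).
    by apply: open_preimI => //; exact: (arc_open A).
  split => //.
  + by split => //=; rewrite -(gpsi _ Ns (arc_in A h)) (arc_can A h).
  + apply: (smooth_on_comp _ oN' _ _ sr); first by move=> x [].
    by apply: smooth_on_sub spsi; exact: subIsetl.
  + by move=> y [Ny _] Ly; rewrite gpsi.
- move=> s /h1[h e]; apply: filterS (arc_near A h) => z H /H [t It tz].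
  by have [a b] := h2 t It; exists (r t) => //; rewrite b.
Qed.

Lemma arc_opp I gam g : arc I gam g ->
  arc [set x | I (- x)] (fun s => gam (- s)) (fun z => - g z).
Proof.
move=> A.
have sN O : open O -> smooth_on O (fun x : R => - x).
  by move=> oO; apply: smooth_onN => //; exact: smooth_on_id.
have oI' : open [set x | I (- x)].
  have := @open_preimI R R setT I (fun x : R => - x) openT (arc_open A) (sN _ openT).
  by rewrite setTI.
apply: (arc_reparam A) => //.
- exact: sN.
- by apply: sN; exact: (arc_open A).
- by move=> s Is; rewrite opprK.
- by move=> s Is; rewrite /= opprK.
Qed.

(** The second agreement hypothesis makes the two inverses coincide on common points. By [arc_near],
    all points of L near an arc are on that arc, so each local extension of one inverse also extends
    the glued one. *)
Lemma arc_union I I' gam g phi k : arc I gam g -> arc I' phi k ->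
  (forall s, I s -> I' s -> gam s = phi s) ->
  (forall s x, I s -> I' x -> gam s = phi x -> s = x) ->
  exists gam' g', arc (I `|` I') gam' g' /\
    (forall s, I s -> gam' s = gam s) /\ (forall s, I' s -> gam' s = phi s).
Proof.
move=> A B h1 h2.
pose gam' s := if pselect (I s) then gam s else phi s.
pose g' z := if pselect (exists2 s, I s & gam s = z) then g z else k z.
have e1 s : I s -> gam' s = gam s by rewrite /gam'; case: pselect.
have e2 s : I' s -> gam' s = phi s.
  by rewrite /gam'; case: pselect => // Is I's; exact: h1.
have f1 z : (exists2 s, I s & gam s = z) -> g' z = g z.
  by rewrite /g'; case: pselect.
have f2 z : (exists2 s, I' s & phi s = z) -> g' z = k z.
  move=> [x Ix <-]; rewrite /g'; case: pselect => // -[s Is e].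
  by rewrite -[in LHS]e (arc_can A)// (arc_can B)//; exact: h2.
exists gam', g'; split; last by split.
split.
- by apply: openU; [exact: (arc_open A)|exact: (arc_open B)].
- apply: smooth_on_local => x [Ix|Ix].
    exists I; first by split => //; exact: (arc_open A).
    by apply: smooth_on_eq (arc_smooth A); [exact: (arc_open A)|move=> y /e1].
  exists I'; first by split => //; exact: (arc_open B).
  by apply: smooth_on_eq (arc_smooth B); [exact: (arc_open B)|move=> y /e2].
- move=> s [Is|Is]; first by rewrite e1//; exact: (arc_in A).
  by rewrite e2//; exact: (arc_in B).
- move=> s [Is|Is].
    by rewrite e1// f1; [exact: (arc_can A)|exists s].
  by rewrite e2// f2; [exact: (arc_can B)|exists s].
- move=> s [Is|Is].
    rewrite e1//.
    have [N [psi [oN Ns spsi gpsi]]] := arc_along A Is.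
    have [N2 [oN2 N2s hN2]] := near_open (arc_near A Is).
    exists (N `&` N2), psi; split => //.
    + exact: openI.
    + by apply: smooth_on_sub spsi; exact: subIsetl.
    + by move=> y [Ny N2y] Ly; rewrite f1 ?(gpsi _ Ny Ly)//; exact: (hN2 _ N2y Ly).
  rewrite e2//.
  have [N [psi [oN Ns spsi gpsi]]] := arc_along B Is.
  have [N2 [oN2 N2s hN2]] := near_open (arc_near B Is).
  exists (N `&` N2), psi; split => //.
  + exact: openI.
  + by apply: smooth_on_sub spsi; exact: subIsetl.
  + by move=> y [Ny N2y] Ly; rewrite f2 ?(gpsi _ Ny Ly)//; exact: (hN2 _ N2y Ly).
- move=> s [Is|Is].
    rewrite e1//; apply: filterS (arc_near A Is) => z H /H [t It tz].
    by exists t; [left|rewrite e1].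
  rewrite e2//; apply: filterS (arc_near B Is) => z H /H [t It tz].
  by exists t; [right|rewrite e2].
Qed.

Section Transition.
Variables (I : set R) (gam : R -> J) (g : J -> R).
Variables (I' : set R) (phi : R -> J) (k : J -> R).

(** The domain of the transition map [g \o phi] from the chart to the arc. *)
Definition overlap := [set x | I' x /\ exists2 s, I s & gam s = phi x].

Hypotheses (A : arc I gam g) (B : arc I' phi k).

(** [arc_near] says that an arc is open in L, so this is continuity of the chart. *)
Lemma overlap_open : open overlap.
Proof.
rewrite openE => x [Ix [s Is e]].
have := arc_near A Is; rewrite e => h.
have h' := smooth_on_cont (arc_smooth B) Ix h.
near=> y.
have Iy : I' y by near: y; apply: open_nbhs_nbhs; split => //; exact: (arc_open B).
split => //.
have : L (phi y) -> exists2 t, I t & gam t = phi y by near: y.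
by apply; exact: (arc_in B).
Unshelve. all: by end_near. Qed.

Lemma overlapE x : overlap x -> I (g (phi x)) /\ gam (g (phi x)) = phi x.
Proof. by move=> [_ [s Is <-]]; rewrite (arc_can A). Qed.

Lemma transition_smooth : smooth_on overlap (fun x => g (phi x)).
Proof.
apply: smooth_on_local => x Wx; have [Ix [s Is e]] := Wx.
have [N [psi [oN Ns spsi gpsi]]] := arc_along A Is.
have sphi : smooth_on overlap phi by apply: smooth_on_sub (arc_smooth B) => y [].
have oN' := open_preimI overlap_open oN sphi.
exists (overlap `&` phi @^-1` N); first by split => //; split => //=; rewrite -e.
apply: (smooth_on_eq oN' (f := fun x => psi (phi x))).
  by move=> y [[Iy _] Ny]; rewrite gpsi//; exact: (arc_in B).
apply: (smooth_on_comp _ oN' _ _ spsi); first by move=> y [].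
by apply: smooth_on_sub sphi; exact: subIsetl.
Qed.

End Transition.

(** The transition in the opposite direction is a local inverse, so by the chain rule the two
    derivatives have product 1. *)
Lemma transition_deriv_neq0 I gam g I' phi k :
  arc I gam g -> arc I' phi k ->
  forall x, overlap I gam I' phi x -> 'D_1 (fun x => g (phi x)) x != 0.
Proof.
move=> A B x Wx; have [Ix [s Is e]] := Wx.
have [a b] := overlapE A Wx.
have W' : overlap I' phi I gam (g (phi x)) by split => //; exists x.
have d1 := smooth_on_diff (transition_smooth A B) Wx.
have d2 := smooth_on_diff (transition_smooth B A) W'.
have {}d1 : is_derive x (1:R) (fun x => g (phi x)) ('D_1 (fun x => g (phi x)) x).
  by apply/derivableP; exact: diff_derivable.
have {}d2 : is_derive (g (phi x)) (1:R) (fun x => k (gam x))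
    ('D_1 (fun x => k (gam x)) (g (phi x))).
  by apply/derivableP; exact: diff_derivable.
have d3 := is_derive1_comp d2 d1.
have d4 : is_derive x (1:R) ((fun x => k (gam x)) \o (fun x => g (phi x))) 1.
  apply: near_eq_is_derive (is_derive_id x (1:R)).
  near=> y; rewrite /=.
  have Wy : overlap I gam I' phi y.
    by near: y; apply: open_nbhs_nbhs; split => //; exact: overlap_open A B.
  have [_ ->] := overlapE A Wy; rewrite (arc_can B)//; by case: Wy.
have [_ E1] := d3; have [_ E2] := d4.
apply/eqP => z0; move: E1; rewrite E2 z0 mulr0 => /eqP; by rewrite oner_eq0.
Unshelve. all: by end_near. Qed.

End Arcs.

(** * Extending an arc along a chart *)

Section Extension.
Context {R : realType} {J : normedModType R} {fJ : findim J} (L : set J).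
Variables (e0 : R -> J) (qc : J -> R).
Hypothesis qc_cont : continuous qc.
Hypothesis qc_e0 : forall s, qc (e0 s) = s.
Implicit Types (I : set R) (gam phi : R -> J) (g k : J -> R).

(* Arcs starting with the left end of the line e0. *)
Record iarc I gam g : Prop := IArc {
  iarc_arc : arc L I gam g;
  iarc_down : forall s t, I s -> t <= s -> I t;
  iarc_init : exists M0, forall s, s < M0 -> I s /\ gam s = e0 s }.

(* A chart leaving the arc can only do so at the upper end of the arc: the rest
   of the arc is either compact, hence closed, or escapes to infinity. *)
Lemma arc_exit I gam g I' phi k e m2 : iarc I gam g -> arc L I' phi k ->
  I' e -> (forall s, I s -> gam s <> phi e) -> I m2 ->
  \forall x \near e, forall s, I s -> gam s = phi x -> m2 < s.
Proof.
move=> [A dI [M0 init]] B Ie ne Im2.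
(* Below [m1] the arc is the line [e0] with [qc] less than [qc (phi e) - 1], out of reach of points
   near [phi e]. *)
set m1 := Num.min M0 (qc (phi e) - 1).
have cphi := smooth_on_cont (arc_smooth B) Ie.
have n1 : \forall x \near e, qc (phi e) - 1 < qc (phi x).
  have c : {for e, continuous (fun x => qc (phi x))}.
    by apply: continuous_comp => //; exact: qc_cont.
  by apply: (c [set y | qc (phi e) - 1 < y]); apply: lt_nbhsr; lra.
have cK : compact (gam @` `[m1, m2]%classic).
  apply: continuous_compact; last exact: segment_compact.
  apply: continuous_in_subspaceT => x; rewrite inE/= in_itv/= => /andP[_ h].
  by apply: (smooth_on_cont (arc_smooth A)); exact: dI h.
have clK := compact_closed (@norm_hausdorff _ _) cK.
have n2 : \forall x \near e, ~ (gam @` `[m1, m2]%classic) (phi x).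
  apply: (cphi (~` (gam @` `[m1, m2]%classic))).
  apply: open_nbhs_nbhs; split; first exact: closed_openC.
  move=> [s]; rewrite /= in_itv/= => /andP[_ h] E.
  by apply: (ne s) => //; exact: dI h.
near=> x => s Is Es; rewrite ltNge; apply/negP => sm2.
have h1 : qc (phi e) - 1 < qc (phi x) by near: x.
have h2 : ~ (gam @` `[m1, m2]%classic) (phi x) by near: x.
have [sm1|m1s] := ltP s m1.
  have [_ E] : I s /\ gam s = e0 s.
    by apply: init; move: sm1; rewrite /m1 lt_min => /andP[].
  have sE : s = qc (phi x) by rewrite -Es E qc_e0.
  move: sm1; rewrite /m1 lt_min => /andP[_ h].
  by have := lt_trans h h1; rewrite -sE ltxx.
by apply: h2; exists s => //; rewrite /= in_itv/= m1s sm2.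
Unshelve. all: by end_near. Qed.

Lemma is_derive_sstep_affine (a b x : R) : a < b ->
  exists2 d, is_derive x (1:R) (fun x => sstep ((x - a) / (b - a))) d & 0 <= d.
Proof.
move=> ab; have [d dd d0] := sstep_derive ((x - a) / (b - a)).
have d1 : is_derive x (1:R) (fun x : R => (x - a) / (b - a)) ((b - a)^-1).
  have dB := is_deriveB (is_derive_id x (1:R)) (is_derive_cst a x (1:R)).
  have dM := is_deriveM dB (is_derive_cst ((b - a)^-1) x (1:R)).
  by apply: is_derive_eq dM _; rewrite scaler0 add0r subr0 [_ *: _]mulr1.
have H := @is_derive1_comp R (@sstep R) (fun x : R => (x - a) / (b - a)) x d _ dd d1.
exists (d * (b - a)^-1); first exact: H.
by rewrite mulr_ge0// invr_ge0; lra.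
Qed.

Lemma smooth_sstep_affine (a b : R) (O : set R) : open O ->
  smooth_on O (fun x => sstep ((x - a) / (b - a))).
Proof.
move=> oO; apply: (smooth_on_compT _ oO _ (@smooth_sstep R)).
apply: smooth_onM => //; last exact: smooth_on_cst.
by apply: smooth_onB => //; [exact: smooth_on_id|exact: smooth_on_cst].
Qed.

Section Glue.
Variables (I : set R) (gam : R -> J) (g : J -> R).
Variables (I' : set R) (phi : R -> J) (k : J -> R) (x0 x1 x2 : R).
Let tau x := g (phi x).
Let W := overlap I gam I' phi.
Hypotheses (A : iarc I gam g) (B : arc L I' phi k) (iI' : is_interval I').
Hypotheses (x01 : x0 < x1) (x12 : x1 < x2).
Hypothesis Wx : forall x, x0 <= x <= x2 -> W x.
Hypothesis pos : forall x, x0 <= x <= x2 -> 0 < 'D_1 tau x.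
Hypothesis far : forall x, x2 < x -> W x -> tau x2 < tau x.

(* sigma is the transition tau left of x1, where the arc and the chart are
   glued, and the translation by K right of x2. *)
Let K : R := Num.max 0 (tau x2 - x0 + 1).
Let beta x := sstep ((x - x1) / (x2 - x1)).
Let form x := tau x + beta x * (K + x - tau x).
Let sigma x := if x <= x2 then form x else x + K.
Let P := I' `&` [set x | x0 < x].

Let oW : open W. Proof. exact: overlap_open (iarc_arc A) B. Qed.
Let oP : open P. Proof. by apply: openI; [exact: (arc_open B)|exact: open_gt]. Qed.
Let dtau x : W x -> is_derive x (1:R) tau ('D_1 tau x).
Proof.
move=> w; apply/derivableP; apply: diff_derivable.
exact: smooth_on_diff (transition_smooth (iarc_arc A) B) w.
Qed.

Let tau_mono x y : x0 <= x -> x < y -> y <= x2 -> tau x < tau y.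
Proof.
move=> h1 h2 h3; apply: (@pos_derive_lt _ tau [set z | x0 <= z <= x2]) => //=.
- by move=> a b /= ha hb c hc; lra.
- by move=> z hz; exists ('D_1 tau z); [apply: dtau; exact: Wx|exact: pos].
- lra.
- lra.
Qed.

Let beta0 x : x <= x1 -> beta x = 0.
Proof. by move=> h; rewrite /beta sstep0// ler_pdivrMr ?subr_gt0// mul0r subr_le0. Qed.
Let beta1 x : x2 <= x -> beta x = 1.
Proof. by move=> h; rewrite /beta sstep1// ler_pdivlMr ?subr_gt0// mul1r lerD2r. Qed.

Let sigma_formE x : sigma x = form x.
Proof.
rewrite /sigma /form; case: leP => // h.
by rewrite beta1 ?ltW//; ring.
Qed.

Let sigma_lo x : x <= x1 -> sigma x = tau x.
Proof. by move=> h; rewrite sigma_formE /form beta0// mul0r addr0. Qed.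

Let sigma_hi x : x2 <= x -> sigma x = x + K.
Proof. by move=> h; rewrite sigma_formE /form beta1//; ring. Qed.

(** The reason for the second entry in the maximum defining K: the increase of beta then only adds
    to the derivative of sigma. *)
Let gap x : x0 <= x -> x <= x2 -> 0 < K + x - tau x.
Proof.
move=> h1 h2; have : tau x2 - x0 + 1 <= K by rewrite /K le_max lexx orbT.
have : tau x <= tau x2.
  by move: h2; rewrite le_eqVlt => /predU1P[->//|h]; rewrite ltW// tau_mono.
lra.
Qed.

Let sigma_smooth : smooth_on P sigma.
Proof.
apply: smooth_on_local => x [Ix x0x].
have [xx2|xx2] := leP x x2.
  have oN : open (W `&` [set x | x0 < x]) by apply: openI => //; exact: open_gt.
  exists (W `&` [set x | x0 < x]).
    by split => //; split => //; apply: Wx; rewrite (ltW x0x).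
  have sW f : smooth_on W f -> smooth_on (W `&` [set x | x0 < x]) f.
    by apply: smooth_on_sub; exact: subIsetl.
  have st : smooth_on W tau by exact: (transition_smooth (iarc_arc A) B).
  apply: (smooth_on_eq oN (f := form)); first by move=> y _; rewrite sigma_formE.
  apply: sW; apply: (@smooth_onD _ R R W tau (fun x => beta x * (K + x - tau x)) oW st).
  apply: (@smooth_onM _ R W beta (fun x => K + x - tau x) oW).
    exact: smooth_sstep_affine oW.
  apply: (@smooth_onB _ R R W (fun x => K + x) tau oW _ st).
  apply: (@smooth_onD _ R R W (fun=> K) (fun x => x) oW).
    exact: smooth_on_cst.
  exact: smooth_on_id.
have oN : open (I' `&` [set x | x2 < x]).
  by apply: openI; [exact: (arc_open B)|exact: open_gt].
exists (I' `&` [set x | x2 < x]); first by split.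
apply: (smooth_on_eq oN (f := fun x => x + K)).
  by move=> y [_ /= h]; rewrite sigma_hi// ltW.
by apply: smooth_onD => //; [exact: smooth_on_id|exact: smooth_on_cst].
Qed.

(** Up to x2 the derivative is (1 - beta) tau' + beta + beta' (K + x - tau): a convex combination of
    tau' > 0 and 1, plus a term that is nonnegative by [gap]. *)
Let sigma_pos x : P x -> exists2 d, is_derive x (1:R) sigma d & 0 < d.
Proof.
move=> [Ix /= x0x]; have [xx2|xx2] := leP x x2; last first.
  exists 1 => //; apply: (near_eq_is_derive (f := fun x => x + K)).
    near=> y; rewrite sigma_hi//; apply: ltW; near: y; exact: lt_nbhsr.
  by have := is_deriveD (is_derive_id x (1:R)) (is_derive_cst K x (1:R)); rewrite addr0.
have x0x2 : x0 <= x <= x2 by rewrite (ltW x0x).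
have [b db b0] := is_derive_sstep_affine x x12.
have dt := dtau (Wx x0x2).
set t' := 'D_1 tau x in dt.
have dg := is_deriveB (is_deriveD (is_derive_cst K x (1:R)) (is_derive_id x (1:R))) dt.
have dM := is_deriveD dt (is_deriveM db dg).
exists (t' + (beta x * (0 + 1 - t') + (K + x - tau x) * b)).
  rewrite (_ : sigma = form); last by apply/funext => y; exact: sigma_formE.
  exact: dM.
have g0 : 0 < K + x - tau x by apply: gap => //; exact: ltW.
have t0 : 0 < t' by exact: pos.
have B0 : 0 <= beta x by exact: sstep_ge0.
have B1 : beta x <= 1 by exact: sstep_le1.
have h1 : 0 <= (K + x - tau x) * b by rewrite mulr_ge0// ltW.
have -> : t' + (beta x * (0 + 1 - t') + (K + x - tau x) * b) =
  (1 - beta x) * t' + beta x + (K + x - tau x) * b by ring.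
rewrite ltr_wpDr//.
have [b1|b1] := ltP (beta x) 1.
  by rewrite ltr_wpDr// mulr_gt0// subr_gt0.
have -> : beta x = 1 by apply/eqP; rewrite eq_le B1.
by rewrite subrr mul0r add0r.
Unshelve. all: by end_near. Qed.

Let iP : is_interval P.
Proof.
move=> a b [Ia /= ha] [Ib /= hb] c /andP[ac cb]; split => /=; last exact: lt_le_trans ha ac.
by apply: (iI' Ia Ib); rewrite ac cb.
Qed.

Let sigma_lt x y : P x -> P y -> x < y -> sigma x < sigma y.
Proof. exact: pos_derive_lt iP sigma_pos x y. Qed.

Let Px x : x0 < x -> x <= x2 -> P x.
Proof. by move=> h1 h2; split => //; have [] : W x by apply: Wx; rewrite h2 ltW. Qed.

(** The arc is cut at [tau x1], and the chart, reparametrized by sigma, is attached to it.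
    Parameters of the chart that fall below the cut come from x < x1, where sigma is tau, so the two
    pieces agree there. *)
Lemma arc_glue : exists I'' gam'' g'', iarc I'' gam'' g'' /\
  exists2 K, 0 <= K &
    forall x, I' x -> x2 <= x -> I'' (x + K) /\ gam'' (x + K) = phi x.
Proof.
have h01 := x01; have h12 := x12.
pose r y : R := get [set x | P x /\ sigma x = y].
have rK x : P x -> r (sigma x) = x.
  move=> Hx; have [Py e] : P (r (sigma x)) /\ sigma (r (sigma x)) = sigma x.
    by apply: (@getPex _ [set y | P y /\ sigma y = sigma x]); exists x.
  move: (r (sigma x)) Py e => y Py e.
  apply/eqP; rewrite eq_le !leNgt; apply/andP; split; apply/negP => h.
    by have := sigma_lt Hx Py h; rewrite e ltxx.
  by have := sigma_lt Py Hx h; rewrite e ltxx.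
have [oS sr] := smooth_on_inverse iP oP sigma_smooth sigma_pos rK.
have [C dI [M0 init]] := A.
have BP : arc L P phi k by apply: arc_sub B oP _; exact: subIsetl.
have B2 : arc L (sigma @` P) (fun s => phi (r s)) (fun z => sigma (k z)).
  apply: (arc_reparam BP oS sr sigma_smooth).
  - by move=> _ [x Hx <-]; rewrite rK.
  - by move=> x Hx; split; [exists x|exact: rK].
have W1 : W x1 by apply: Wx; lra.
pose y1 := tau x1.
have Iy1 : I y1 by have [] := overlapE C W1.
have A2 : arc L [set s | s < y1] gam g.
  by apply: arc_sub C _ _; [exact: open_lt|move=> s /= /ltW; exact: dI].
have s1 : sigma x1 = y1 by exact: sigma_lo.
have P1 : P x1 by apply: Px; lra.
have lt1 x : P x -> sigma x < y1 -> x < x1.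
  move=> Hx; apply: contraTT; rewrite -!leNgt -s1 le_eqVlt => /predU1P[->//|h].
  by rewrite ltW// sigma_lt.
have [||gam'' [g'' [D [E1 E2]]]] := arc_union A2 B2.
- move=> s /= sy1 [x Hx e]; rewrite -e rK//.
  have xx1 : x < x1 by apply: lt1 => //; rewrite e.
  rewrite sigma_lo ?ltW//.
  have [|_ ->//] := overlapE C (I' := I') (phi := phi) (x := x).
  by apply: Wx; case: Hx => _ /= h; lra.
- move=> s _ /= sy1 [x Hx <-]; rewrite rK// => e.
  have Is : I s by apply: dI Iy1 _; exact: ltW.
  have Wxx : W x by split; [case: Hx|exists s].
  have ts : tau x = s by rewrite /tau -e (arc_can C).
  have [h|h] := ltP x x1; first by rewrite sigma_lo ?ltW.
  (* A chart parameter from x1 on has transition value at least [tau x1], by monotonicity up to x2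
     and by [far] beyond it, so its point is not on the part of the arc that is kept. *)
  exfalso; have : tau x1 <= tau x.
    have [h2|h2] := ltP x2 x.
      by rewrite ltW//; apply: lt_trans (far h2 Wxx); apply: tau_mono => //; exact: ltW.
    move: h; rewrite le_eqVlt => /predU1P[->//|h].
    by rewrite ltW//; apply: tau_mono => //; exact: ltW.
  by rewrite ts leNgt sy1.
- exists ([set s | s < y1] `|` sigma @` P), gam'', g''; split; last first.
    exists K; first by rewrite /K le_max lexx.
    move=> x Ix x2x; have Hx : P x by split => //=; lra.
    have Sx : (sigma @` P) (x + K) by exists x => //; exact: sigma_hi.
    by split; [right|rewrite E2// -sigma_hi// rK].
  split => //.
    move=> s t Is ts; have [ty|yt] := ltP t y1; first by left.
    case: Is => [/= sy|[x Hx e]]; first by left; exact: le_lt_trans ts sy.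
    right.
    have x1x : x1 <= x.
      rewrite leNgt; apply/negP => h; have := sigma_lt Hx P1 h.
      by rewrite s1 e ltNge (le_trans yt ts).
    (* The image of sigma has no gaps, so every parameter between [y1] and one already reached is
       taken. *)
    have [||z] := @IVT R sigma x1 x t x1x.
    - apply: continuous_in_subspaceT => z; rewrite inE/= in_itv/= => hz.
      by apply: (smooth_on_cont sigma_smooth); exact: (iP P1 Hx).
    - by rewrite ge_min le_max s1 e yt ts orbT.
    - by rewrite in_itv/= => hz <-; exists z => //; exact: (iP P1 Hx).
  exists (Num.min M0 y1) => s; rewrite lt_min => /andP[h1 h2].
  split; first by left.
  by rewrite E1//; have [] := init _ h1.
Qed.

End Glue.
End Extension.

(** The norm need not be smooth, so distance is measured by the sum D of the squared coordinates of
    y - z. The radius eta is such that D <= eta^2 forces |y - z| <= eta S < r. *)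
Lemma smooth_bump (R : realType) (J : normedModType R) (fJ : findim J)
    (z : J) (N : set J) : open N -> N z -> exists beta C,
  [/\ smooth_on setT beta, closed C, C `<=` N, forall y, ~ C y -> beta y = 0 :> R &
    \forall y \near z, beta y = 1].
Proof.
move=> oN Nz; case: (fJ) => -[n [e [c [cc ce]]]].
have /nbhs_ballP[r /= r0 rN] : nbhs z N by exact: open_nbhs_nbhs.
pose S := \sum_i `|e i|.
have S0 : 0 <= S by apply: sumr_ge0.
pose eta := r / (2 * (1 + S)).
have eta0 : 0 < eta by rewrite divr_gt0 ?mulr_gt0//; lra.
pose D (y : J) : R := \sum_i c i (y - z) * c i (y - z).
have cD i : smooth_on setT (fun y => c i (y - z)).
  apply: (smooth_on_eq openT (f := fun y => c i y - c i z)).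
    by move=> y _; rewrite linearB.
  apply: smooth_onB; [exact: openT| |exact: smooth_on_cst].
  exact: smooth_on_lin.
have sD : smooth_on setT D.
  apply: (smooth_on_sum openT) => i; exact: (smooth_onM openT).
have D0 y : 0 <= D y by apply: sumr_ge0 => i _; rewrite -expr2 sqr_ge0.
have eta2 : 0 < eta * eta by rewrite mulr_gt0.
pose f y := 2 * D y / (eta * eta) - 1.
have sf : smooth_on setT f.
  apply: (smooth_onB openT); last exact: smooth_on_cst.
  apply: (smooth_onM openT); last exact: smooth_on_cst.
  apply: (smooth_onM openT); last exact: sD.
  exact: smooth_on_cst.
exists (fun y => 1 - sstep (f y)), [set y | D y <= eta * eta]; split.
- apply: (smooth_onB openT); first exact: smooth_on_cst.
  exact: (smooth_comp _ sf (@smooth_sstep R)).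
- apply: (closed_comp (f := D) (D := [set x | x <= eta * eta])) => [y _|].
    exact: (smooth_on_cont sD).
  exact: closed_le.
- move=> y /= Dy; apply: rN; rewrite -ball_normE /= distrC.
  have ci i : `|c i (y - z)| <= eta.
    rewrite -(@ler_pXn2r _ 2)// ?nnegrE ?(ltW eta0)// real_normK ?num_real// !expr2.
    apply: le_trans Dy; rewrite /D (bigD1 i)//= lerDl.
    by apply: sumr_ge0 => j _; rewrite -expr2 sqr_ge0.
  rewrite {1}(ce (y - z)).
  apply: (@le_lt_trans _ _ (eta * S)).
    apply: le_trans (ler_norm_sum _ _ _) _; rewrite /S mulr_sumr.
    by apply: ler_sum => i _; rewrite normrZ ler_wpM2r.
  rewrite /eta -mulrA mulrC -ltr_pdivlMr// divff ?gt_eqF//.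
  by rewrite mulrC ltr_pdivrMr; lra.
- move=> y /negP; rewrite -ltNge => Dy; rewrite sstep1 ?subrr//.
  by rewrite /f lerBrDr ler_pdivlMr//; lra.
- have cf : {for z, continuous f} by exact: (smooth_on_cont sf).
  have fz : f z < 0.
    rewrite /f /D big1 ?mulr0 ?mul0r ?sub0r ?oppr_lt0// => i _.
    by rewrite subrr linear0 mulr0.
  have : \forall y \near z, f y < 0.
    by apply: (cf [set y | y < 0]); exact: lt_nbhsl.
  by apply: filterS => y fy; rewrite sstep0 ?subr0// ltW.
Qed.

(** * A connected curve with straight ends is a line *)

Section Classification.
Context {R : realType} {J : normedModType R} {fJ : findim J} (L : set J).
Variables (e0 : R -> J) (qc : J -> R) (M : R).
Hypothesis qc_smooth : smooth_on setT qc.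
Hypothesis e0_smooth : smooth_on setT e0.
Hypothesis qc_e0 : forall s, qc (e0 s) = s.
Hypothesis L_end : forall z, L z -> M < `|qc z| -> z = e0 (qc z).
Hypothesis end_L : forall s, M < `|s| -> L (e0 s).
Hypothesis chart : forall z, L z -> exists (c d m : R) phi k,
  [/\ arc L [set x | c < x < d] phi k, c < m < d & phi m = z].
Hypothesis L_conn : connected L.
Implicit Types (I : set R) (gam phi : R -> J) (g k : J -> R).

Let qc_cont : continuous qc.
Proof. by move=> x; apply: (smooth_on_cont qc_smooth). Qed.

(** Since the derivative of a transition never vanishes, one increase between the endpoints fixes
    its sign on the whole segment. *)
Lemma transition_pos I gam g I' phi k x0 x3 x : iarc L e0 I gam g -> arc L I' phi k ->
  (forall x, x0 <= x <= x3 -> overlap I gam I' phi x) ->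
  g (phi x0) < g (phi x3) -> x0 <= x3 -> x0 <= x <= x3 ->
  0 < 'D_1 (fun x => g (phi x)) x.
Proof.
move=> A B Wx lt x03; have C := iarc_arc A.
have st : smooth_on (overlap I gam I' phi) (fun x => g (phi x)).
  exact: (transition_smooth C B).
have st' : smooth_on (overlap I gam I' phi) ('D_1 (fun x => g (phi x))).
  exact: smooth_on_D.
move=> hx; apply: (@pos_derive _ (fun x => g (phi x)) ('D_1 (fun x => g (phi x))) x0 x3 x03 _ _ _ lt x hx) => y hy.
- apply/derivableP; apply: diff_derivable; apply: (smooth_on_diff st); exact: Wx.
- apply: (smooth_on_cont st'); exact: Wx.
- apply: (transition_deriv_neq0 C B); exact: Wx.
Qed.

Lemma transition_mono I gam g I' phi k x0 x3 x y : iarc L e0 I gam g -> arc L I' phi k ->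
  (forall x, x0 <= x <= x3 -> overlap I gam I' phi x) ->
  g (phi x0) < g (phi x3) -> x0 <= x3 -> x0 <= x -> x < y -> y <= x3 ->
  g (phi x) < g (phi y).
Proof.
move=> A B Wx lt x03 x0x xy yx3.
apply: (@pos_derive_lt _ (fun x => g (phi x)) [set z | x0 <= z <= x3]) => //=.
- by move=> a b /= ha hb c hc; lra.
- move=> z hz; exists ('D_1 (fun x => g (phi x)) z).
    apply/derivableP; apply: diff_derivable.
    have st : smooth_on (overlap I gam I' phi) (fun x => g (phi x)).
      exact: (transition_smooth (iarc_arc A) B).
    apply: (smooth_on_diff st); exact: Wx.
  exact: transition_pos A B Wx lt x03 hz.
- lra.
- lra.
Qed.

(** Let e be the first point where the chart leaves the arc. By [arc_exit] the transition runs to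
    the upper end of the arc as x tends to e, so it is increasing before e, and the chart can be
    glued on just before e. *)
Lemma arc_extend I gam g I' phi k x0 m : iarc L e0 I gam g -> arc L I' phi k ->
  is_interval I' -> overlap I gam I' phi x0 -> I' m -> ~ overlap I gam I' phi m ->
  x0 < m ->
  exists I'' gam'' g'' x2, [/\ iarc L e0 I'' gam'' g'', x2 < m &
  exists2 K, 0 <= K &
    forall x, I' x -> x2 <= x -> I'' (x + K) /\ gam'' (x + K) = phi x].
Proof.
move=> A B iI' W0 Im Wm x0m; have C := iarc_arc A.
set W := overlap I gam I' phi in W0 Wm *; pose tau x := g (phi x).
have oW : open W by exact: overlap_open C B.
have st : smooth_on W tau by exact: (transition_smooth C B).
have ninj e : I' e -> ~ W e -> forall s, I s -> gam s <> phi e.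
  by move=> Ie We s Is h; apply: We; split => //; exists s.
have [e [x0e em We Wx]] := first_exit oW W0 Wm x0m.
have I0 : I' x0 by case: W0.
have Ie : I' e by apply: (iI' _ _ I0 Im); rewrite em ltW.
have IW x : W x -> I (tau x) by move=> /(overlapE C)[].
(* Chart parameters close enough to e on the left correspond to arc parameters beyond any prescribed
   s. *)
have exitl y s : y < e -> x0 <= y -> I s -> exists2 x3, y < x3 < e & s < tau x3.
  move=> ye x0y Is.
  have h := arc_exit qc_cont qc_e0 A B Ie (ninj e Ie We) Is.
  have h1 : \forall x \near e^'-, y < x < e.
    near=> x; apply/andP; split; near: x; last exact: nbhs_left_lt.
    exact: nbhs_left_gt.
  have h2 : \forall x \near e^'-, forall s0, I s0 -> gam s0 = phi x -> s < s0.
    exact: cvg_at_left_filter h.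
  have [x3 [h3 h4]] := filter_ex (filterI h1 h2); exists x3 => //.
  have [a b] : I (tau x3) /\ gam (tau x3) = phi x3.
    have W3 : W x3 by apply: Wx; lra.
    exact: (overlapE C W3).
  exact: h4.
have Wsub x3 : x3 < e -> forall x, x0 <= x <= x3 -> W x.
  by move=> x3e x hx; apply: Wx; lra.
have lift y : x0 <= y -> y < e -> exists x3, [/\ y < x3, x3 < e & tau x0 < tau x3].
  move=> h1 h2; have [x3 /andP[a b] c] := exitl y (tau x0) h2 h1 (IW _ W0).
  by exists x3.
pose x1 := x0 + (e - x0) / 3; pose x2 := x0 + (e - x0) * 2 / 3.
have x01 : x0 < x1 by rewrite /x1; lra.
have x12 : x1 < x2 by rewrite /x1 /x2; lra.
have x2e : x2 < e by rewrite /x2; lra.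
have x02 : x0 <= x2 by lra.
have mono x y : x0 <= x -> x < y -> y < e -> tau x < tau y.
  move=> h1 h2 h3; have [||x3 [a b c]] := lift y; [lra|lra|].
  by apply: (transition_mono A B (Wsub x3 b) c); lra.
have [I'' [gam'' [g'' [D [K K0 DK]]]]] : exists I'' gam'' g'', iarc L e0 I'' gam'' g'' /\
  exists2 K, 0 <= K &
    forall x, I' x -> x2 <= x -> I'' (x + K) /\ gam'' (x + K) = phi x.
  apply: (arc_glue A B iI' x01 x12).
  - exact: Wsub.
  - move=> x hx; have [x3 [a b c]] := lift x2 x02 x2e.
    by apply: (transition_pos A B (Wsub x3 b) c); lra.
  - move=> x x2x Wxx; have [xe|ex] := ltP x e; first exact: mono.
    have {}ex : e < x.
      by rewrite lt_neqAle ex andbT; apply/eqP => h; apply: We; rewrite h.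
    (* Otherwise let e' be the last entry into W before x. Just right of e' the transition exceeds
       [tau x3] again, so between there and x it takes the value [tau x3] once more. Then phi passes
       twice through [phi x3], against its injectivity. *)
    change (tau x2 < tau x); rewrite ltNge; apply/negP => tx.
    have [e' [e'x ee' We' Wx']] := last_entry oW Wxx We ex.
    have Ix : I' x by case: Wxx.
    have Ie' : I' e' by apply: (iI' _ _ Ie Ix); rewrite ee' ltW.
    have [x3 /andP[a b] c] := exitl x2 (tau x2) x2e x02 (IW _ (Wsub x2 x2e x2 ltac:(lra))).
    have W3 : W x3 by apply: Wx; lra.
    have h := arc_exit qc_cont qc_e0 A B Ie' (ninj e' Ie' We') (IW _ W3).
    have h1 : \forall x' \near e'^'+, e' < x' < x.
      near=> x'; apply/andP; split; near: x'; first exact: nbhs_right_gt.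
      exact: nbhs_right_lt.
    have h2 : \forall x' \near e'^'+, forall s0, I s0 -> gam s0 = phi x' -> tau x3 < s0.
      exact: cvg_at_right_filter h.
    have [x' [/andP[h3 h3'] h4]] := filter_ex (filterI h1 h2).
    have [a' b'] : I (tau x') /\ gam (tau x') = phi x'.
      have W' : W x' by apply: Wx'; lra.
      exact: (overlapE C W').
    have {}h4 := h4 _ a' b'.
    have [||z] := @IVT R tau x' x (tau x3) (ltW h3').
    + apply: continuous_in_subspaceT => z; rewrite inE/= in_itv/= => hz.
      by apply: (smooth_on_cont st); apply: Wx'; lra.
    + by rewrite ge_min le_max (le_trans tx (ltW c)) (ltW h4) orbT.
    rewrite in_itv/= => hz tz.
    have Wz : W z by apply: Wx'; lra.
    have [_ E1] := overlapE C Wz; have [_ E2] := overlapE C W3.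
    have : phi z = phi x3 by rewrite -E1 -E2; congr gam.
    move=> /(congr1 k); rewrite (arc_can B); last by case: Wz.
    by rewrite (arc_can B); [lra|case: W3].
exists I'', gam'', g'', x2; split => //; first lra.
by exists K.
Unshelve. all: by end_near. Qed.

Let covered z := exists I gam g, iarc L e0 I gam g /\ exists2 s, I s & gam s = z.

Let end_arc (I : set R) : open I -> (forall s, I s -> M < `|s|) ->
  arc L I e0 qc.
Proof.
move=> oI hI; split => //.
- exact: smooth_on_sub e0_smooth.
- by move=> s /hI; exact: end_L.
- move=> s Is; exists setT, qc; split => //; exact: openT.
- move=> s Is.
  have h : \forall z \near e0 s, I (qc z).
    by apply: qc_cont; rewrite qc_e0; exact: open_nbhs_nbhs.
  by apply: filterS h => z Iz Lz; exists (qc z) => //; rewrite -L_end//; exact: hI.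
Qed.

Let init_arc : iarc L e0 [set s | s < - `|M| - 1] e0 qc.
Proof.
have hM := ler_norm M; have nM := normr_ge0 M.
split.
- apply: end_arc; first exact: open_lt.
  by move=> s /= hs; rewrite ltr0_norm; lra.
- by move=> s t /= h1 h2; lra.
- by exists (- `|M| - 1).
Qed.

Let covered_extend I' phi k x0 m : arc L I' phi k -> is_interval I' ->
  I' x0 -> I' m -> x0 <= m -> covered (phi x0) -> covered (phi m).
Proof.
move=> B iI' I0 Im; rewrite le_eqVlt => /predU1P[->//|x0m].
move=> [I [gam [g [A [s Is Es]]]]].
have [Wm|Wm] := pselect (overlap I gam I' phi m).
  by case: Wm => _ [t It Et]; exists I, gam, g; split => //; exists t.
have W0 : overlap I gam I' phi x0 by split => //; exists s.
have [I'' [gam'' [g'' [x2 [D x2m [K K0 DK]]]]]] := arc_extend A B iI' W0 Im Wm x0m.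
have [a b] := DK m Im (ltW x2m).
by exists I'', gam'', g''; split => //; exists (m + K).
Qed.

(** The covered points form a nonempty subset of L that is open and closed in L. For closedness, a
    chart around a limit point contains a covered point, and coverage propagates along the chart. *)
Let all_covered z : L z -> covered z.
Proof.
pose Z := L `&` [set z | covered z].
suff -> : L = Z by case.
clear z.
have hM := ler_norm M; have nM := normr_ge0 M.
apply/esym/L_conn.
- exists (e0 (- `|M| - 2)); split.
    by apply: end_L; rewrite ltr0_norm; lra.
  exists [set s | s < - `|M| - 1], e0, qc; split; first exact: init_arc.
  by exists (- `|M| - 2) => //=; lra.
- exists ([set z | L z -> covered z]^°); first exact: open_interior.
  apply/seteqP; split => z [Lz].
    move=> [I [gam [g [A [s Is Es]]]]]; split => //.
    have := arc_near (iarc_arc A) Is; rewrite Es; apply: filterS => y h Ly.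
    by have [t It Et] := h Ly; exists I, gam, g; split => //; exists t.
  by move=> /interior_subset h; split => //; exact: h.
exists (closure Z); first exact: closed_closure.
apply/seteqP; split => z.
  by move=> Hz; split; [case: Hz|exact: subset_closure].
move=> [Lz cz]; split => //.
have [c [d [m [phi [k [B mcd Ez]]]]]] := chart Lz.
have := arc_near B mcd; rewrite Ez => /cz [y [[Ly Cy] h]].
have [x xcd Ex] := h Ly; rewrite /= -Ez; move: Cy; rewrite /= -Ex.
have iI : is_interval [set x | c < x < d] by move=> a b /= ha hb e he; lra.
have [xm|mx] := leP x m; first exact: (covered_extend B iI xcd mcd xm).
(* Propagation works to the right only; for a covered point to the right of m the chart is
   reversed. *)
rewrite -(opprK m) -(opprK x).
apply: (@covered_extend _ (fun s => phi (- s)) _ (- x) (- m) (arc_opp B)).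
- by move=> a b /= ha hb e he; lra.
- by rewrite /= opprK.
- by rewrite /= opprK.
- by rewrite lerN2 ltW.
Qed.

(** Some arc reaches the right end. If it misses a point of the end further out, [arc_extend]
    applies; if it contains the rest of the end, the end is glued on so that the parametrization
    becomes standard there. *)
Lemma arc_full : exists gam g x2 K, [/\ iarc L e0 setT gam g, 0 <= K &
  forall x, x2 <= x -> gam (x + K) = e0 x].
Proof.
have hM := ler_norm M; have nM := normr_ge0 M.
pose E := [set s | `|M| + 1 < s].
have B : arc L E e0 qc.
  apply: end_arc; first exact: open_gt.
  by move=> s; rewrite {1}/E /= => hs; rewrite gtr0_norm; [lra|have := normr_ge0 M; lra].
have iE : is_interval E by rewrite /E => a b /= ha hb c hc; lra.
pose x0 := `|M| + 2; have Ex0 : E x0 by rewrite /E /x0/=; lra.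
have [I [gam [g [A [s Is Es]]]]] := all_covered (arc_in B Ex0).
have C := iarc_arc A.
pose tau x := g (e0 x); set W := overlap I gam E e0.
have W0 : W x0 by split => //; exists s.
suff [I'' [gam'' [g'' [x2 [D [K K0 DK]]]]]] : exists I'' gam'' g'' x2,
  iarc L e0 I'' gam'' g'' /\ exists2 K, 0 <= K &
    forall x, E x -> x2 <= x -> I'' (x + K) /\ gam'' (x + K) = e0 x.
  (* The domain contains [x + K] for all large x, and K >= 0; being closed downwards, it is the
     whole line. *)
  have IT : I'' = setT.
    apply/seteqP; split => // t _.
    pose x := Num.max x0 (Num.max x2 t).
    have [||h _] := DK x; first by rewrite /E /x/= lt_max Ex0.
      by rewrite /x !le_max lexx orbT.
    apply: (iarc_down D h).
    have : t <= x by rewrite /x !le_max lexx !orbT.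
    lra.
  exists gam'', g'', (Num.max x0 x2), K; split => //; first by rewrite -IT.
  move=> x; rewrite ge_max => /andP[h1 h2].
  by have [|_ ->//] := DK x _ h2; rewrite /E/=; move: Ex0; rewrite /E/=; lra.
have [allW|] := pselect (forall x, x0 <= x -> W x); last first.
  move=> /existsNP[m /not_implyP[x0m Wm]].
  have {}x0m : x0 < m.
    by rewrite lt_neqAle x0m andbT; apply/eqP => h; apply: Wm; rewrite -h.
  have Em : E m by rewrite /E/=; move: Ex0; rewrite /E/=; lra.
  have [I'' [gam'' [g'' [x2 [D _ H]]]]] := arc_extend A B iE W0 Em Wm x0m.
  by exists I'', gam'', g'', x2.
have [dI [M0 init]] := (iarc_down A, iarc_init A).
have It0 : I (tau x0) by have [] := overlapE C W0.
(* Up to [tau x0] the arc is a compact piece preceded by the left end, so it meets the right end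
   only over a bounded range of [qc]. Points further right therefore have larger arc parameters,
   which makes the transition increasing. *)
have [Cb Cbb] : exists Cb, forall s, I s -> s <= tau x0 -> x0 <= qc (gam s) -> qc (gam s) <= Cb.
  pose m1 := Num.min M0 (Num.min (tau x0) x0).
  have m1t : m1 <= tau x0 by rewrite /m1 !ge_min lexx !orbT.
  have [|c cin hc] := @EVT_max R (fun s => qc (gam s)) m1 (tau x0) m1t.
    apply: continuous_in_subspaceT => y; rewrite inE/= in_itv/= => /andP[_ h].
    apply: continuous_comp; last exact: qc_cont.
    by apply: (smooth_on_cont (arc_smooth C)); exact: dI h.
  exists (qc (gam c)) => t It tt tq.
  have [tm1|m1t'] := ltP t m1; last by apply: hc; rewrite in_itv/= m1t' tt.
  move: tm1; rewrite /m1 !lt_min => /and3P[h1 _ h3].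
  have [_ E1] := init _ h1; move: tq; rewrite E1 qc_e0; lra.
have big x : x0 <= x -> Cb < x -> tau x0 < tau x.
  move=> h1 h2; rewrite ltNge; apply/negP => h3.
  have [a b] := overlapE C (allW x h1).
  have := Cbb _ a h3; rewrite b qc_e0 => /(_ h1); lra.
have Wsub x3 : forall x, x0 <= x <= x3 -> W x by move=> x /andP[h _]; exact: allW.
have lift y : x0 <= y -> exists x3, y < x3 /\ tau x0 < tau x3.
  move=> h; exists (Num.max y Cb + 1).
  have h1 : y <= Num.max y Cb by rewrite le_max lexx.
  have h2 : Cb <= Num.max y Cb by rewrite le_max lexx orbT.
  by split; [lra|apply: big; lra].
have x01 : x0 < x0 + 1 by lra.
have x12 : x0 + 1 < x0 + 2 by lra.
have [I'' [gam'' [g'' [D H]]]] : exists I'' gam'' g'', iarc L e0 I'' gam'' g'' /\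
  exists2 K, 0 <= K &
    forall x, E x -> x0 + 2 <= x -> I'' (x + K) /\ gam'' (x + K) = e0 x.
  apply: (arc_glue A B iE x01 x12).
  - by move=> x /andP[h _]; exact: allW.
  - move=> x hx; have [|x3 [a b]] := lift (x0 + 2); first lra.
    by apply: (transition_pos A B (Wsub x3) b); lra.
  - move=> x h _; have [|x3 [a b]] := lift x; first lra.
    by apply: (transition_mono A B (Wsub x3) b); lra.
by exists I'', gam'', g'', (x0 + 2).
Qed.

(** The increasing change of parameter [rho] is the identity on the left and the translation by K on
    the right, so it absorbs the shift left by [arc_full]. The image of the curve is then open and
    closed in L. *)
Lemma arc_global : exists gam g M', [/\ arc L setT gam g, M <= M',
  forall s, M' <= `|s| -> gam s = e0 s & forall z, L z -> exists s, gam s = z].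
Proof.
have [gam [g [x2 [K [A K0 hK]]]]]  := arc_full.
have [C dI [M0 init]] := A.
pose rho (s : R) := s + K * sstep s.
have srho : smooth_on setT rho.
  apply: smooth_onD; [exact: openT|exact: smooth_on_id|].
  apply: smooth_onM; [exact: openT|exact: smooth_on_cst|exact: smooth_sstep].
have drho x : setT x -> exists2 d, is_derive x (1:R) rho d & 0 < d.
  move=> _; have [d dd d0] := sstep_derive x.
  exists (1 + (K *: d + sstep x *: 0)).
    exact: is_deriveD (is_derive_id _ _) (is_deriveM (is_derive_cst K x (1:R)) dd).
  by rewrite scaler0 addr0 ltr_wpDr// mulr_ge0.
have iT : is_interval (@setT R) by [].
have mono x y : x < y -> rho x < rho y by exact: pos_derive_lt iT drho x y I I.
have Krho s : s <= rho s <= s + K.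
  have := sstep_ge0 s; have := sstep_le1 s; rewrite /rho => h1 h2.
  by apply/andP; split; nra.
have surj y : exists s, rho s = y.
  have h1 : y - K <= y by lra.
  have [||z _ <-] := @IVT R rho (y - K) y y h1; last by exists z.
    apply: continuous_in_subspaceT => z _; exact: (smooth_on_cont srho).
  have /andP[_ h2] := Krho (y - K); have /andP[h3 _] := Krho y.
  by rewrite ge_min le_max h3 orbT andbT; apply/orP; left; lra.
pose r y : R := get [set s | rho s = y].
have rhoK y : rho (r y) = y by apply: (@getPex _ [set s | rho s = y]); exact: surj.
have rK s : r (rho s) = s.
  apply/eqP; rewrite eq_le !leNgt; apply/andP; split; apply/negP => /mono.
    by rewrite rhoK ltxx.
  by rewrite rhoK ltxx.
have [_ sr] := smooth_on_inverse iT openT srho drho (fun s _ => rK s).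
have imT : rho @` setT = setT by apply/seteqP; split => // y _; exists (r y).
rewrite imT in sr.
have B : arc L setT (fun s => gam (rho s)) (fun z => r (g z)).
  by apply: (arc_reparam C openT srho sr).
(* Beyond this bound [sstep] is constant and the curve is on one of its straight ends. *)
pose M' := `|M0| + `|x2| + `|M| + 1.
have nM := normr_ge0 M; have nM0 := normr_ge0 M0; have nx2 := normr_ge0 x2.
have hM := ler_norm M; have hx2 := ler_norm x2; have hM0 := ler_norm (- M0).
rewrite normrN in hM0.
have e s : M' <= `|s| -> gam (rho s) = e0 s.
  rewrite /M'; have [s0|s0] := leP 0 s.
    rewrite (ger0_norm s0) => h; rewrite /rho sstep1; last lra.
    by rewrite mulr1 hK//; lra.
  rewrite (ltr0_norm s0) => h; rewrite /rho sstep0; last lra.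
  by rewrite mulr0 addr0; have [|_ ->] := init s; first lra.
exists (fun s => gam (rho s)), (fun z => r (g z)), M'; split => //.
  by rewrite /M'; lra.
pose Z := range (fun s => gam (rho s)).
have ZL : Z `<=` L by move=> _ [s _ <-]; exact: (arc_in B).
suff -> : L = Z by move=> z [s _ <-]; exists s.
apply/esym/L_conn.
- by exists (gam (rho 0)); exists 0.
- exists ([set z | L z -> Z z]^°); first exact: open_interior.
  apply/seteqP; split => z.
    move=> Hz; split; first exact: ZL.
    case: Hz => s _ <-; apply: filterS (arc_near B (s := s) I) => y h /h[t _ <-].
    by exists t.
  by move=> [Lz /interior_subset]; exact.
exists (closure Z); first exact: closed_closure.
apply/seteqP; split => z.
  by move=> Hz; split; [exact: ZL|exact: subset_closure].
move=> [Lz cz]; apply: contrapT => Zz.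
(* Near z the values of [qc] are bounded, and on the ends [qc] is the parameter. So points of the
   curve near z have parameters in [-b, b], and the image of this segment is closed. *)
pose b := M' + `|qc z| + 1.
have nq := normr_ge0 (qc z).
have cK : compact ((fun s => gam (rho s)) @` `[- b, b]%classic).
  apply: continuous_compact; last exact: segment_compact.
  by apply: continuous_in_subspaceT => x _; exact: (smooth_on_cont (arc_smooth B)).
have clK := compact_closed (@norm_hausdorff _ _) cK.
have n2 : \forall x \near z, ~ ((fun s => gam (rho s)) @` `[- b, b]%classic) x.
  apply: open_nbhs_nbhs; split; first exact: closed_openC.
  by move=> [s _ E]; apply: Zz; exists s.
have n1 : \forall x \near z, `|qc x| < `|qc z| + 1.
  have c : {for z, continuous (fun x => `|qc x|)}.
    apply: continuous_comp; last exact: norm_continuous.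
    exact: (smooth_on_cont qc_smooth).
  by apply: (c [set y | y < `|qc z| + 1]); apply: lt_nbhsl; lra.
have [_ [[t _ <-] [h1 h2]]] := cz _ (filterI n1 n2).
have [tb|bt] := leP `|t| b.
  by apply: h2; exists t => //=; rewrite in_itv/= -ler_norml.
have tM : M' <= `|t| by move: bt; rewrite /b; lra.
move: h1; rewrite e// qc_e0; move: bt; rewrite /b /M'; lra.
Qed.

(* Corrections by bump functions extend the smooth inverse along the arc, by
   real induction. *)
Lemma arc_global_inverse gam g M' : arc L setT gam g -> M <= M' ->
  (forall s, M' <= `|s| -> gam s = e0 s) ->
  exists2 delta, smooth_on setT delta & forall s, delta (gam s) = s.
Proof.
move=> A MM' He.
have oT := @openT J.
have qcg t : M' < `|qc (gam t)| -> qc (gam t) = t.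
  move=> h; have E := L_end (arc_in A (s := t) I) (le_lt_trans MM' h).
  have Eq : gam (qc (gam t)) = gam t by rewrite He ?ltW// -E.
  by move: (congr1 g Eq); rewrite !(arc_can A).
pose P s := exists2 delta, smooth_on setT delta & forall t, t <= s -> delta (gam t) = t.
have step s : (forall t, t < s -> P t) -> exists2 s', s < s' & P s'.
  move=> Ps.
  have [N [psi [oN Ns spsi gpsi]]] := arc_along A (s := s) I.
  have [beta [C [sb cC CN b0 b1]]] := smooth_bump fJ oN Ns.
  have cg : {for s, continuous gam} by exact: (smooth_on_cont (arc_smooth A)).
  have /nbhs_ballP[e /= e0' be] := cg _ b1.
  have [delta sd hd] : P (s - e / 2) by apply: Ps; lra.
  exists (s + e / 2); first lra.
  exists (fun z => delta z + beta z * (psi z - delta z)).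
    apply: smooth_onD => //.
    apply: smooth_on_local => z _; have [Cz|Cz] := pselect (C z).
      exists N; first by split => //; exact: CN.
      by apply: smooth_onM => //; [|apply: smooth_onB => //]; exact: smooth_on_sub (@subsetT _ N) _.
    have oC : open (~` C) by exact: closed_openC.
    exists (~` C) => //.
    apply: (smooth_on_eq oC (f := fun=> 0)); last exact: smooth_on_cst.
    by move=> y Cy; rewrite b0// mul0r.
  (* Up to [s - e / 2] delta already returns t, and so does psi wherever beta may be nonzero, so the
     correction vanishes. From there to [s + e / 2] beta is 1 and psi takes over. *)
  move=> t ts; have [h|h] := leP t (s - e / 2).
    rewrite hd//; have [Nt|Nt] := pselect (N (gam t)).
      by rewrite -(gpsi _ Nt (arc_in A (s := t) I)) (arc_can A)// subrr mulr0 addr0.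
    by rewrite b0 ?mul0r ?addr0// => /CN.
  have bt : beta (gam t) = 1.
    by apply: be; rewrite /ball/= ltr_norml; lra.
  have Nt : N (gam t).
    apply: CN; apply: contrapT => /b0; rewrite bt => /eqP; by rewrite oner_eq0.
  rewrite bt mul1r addrC subrK.
  by rewrite -(gpsi _ Nt (arc_in A (s := t) I)) (arc_can A).
have P0 : P (- `|M'| - 1).
  exists qc => // t ht; rewrite He ?qc_e0//.
  have := ler_norm M'; have := ler_norm (- t); rewrite normrN; lra.
have Pdown s t : P s -> t <= s -> P t.
  by move=> [d sd hd] ts; exists d => // u ut; apply: hd; exact: le_trans ut ts.
have Pall s : P s.
  apply: contrapT => Ps.
  have hS : has_sup [set t | P t].
    split; first by exists (- `|M'| - 1).
    exists s => t /= Pt; rewrite leNgt; apply/negP => st.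
    by apply: Ps; apply: Pdown Pt _; exact: ltW.
  have [|s' ss' Ps'] := step (sup [set t | P t]).
    move=> t ts; have e1 : 0 < sup [set t | P t] - t by lra.
    have [u Pu] := sup_adherent e1 hS; rewrite subKr => tu.
    by apply: Pdown Pu _; exact: ltW.
  have := sup_upper_bound hS Ps'; lra.
have [d sd hd] := Pall (`|M'| + 1).
(* [d] is correct up to |M'| + 1, and [qc] takes over on the right end. Where the step is nonzero,
   [qc] exceeds |M'|, so by [qcg] it equals the parameter and the correction does no harm for
   smaller t. *)
exists (fun z => d z + sstep (qc z - `|M'|) * (qc z - d z)).
  apply: smooth_onD => //; apply: smooth_onM => //; last exact: smooth_onB.
  apply: (smooth_on_compT _ oT _ (@smooth_sstep R)).
  by apply: smooth_onB => //; exact: smooth_on_cst.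
have hM := ler_norm M'; have nM := normr_ge0 M'.
move=> t; have [ht|ht] := leP t (`|M'| + 1).
  rewrite hd//; have [h|h] := leP (qc (gam t)) `|M'|.
    by rewrite sstep0 ?mul0r ?addr0//; lra.
  rewrite qcg ?subrr ?mulr0 ?addr0//.
  by apply: lt_le_trans (ler_norm _); lra.
rewrite He ?qc_e0; last by apply: le_trans (ler_norm _); lra.
rewrite sstep1; last lra.
by rewrite mul1r addrC subrK.
Qed.

End Classification.

(** * Legendrian knots as parametrized curves *)

Section JetLine.
Context {R : realType}.

Definition jpt (u q p : R) : J1 R 1 := (u, const_mx q, const_mx p).

Lemma rV1E (v : 'rV[R]_1) : v = const_mx (v 0 0).
Proof. by apply/rowP => i; rewrite mxE ord1. Qed.

Lemma jptE (z : J1 R 1) : z = jpt z.1.1 (z.1.2 0 0) (z.2 0 0).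
Proof. by case: z => -[u q] p; rewrite /jpt /= -!rV1E. Qed.

Lemma smooth_on_const_mx (V : normedModType R) (O : set V) n (f : V -> R) :
  open O -> smooth_on O f ->
  smooth_on O (fun x => const_mx (f x) : 'rV[R]_n).
Proof.
by move=> oO sf; apply: smooth_on_row => // i; under eq_fun do rewrite mxE.
Qed.

Global Instance findim_J1 n : findim (J1 R n).
Proof.
exact (findim_prod (findim_prod findim_R (findim_rV n)) (findim_rV n)).
Qed.

Lemma smooth_on_jpt (O : set R) (u q p : R -> R) : open O ->
  smooth_on O u -> smooth_on O q -> smooth_on O p ->
  smooth_on O (fun s => jpt (u s) (q s) (p s)).
Proof.
move=> oO su sq sp; apply: (smooth_on_pair oO); last exact: smooth_on_const_mx.
by apply: (smooth_on_pair oO) => //; exact: smooth_on_const_mx.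
Qed.

Lemma smooth_u n : smooth_on setT (fun z : J1 R n => z.1.1).
Proof.
apply: (smooth_comp (f := fun z : J1 R n => z.1) (g := fun w : R * 'rV[R]_n => w.1) _).
  exact: smooth_on_fst.
exact: smooth_on_fst.
Qed.

Lemma smooth_base n : smooth_on setT (fun z : J1 R n => z.1.2).
Proof.
apply: (smooth_comp (f := fun z : J1 R n => z.1) (g := fun w : R * 'rV[R]_n => w.2) _).
  exact: smooth_on_fst.
exact: smooth_on_snd.
Qed.

Lemma smooth_q n i : smooth_on setT (fun z : J1 R n => z.1.2 0 i : R).
Proof.
apply: (smooth_comp (g := fun w : 'rV[R]_n => w 0 i : R) _ (@smooth_base n)).
exact: smooth_on_coord.
Qed.

Lemma smooth_p n i : smooth_on setT (fun z : J1 R n => z.2 0 i : R).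
Proof.
apply: (smooth_comp (f := fun z : J1 R n => z.2) (g := fun w : 'rV[R]_n => w 0 i : R) _).
  exact: smooth_on_snd.
exact: smooth_on_coord.
Qed.

(** The parametrization is cut down to an interval around the given point. Since U is open and [psi]
    is continuous, the resulting piece fills L near each of its points. *)
Lemma legendrian_chart (L : set (J1 R 1)) : legendrian setT L ->
  forall z, L z -> exists (c d m : R) phi k,
  [/\ arc L [set x | c < x < d] phi k, c < m < d & phi m = z].
Proof.
move=> [_ leg] z Lz; have [U [V [phi [psi [oU Uz oV [sphi spsi im can] _]]]]] := leg z Lz.
move/smooth_onT in sphi; move/smooth_onT in spsi; rewrite setIT in im can.
have canV x : V x -> psi (phi x) = x by move=> Vx; apply: can; rewrite inE.
have [a Va az] : (phi @` V) z by rewrite im.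
have sc : smooth_on setT (fun s : R => const_mx s : 'rV[R]_1).
  by apply: (@smooth_on_const_mx R setT 1%N (fun s => s) openT); exact: smooth_on_id.
have ca : nbhs (a 0 0) [set s : R | V (const_mx s)].
  apply: (smooth_on_cont sc (x := a 0 0)) => //.
  by rewrite -rV1E; exact: open_nbhs_nbhs.
have /nbhs_ballP[r /= r0 rV] := ca.
have rV' s : a 0 0 - r < s < a 0 0 + r -> V (const_mx s).
  by move=> hs; apply: rV; rewrite /ball/= ltr_norml; lra.
exists (a 0 0 - r), (a 0 0 + r), (a 0 0), (fun s => phi (const_mx s)), (fun z => psi z 0 0).
split; [|lra|by rewrite -rV1E].
have skk : smooth_on setT (fun z : J1 R 1 => psi z 0 0 : R).
  apply: (smooth_comp (g := fun w : 'rV[R]_1 => w 0 0 : R) _ spsi).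
  exact: smooth_on_coord.
have oI : open [set x | a 0 0 - r < x < a 0 0 + r].
  rewrite (_ : [set x | _] = [set x | a 0 0 - r < x] `&` [set x | x < a 0 0 + r]).
    by apply: openI; [exact: open_gt|exact: open_lt].
  by apply/seteqP; split => x /=; [move/andP|move=> [-> ->]].
have inU s : a 0 0 - r < s < a 0 0 + r -> (U `&` L) (phi (const_mx s)).
  by move=> hs; rewrite -im; exists (const_mx s) => //; exact: rV'.
split => //.
- apply: (smooth_on_compT _ oI _ sphi).
  exact: smooth_on_sub sc.
- by move=> s /inU[].
- by move=> s hs; rewrite canV ?mxE//; exact: rV'.
- by move=> s hs; exists setT, (fun z => psi z 0 0); split => //; exact: openT.
- move=> s hs; have [Us Ls] := inU s hs.
  have n1 : \forall y \near phi (const_mx s), U y by exact: open_nbhs_nbhs.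
  have n2 : \forall y \near phi (const_mx s), a 0 0 - r < psi y 0 0 < a 0 0 + r.
    have h : nbhs (psi (phi (const_mx s)) 0 0) [set x | a 0 0 - r < x < a 0 0 + r].
      by apply: open_nbhs_nbhs; split => //; rewrite /= canV ?mxE//; exact: rV'.
    exact: (smooth_on_cont skk (x := phi (const_mx s)) I h).
  near=> y => Ly; exists (psi y 0 0); first by near: y.
  have [b Vb <-] : (phi @` V) y by rewrite im; split => //; near: y.
  by rewrite canV// -rV1E.
Unshelve. all: by end_near. Qed.

(** Near s the curve factors as [phi \o psi \o c], so its velocity is in the image of the
    differential of [phi], where the contact form vanishes. *)
Lemma legendrian_tangent (L : set (J1 R 1)) (c : R -> J1 R 1) s :
  legendrian setT L -> smooth_on setT c -> (forall s, L (c s)) ->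
  ('D_1 c s).1.1 = ((c s).2 *m ('D_1 c s).1.2^T) 0 0.
Proof.
move=> [_ leg] sc Lc.
have [U [V [phi [psi [oU Uz oV [sphi spsi im can] tan]]]]] := leg _ (Lc s).
move/smooth_onT in sphi; move/smooth_onT in spsi; rewrite setIT in im can.
have canV x : V x -> psi (phi x) = x by move=> Vx; apply: can; rewrite inE.
have [a Va az] : (phi @` V) (c s) by rewrite im.
have pa : psi (c s) = a by rewrite -az canV.
have nU : \forall t \near s, U (c t).
  have h : nbhs (c s) U by exact: open_nbhs_nbhs.
  exact: (smooth_on_cont sc (x := s) I h).
have E : \forall t \near s, c t = phi (psi (c t)).
  apply: filterS nU => t Ut; have [b Vb <-] : (phi @` V) (c t) by rewrite im.
  by rewrite canV.
have dc : differentiable c s by exact: (smooth_on_diff sc).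
have dpsi : differentiable psi (c s) by exact: (smooth_on_diff spsi).
have dpc : differentiable (psi \o c) s by exact: differentiable_comp.
have dphi : differentiable phi (psi (c s)) by exact: (smooth_on_diff sphi).
have -> : 'D_1 c s = 'D_('D_1 (psi \o c) s) phi a.
  rewrite (near_eq_derive _ E) (deriveE _ (differentiable_comp dpc dphi)).
  have /(congr1 (@^~ (1:R)))/= -> := diff_comp dpc dphi.
  by rewrite (deriveE _ dpc) -pa (deriveE _ dphi).
by have [_ /(_ ('D_1 (psi \o c) s))] := tan a Va I; rewrite az.
Qed.

(** The classification is applied to the line s |-> (0, s, 0); the equation for u' is tangency to
    the contact structure. *)
Lemma knot_param (L : set (J1 R 1)) (M : R) : legendrian setT L -> connected L ->
  (forall z, M < `|qcoord z| -> (L z <-> zero_section z)) ->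
  exists (u x p : R -> R) (delta : J1 R 1 -> R) M',
  [/\ [/\ smooth_on setT u, smooth_on setT x, smooth_on setT p &
       smooth_on setT delta],
    [/\ forall s, L (jpt (u s) (x s) (p s)),
       forall s, delta (jpt (u s) (x s) (p s)) = s &
       forall u0 q p0, L (jpt u0 q p0) -> exists s, [/\ u s = u0, x s = q & p s = p0]],
    [/\ M <= M', forall s, M' <= `|s| -> [/\ u s = 0, x s = s & p s = 0] &
        forall u0 q p0, M' <= `|q| -> (L (jpt u0 q p0) <-> u0 = 0 /\ p0 = 0)] &
    forall s, is_derive s (1:R) u (p s * 'D_1 x s)].
Proof.
move=> leg con ends.
have [||||||gam [g [M' [A MM' He sur]]]] :=
    @arc_global R (J1 R 1) _ L (fun s => jpt 0 s 0) (@qcoord R) M _ _ _ _ _ _ con.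
- exact: (@smooth_q 1 0).
- apply: (smooth_on_jpt openT); [exact: smooth_on_cst|exact: smooth_on_id|exact: smooth_on_cst].
- by move=> s; rewrite /qcoord /jpt /= mxE.
- move=> z Lz Mz; have [u0 p0] := (ends z Mz).1 Lz.
  by rewrite {1}(jptE z) u0 p0 mxE.
- move=> s Ms; apply/ends; first by rewrite /qcoord /jpt /= mxE.
  by split => //=; apply/rowP => i; rewrite !mxE.
- exact: legendrian_chart.
have [|||delta sdelta hdelta] :=
    @arc_global_inverse R (J1 R 1) _ L (fun s => jpt 0 s 0) (@qcoord R) M _ _ _ _ _ _ A MM' He.
- exact: (@smooth_q 1 0).
- by move=> s; rewrite /qcoord /jpt /= mxE.
- move=> z Lz Mz; have [u0 p0] := (ends z Mz).1 Lz.
  by rewrite {1}(jptE z) u0 p0 mxE.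
have gE s : gam s = jpt (gam s).1.1 ((gam s).1.2 0 0) ((gam s).2 0 0) by exact: jptE.
have sg := arc_smooth A.
(* [ends] requires M < |q| strictly while the new bound is used with a weak inequality, hence
   [M' + 1]. *)
exists (fun s => (gam s).1.1), (fun s => (gam s).1.2 0 0), (fun s => (gam s).2 0 0), delta, (M' + 1).
split.
- split => //.
  + apply: (smooth_comp (g := fun z : J1 R 1 => z.1.1) _ sg); exact: (@smooth_u 1).
  + apply: (smooth_comp (g := fun z : J1 R 1 => z.1.2 0 0 : R) _ sg); exact: (@smooth_q 1 0).
  + apply: (smooth_comp (g := fun z : J1 R 1 => z.2 0 0 : R) _ sg); exact: (@smooth_p 1 0).
- split.
  + by move=> s; rewrite -gE; exact: (arc_in A).
  + by move=> s; rewrite -gE.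
  + move=> u0 q p0 /sur[s E]; exists s; rewrite E /=.
    by rewrite !mxE.
- split; first lra.
  + move=> s Ms; rewrite He; last lra.
    by rewrite /= !mxE.
  + move=> u0 q p0 Mq.
    rewrite ends /zero_section /=; last by rewrite /qcoord /= mxE; lra.
    split=> -[-> h]; split => //; last by rewrite h; apply/rowP => i; rewrite !mxE.
    by move/rowP/(_ 0): h; rewrite !mxE.
- move=> s.
  have dg : differentiable gam s by exact: (smooth_on_diff sg).
  have tan := legendrian_tangent s leg sg (fun s => arc_in A (s := s) I).
  have dlin (l : J1 R 1 -> R) : linear l -> smooth_on setT l ->
      is_derive s (1:R) (fun s => l (gam s)) (l ('D_1 gam s)).
    move=> linl sl.
    pose l' : {linear J1 R 1 -> R} := HB.pack l (GRing.isLinear.Build _ _ _ _ _ linl).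
    have cl : continuous l' by move=> z; exact: (smooth_on_cont sl).
    have dl : differentiable l' (gam s) by exact: linear_differentiable.
    have dlg : differentiable (l' \o gam) s by exact: differentiable_comp.
    change (is_derive s (1:R) (l' \o gam) (l' ('D_1 gam s))).
    apply: DeriveDef; first exact: diff_derivable.
    rewrite (deriveE _ dlg) (deriveE _ dg).
    have /(congr1 (@^~ (1:R)))/= -> := diff_comp dg dl.
    by have /(congr1 (@^~ ('d gam s 1))) -> := diff_lin (gam s) cl.
  have du : is_derive s (1:R) (fun s => (gam s).1.1) ('D_1 gam s).1.1.
    by apply: (dlin (fun z => z.1.1)); [move=> a z w|exact: (@smooth_u 1)].
  have dx : is_derive s (1:R) (fun s => (gam s).1.2 0 0) (('D_1 gam s).1.2 0 0).
    apply: (dlin (fun z => z.1.2 0 0)); last exact: (@smooth_q 1 0).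
    by move=> a z w; rewrite /= !mxE.
  have [_ ->] := dx; apply: is_derive_eq du _; rewrite tan.
  by rewrite mxE big_ord1 mxE.
Qed.

End JetLine.

(** * Derivatives of generating functions *)

Section FindimLinear.
Context {R : realType} {V W : normedModType R} {fV : findim V}.
Variables (l : V -> W) (lin_l : linear l).

Let l' : {linear V -> W} := HB.pack l (GRing.isLinear.Build _ _ _ _ _ lin_l).

Lemma smooth_on_linear (O : set V) : smooth_on O l.
Proof.
suff s : smooth_on setT l by exact: smooth_on_sub s.
case: fV => -[n [e [c [cc ce]]]].
apply: (smooth_on_eq openT (f := fun v => \sum_i c i v *: l' (e i))).
  move=> v _; rewrite -[l v]/(l' v) [in RHS](ce v) linear_sum.
  by apply: eq_bigr => i _; rewrite linearZ.
apply: (smooth_on_sum openT) => i; apply: (smooth_onZ openT).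
  exact: smooth_on_lin.
exact: smooth_on_cst.
Qed.

Lemma diff_linear (x v : V) : 'd l x v = l v.
Proof.
have cl : continuous l' by move=> z; exact: (smooth_on_cont (smooth_on_linear setT) (I : setT z)).
exact: (congr1 (@^~ v) (diff_lin x cl)).
Qed.

End FindimLinear.

Section Derivatives.
Context {R : realType}.
Implicit Types U V W : normedModType R.

Lemma diff_compE U V W (f : U -> V) (g : V -> W) x v :
  differentiable f x -> differentiable g (f x) ->
  'd (fun x => g (f x)) x v = 'd g (f x) ('d f x v).
Proof. by move=> df dg; exact: (congr1 (@^~ v) (diff_comp df dg)). Qed.

Lemma diff_pairE U V W (f : U -> V) (g : U -> W) x v :
  differentiable f x -> differentiable g x ->
  'd (fun x => (f x, g x)) x v = ('d f x v, 'd g x v).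
Proof. by move=> df dg; exact: (congr1 (@^~ v) (diff_pair df dg)). Qed.

Lemma diff_cstE V W (a : W) (x v : V) : 'd (fun=> a) x v = 0.
Proof. by rewrite (congr1 (@^~ v) (diff_cst a x)). Qed.

Lemma differentiable_id V (x : V) : differentiable (fun x => x) x.
Proof. by have [] := is_diff_id x. Qed.

Lemma diff_idE V (x v : V) : 'd (fun x => x) x v = v.
Proof. by rewrite (congr1 (@^~ v) (@diff_val _ _ _ _ _ _ _ (is_diff_id x))). Qed.

Lemma diff_coordE V k (f : V -> 'rV[R]_k) x v i : differentiable f x ->
  ('d f x v) 0 i = 'd (fun x => f x 0 i : R) x v.
Proof.
move=> df.
have lc : linear (fun w : 'rV[R]_k => w 0 i : R) by exact: coord_is_linear.
have dc : differentiable (fun w : 'rV[R]_k => w 0 i : R) (f x).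
  exact: (smooth_diff (smooth_on_linear lc setT) (f x)).
by rewrite (diff_compE v df dc) diff_linear.
Qed.

Lemma grad0P k (f : 'rV[R]_k -> R) y : differentiable f y ->
  grad f y = 0 <-> forall v, 'D_v f y = 0.
Proof.
move=> df; split=> [/rowP g0 v|h]; last by apply/rowP => i; rewrite !mxE h.
rewrite (deriveE _ df) (row_sum_delta v) linear_sum big1// => i _.
by rewrite linearZ/= -(deriveE _ df); move: (g0 i); rewrite !mxE => ->; rewrite scaler0.
Qed.

Lemma gradE k (f : 'rV[R]_k -> R) y v : differentiable f y ->
  'D_v f y = \sum_i v 0 i * grad f y 0 i.
Proof.
move=> df; rewrite (deriveE _ df) {1}(row_sum_delta v) linear_sum.
by apply: eq_bigr => i _; rewrite linearZ/= -(deriveE _ df) mxE.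
Qed.

End Derivatives.

Section GfDerivatives.
Context {R : realType}.
Variables (n k : nat) (F : 'rV[R]_n -> 'rV[R]_k -> R).
Hypothesis sF : smooth_family F.
Let Fh (z : 'rV[R]_n * 'rV[R]_k) := F z.1 z.2.

Lemma smooth_gf : smooth_on setT Fh. Proof. by apply/smooth_onT. Qed.

Lemma gf_pair_diff x w : differentiable Fh (x, w).
Proof. exact: (smooth_diff smooth_gf (x, w)). Qed.

Let dpl (x : 'rV[R]_n) (w : 'rV[R]_k) : differentiable (fun x : 'rV[R]_n => (x, w)) x.
Proof.
by apply: differentiable_pair; [exact: differentiable_id|exact: (differentiable_cst w x)].
Qed.
Let dpr (x : 'rV[R]_n) (w : 'rV[R]_k) : differentiable (fun w => (x, w)) w.
Proof.
by apply: differentiable_pair; [exact: (differentiable_cst x w)|exact: differentiable_id].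
Qed.

Lemma gf_diff_w x w : differentiable (F x) w.
Proof. exact: (@differentiable_comp _ _ _ _ (fun w => (x, w)) Fh w (dpr x w) (gf_pair_diff x w)). Qed.

Lemma gf_diff_x x w : differentiable (F^~ w) x.
Proof. exact: (@differentiable_comp _ _ _ _ (fun x => (x, w)) Fh x (dpl x w) (gf_pair_diff x w)). Qed.

Lemma gf_deriv_w x w b : 'D_b (F x) w = 'd Fh (x, w) (0, b).
Proof.
rewrite (deriveE _ (gf_diff_w x w)) (@diff_compE _ _ _ _ (fun w => (x, w)) Fh w _ (dpr x w) (gf_pair_diff x w)).
by rewrite diff_pairE ?diff_cstE ?diff_idE//; exact: differentiable_id.
Qed.

Lemma gf_deriv_x x w a : 'D_a (F^~ w) x = 'd Fh (x, w) (a, 0).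
Proof.
rewrite (deriveE _ (gf_diff_x x w)) (@diff_compE _ _ _ _ (fun x => (x, w)) Fh x _ (dpl x w) (gf_pair_diff x w)).
by rewrite diff_pairE ?diff_cstE ?diff_idE//; exact: differentiable_id.
Qed.

Lemma gf_diffE x w a b :
  'd Fh (x, w) (a, b) = 'D_a (F^~ w) x + 'D_b (F x) w.
Proof.
rewrite gf_deriv_x gf_deriv_w -linearD; congr ('d _ _ _).
by apply/pair_equal_spec => /=; rewrite addr0 add0r.
Qed.

Lemma smooth_gf_dw : smooth_on setT (@gf_dw R n (GF F)).
Proof.
apply: (smooth_on_row openT) => i.
apply: (smooth_on_eq openT (f := 'D_(0, delta_mx 0 i) Fh)).
  move=> -[x w] _; rewrite mxE gf_deriv_w deriveE//; exact: gf_pair_diff.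
exact: smooth_on_D smooth_gf.
Qed.

End GfDerivatives.

Section Regular.
Context {R : realType}.
Implicit Types n k : nat.

Lemma regularP n (D : set 'rV[R]_n) (F : gf R n) : is_gf D F <->
  smooth_family F /\ forall x w, D x -> gf_dw (F := F) (x, w) = 0 ->
    forall y, exists v, 'd (@gf_dw _ _ F) (x, w) v = y.
Proof.
split=> -[sF h]; split => //.
  move=> x w Dx g0 y; have : setT y by [].
  by rewrite -(h (x, w) Dx g0) => -[v _ <-]; exists v.
move=> [x w] Dx g0; apply/seteqP; split => // y _.
by have [v <-] := h x w Dx g0 y; exists v.
Qed.

Lemma gf_dw0P n (F : gf R n) x w : smooth_family F ->
  gf_dw (F := F) (x, w) = 0 <-> forall v, 'D_v (F x) w = 0.
Proof. by move=> sF; apply: grad0P; exact: gf_diff_w. Qed.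

End Regular.

Section Quad.
Context {R : realType}.

Lemma linear_row_sum k (W : lmodType R) (l : 'rV[R]_k -> W) b : linear l ->
  l b = \sum_j b 0 j *: l (delta_mx 0 j).
Proof.
move=> ll; pose l' : {linear 'rV[R]_k -> W} :=
  HB.pack l (GRing.isLinear.Build _ _ _ _ _ ll).
rewrite -[l b]/(l' b) {1}(row_sum_delta b) linear_sum.
by apply: eq_bigr => j _; rewrite linearZ.
Qed.

Lemma derive_sum_mul (V : normedModType R) m (f g : 'I_m -> V -> R) x v :
  (forall j, differentiable (f j) x) -> (forall j, differentiable (g j) x) ->
  'D_v (fun z => \sum_j f j z * g j z) x =
  \sum_j (f j x * 'D_v (g j) x + g j x * 'D_v (f j) x).
Proof.
move=> df dg.
rewrite (_ : (fun z => _) = \sum_j (f j * g j)); last first.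
  by apply/funext => z; rewrite fct_sumE.
rewrite derive_sum.
  by apply: eq_bigr => j _; rewrite deriveM//; exact: diff_derivable.
by move=> j; apply: derivableM; exact: diff_derivable.
Qed.

Lemma quadE k (A : 'M[R]_k) w : quad A w = \sum_j (w *m A) 0 j * w 0 j.
Proof. by rewrite /quad mxE; apply: eq_bigr => j _; rewrite [X in _ * X]mxE. Qed.

Lemma quad0 k (A : 'M[R]_k) : quad A 0 = 0.
Proof. by rewrite /quad mul0mx mul0mx mxE. Qed.

Lemma mulmx_coord_linear k k' (A : 'M[R]_(k, k')) j :
  linear (fun w : 'rV[R]_k => (w *m A) 0 j : R).
Proof. by move=> a u v; rewrite mulmxDl -scalemxAl !mxE. Qed.

Lemma smooth_quad k (A : 'M[R]_k) : smooth_on setT (quad A).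
Proof.
apply: (smooth_on_eq openT (f := fun w => \sum_j (w *m A) 0 j * w 0 j)).
  by move=> w _; rewrite quadE.
apply: (smooth_on_sum openT) => j; apply: (smooth_onM openT).
  exact: smooth_on_linear (mulmx_coord_linear A j) setT.
exact: smooth_on_coord.
Qed.

Lemma derive_quad k (A : 'M[R]_k) w v : A^T = A ->
  'D_v (quad A) w = 2 * (w *m A *m v^T) 0 0.
Proof.
move=> sA.
have l1 j := mulmx_coord_linear A j.
have l2 (j : 'I_k) : linear (fun w : 'rV[R]_k => w 0 j : R) by exact: coord_is_linear.
have d1 j : differentiable (fun w : 'rV[R]_k => (w *m A) 0 j : R) w.
  exact: (smooth_diff (smooth_on_linear (l1 j) setT) w).
have d2 (j : 'I_k) : differentiable (fun w : 'rV[R]_k => w 0 j : R) w.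
  exact: (smooth_diff (smooth_on_linear (l2 j) setT) w).
rewrite (_ : quad A = fun w => \sum_j (w *m A) 0 j * w 0 j); last first.
  by apply/funext => u; exact: quadE.
rewrite (derive_sum_mul _ d1 d2) big_split /=.
under eq_bigr do rewrite (deriveE _ (d2 _)) (diff_linear (l2 _)).
under [X in _ + X]eq_bigr do rewrite (deriveE _ (d1 _)) (diff_linear (l1 _)).
have e1 : \sum_i (w *m A) 0 i * v 0 i = (w *m A *m v^T) 0 0.
  by rewrite [RHS]mxE; apply: eq_bigr => j _; rewrite [X in _ = _ * X]mxE.
have e2 : \sum_i w 0 i * (v *m A) 0 i = (w *m A *m v^T) 0 0.
  have -> : (w *m A *m v^T) 0 0 = ((v *m A) *m w^T) 0 0.
    have -> : v *m A *m w^T = (w *m A *m v^T)^T by rewrite !trmx_mul trmxK sA mulmxA.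
    by rewrite [RHS]mxE.
  by rewrite [RHS]mxE; apply: eq_bigr => j _; rewrite [X in _ = _ * X]mxE mulrC.
by rewrite e1 e2 mulr_natl mulr2n.
Qed.

(** Testing against the standard basis gives w A = 0, and A is invertible. *)
Lemma nondegenerate_ker k (A : 'M[R]_k) (w : 'rV[R]_k) : nondegenerate_mx A ->
  (forall v : 'rV[R]_k, (w *m A *m v^T) 0 0 = 0) -> w = 0.
Proof.
move=> [_ uA] h; rewrite -(mulmxK uA w).
suff -> : w *m A = 0 by rewrite mul0mx.
apply/rowP => j; have := h (delta_mx 0 j).
by rewrite trmx_delta -colE !mxE.
Qed.

End Quad.

(** * Equivalence of generating functions *)

Section Fiberwise.
Context {R : realType}.
Variables (n k : nat) (F : 'rV[R]_n -> 'rV[R]_k -> R).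
Variables (phi psi : 'rV[R]_n -> 'rV[R]_k -> 'rV[R]_k).
Hypotheses (sF : smooth_family F) (sphi : smooth_family phi) (spsi : smooth_family psi).
Hypothesis can1 : forall x, cancel (phi x) (psi x).
Hypothesis can2 : forall x, cancel (psi x) (phi x).
Let G x w := F x (phi x w).
Let Fh (z : 'rV[R]_n * 'rV[R]_k) := F z.1 z.2.
Let ph (z : 'rV[R]_n * 'rV[R]_k) := phi z.1 z.2.
Let qh (z : 'rV[R]_n * 'rV[R]_k) := psi z.1 z.2.
Let Phi (z : 'rV[R]_n * 'rV[R]_k) := (z.1, ph z).
Let Psi (z : 'rV[R]_n * 'rV[R]_k) := (z.1, qh z).

Let sph : smooth_on setT ph. Proof. by apply/smooth_onT. Qed.
Let sqh : smooth_on setT qh. Proof. by apply/smooth_onT. Qed.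
Let sFh : smooth_on setT Fh. Proof. by apply/smooth_onT. Qed.
Let sPhi : smooth_on setT Phi.
Proof. by apply: (smooth_on_pair openT) => //; exact: smooth_on_fst. Qed.
Let sPsi : smooth_on setT Psi.
Proof. by apply: (smooth_on_pair openT) => //; exact: smooth_on_fst. Qed.

Lemma fiberwise_smooth : smooth_family G.
Proof.
apply/smooth_onT; apply: (smooth_comp (f := Phi) (g := Fh) _ sPhi sFh).
Qed.
Let sG := fiberwise_smooth.

Let dph z : differentiable ph z. Proof. exact: (smooth_diff sph z). Qed.
Let dqh z : differentiable qh z. Proof. exact: (smooth_diff sqh z). Qed.
Let dPhi z : differentiable Phi z. Proof. exact: (smooth_diff sPhi z). Qed.
Let dPsi z : differentiable Psi z. Proof. exact: (smooth_diff sPsi z). Qed.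

Let dfst (z : 'rV[R]_n * 'rV[R]_k) : differentiable (fun z => z.1) z.
Proof. exact: (smooth_diff (@smooth_on_fst _ _ _ setT) z). Qed.

Let dfstE (z a : 'rV[R]_n * 'rV[R]_k) : 'd (fun z => z.1) z a = a.1.
Proof. by apply: (@diff_linear _ _ _ _ (fun z : 'rV[R]_n * 'rV[R]_k => z.1)) => c u v. Qed.

Let dPhiE z a : 'd Phi z a = (a.1, 'd ph z a).
Proof. by rewrite (diff_pairE _ (dfst z) (dph z)) dfstE. Qed.

Let dGE x w a b : 'd (fun z => G z.1 z.2) (x, w) (a, b) =
  'D_a (F^~ (phi x w)) x + 'D_('d ph (x, w) (a, b)) (F x) (phi x w).
Proof.
have dF : differentiable Fh (Phi (x, w)) by exact: gf_pair_diff.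
rewrite (@diff_compE _ _ _ _ Phi Fh (x, w) (a, b) (dPhi _) dF) dPhiE /=.
by rewrite gf_diffE.
Qed.

Let deriv_w x w b : 'D_b (G x) w = 'D_('d ph (x, w) (0, b)) (F x) (phi x w).
Proof.
rewrite gf_deriv_w// dGE (deriveE _ (gf_diff_x sF x _)) linear0 add0r //.
Qed.

Lemma fiberwise_crit x w : gf_dw (F := GF F) (x, phi x w) = 0 ->
  gf_dw (F := GF G) (x, w) = 0.
Proof.
by move=> /(gf_dw0P (F := GF F) _ _ sF) h; apply/(gf_dw0P (F := GF G) _ _ sG) => v; rewrite /= deriv_w.
Qed.

Lemma fiberwise_contour (D : set 'rV[R]_n) : contour D (GF F) `<=` contour D (GF G).
Proof.
move=> [[u x] y] [/= Dx [w [/= cw uE yE]]]; split => //=; exists (psi x w); split => /=.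
- by apply: fiberwise_crit; rewrite can2.
- by rewrite /G can2.
rewrite yE; apply/rowP => i; rewrite !mxE.
rewrite (gf_deriv_x sG) dGE can2.
by move/(gf_dw0P (F := GF F) _ _ sF): cw => ->; rewrite addr0.
Qed.

Let fiberwise_dw z : gf_dw (F := GF G) z = \row_i \sum_j
  'D_(0, delta_mx 0 i) ph z 0 j * (gf_dw (F := GF F) (Phi z)) 0 j.
Proof.
case: z => x w; apply/rowP => i; rewrite !mxE deriv_w (gradE _ (gf_diff_w sF x _)).
by apply: eq_bigr => j _; rewrite deriveE.
Qed.

(** [gf_dw G] is the fibre Jacobian of phi applied to [gf_dw F]. At a critical point the product
    rule keeps only the terms that differentiate [gf_dw F], and the Jacobian is inverted by that of
    psi. *)
Lemma fiberwise_regular (D : set 'rV[R]_n) :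
  (forall x w, D x -> gf_dw (F := GF G) (x, w) = 0 -> gf_dw (F := GF F) (x, phi x w) = 0) ->
  is_gf D (GF F) -> is_gf D (GF G).
Proof.
move=> crit /regularP[_ reg]; apply/regularP; split; first exact: sG.
move=> x w Dx c0 y; have cF := crit x w Dx c0.
pose z0 : 'rV[R]_n * 'rV[R]_k := (x, w).
pose z1 : 'rV[R]_n * 'rV[R]_k := (x, phi x w).
have reg1 : forall y, exists v, 'd (@gf_dw _ _ (GF F)) z1 v = y.
  exact: reg x (phi x w) Dx cF.
change (exists v, 'd (@gf_dw _ _ (GF G)) z0 v = y).
have dF1 : differentiable (@gf_dw _ _ (GF F)) z1.
  exact: (smooth_diff (smooth_gf_dw sF) z1).
have dG0 : differentiable (@gf_dw _ _ (GF G)) z0.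
  exact: (smooth_diff (smooth_gf_dw sG) z0).
(* The value to be reached for F: y transformed by the fibre Jacobian of psi, which the Jacobian of
   phi undoes. *)
pose c : 'rV[R]_k := \row_j \sum_m y 0 m * 'D_(0, delta_mx 0 j) qh z1 0 m.
have [v' v'E] := reg1 c.
have Psi1 : Psi z1 = z0 by rewrite /Psi /qh /= can1.
have dPP : 'd Phi z0 ('d Psi z1 v') = v'.
  have := @diff_compE _ _ _ _ Psi Phi z1 v' (dPsi z1) (dPhi _).
  rewrite Psi1 => <-.
  rewrite (_ : (fun z => Phi (Psi z)) = fun z => z) ?diff_idE//.
  by apply/funext => -[a b]; rewrite /Phi /Psi /ph /qh /= can2.
exists ('d Psi z1 v'); apply/rowP => i.
have dFP : differentiable (fun z => gf_dw (F := GF F) (Phi z)) z0.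
  exact: (@differentiable_comp _ _ _ _ Phi (@gf_dw _ _ (GF F)) z0 (dPhi z0) dF1).
have dFPj j : differentiable (fun z => gf_dw (F := GF F) (Phi z) 0 j : R) z0.
  have dc : differentiable (fun u : 'rV[R]_k => u 0 j : R) (gf_dw (F := GF F) (Phi z0)).
    exact: differentiable_coord.
  exact: (@differentiable_comp _ _ _ _ (fun z => gf_dw (F := GF F) (Phi z))
     (fun u : 'rV[R]_k => u 0 j : R) z0 dFP dc).
have dJ j : differentiable (fun z => 'D_(0, delta_mx 0 i) ph z 0 j : R) z0.
  have dD : differentiable ('D_(0, delta_mx 0 i) ph) z0.
    exact: (smooth_diff (smooth_on_D _ sph) z0).
  have dc : differentiable (fun u : 'rV[R]_k => u 0 j : R) ('D_(0, delta_mx 0 i) ph z0).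
    exact: differentiable_coord.
  exact: (@differentiable_comp _ _ _ _ ('D_(0, delta_mx 0 i) ph)
     (fun u : 'rV[R]_k => u 0 j : R) z0 dD dc).
have dGi : differentiable (fun z => gf_dw (F := GF G) z 0 i : R) z0.
  have dc : differentiable (fun u : 'rV[R]_k => u 0 i : R) (gf_dw (F := GF G) z0).
    exact: differentiable_coord.
  exact: (@differentiable_comp _ _ _ _ (@gf_dw _ _ (GF G))
     (fun u : 'rV[R]_k => u 0 i : R) z0 dG0 dc).
rewrite (diff_coordE _ _ dG0) -(deriveE _ dGi).
rewrite (_ : (fun z => _) = fun z => \sum_j
  'D_(0, delta_mx 0 i) ph z 0 j * (gf_dw (F := GF F) (Phi z)) 0 j); last first.
  by apply/funext => z; rewrite fiberwise_dw mxE.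
rewrite (derive_sum_mul _ dJ dFPj).
have cj j : gf_dw (F := GF F) (Phi z0) 0 j = 0 by rewrite [gf_dw _]cF mxE.
have v'E' : 'd (@gf_dw _ _ (GF F)) (Phi z0) v' = c by exact: v'E.
under eq_bigr => j _.
  rewrite cj mul0r addr0 (deriveE _ (dFPj j)) -(diff_coordE _ _ dFP).
  rewrite (@diff_compE _ _ _ _ Phi (@gf_dw _ _ (GF F)) z0 _ (dPhi z0) dF1) dPP.
  rewrite v'E' [c 0 j]mxE mulr_sumr; over.
rewrite exchange_big /=.
(* The chain rule for [psi x \o phi x = id] in the fibre direction i. *)
have key m : \sum_j 'D_(0, delta_mx 0 i) ph z0 0 j * 'D_(0, delta_mx 0 j) qh z1 0 m
    = (delta_mx 0 i : 'rV[R]_k) 0 m.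
  have E1 : 'd qh z1 (0, 'D_(0, delta_mx 0 i) ph z0) = delta_mx 0 i.
    have -> : (0, 'D_(0, delta_mx 0 i) ph z0) = 'd Phi z0 (0, delta_mx 0 i).
      by rewrite dPhiE /= deriveE.
    rewrite -(@diff_compE _ _ _ _ Phi qh z0 _ (dPhi z0) (dqh _)).
    rewrite (_ : (fun z => qh (Phi z)) = fun z => z.2).
      by apply: (@diff_linear _ _ _ _ (fun z : 'rV[R]_n * 'rV[R]_k => z.2)) => a u v.
    by apply/funext => -[a b]; rewrite /Phi /ph /qh /= can1.
  have ll : linear (fun b => 'd qh z1 (0, b)).
    move=> a u v /=; rewrite -linearP; congr ('d _ _ _).
    by apply/pair_equal_spec; rewrite /= scaler0 addr0.
  rewrite -[RHS](congr1 (fun u : 'rV[R]_k => u 0 m) E1) (linear_row_sum _ ll).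
  rewrite summxE; apply: eq_bigr => j _.
  by rewrite [RHS]mxE; congr (_ * _); rewrite (deriveE _ (dqh z1)).
rewrite (eq_bigr (fun m => y 0 m * (delta_mx 0 i : 'rV[R]_k) 0 m)).
  rewrite (bigD1 i)//= mxE !eqxx mulr1 big1 ?addr0// => m mi.
  by rewrite mxE eqxx (negbTE mi) mulr0.
move=> m _; rewrite -key mulr_sumr; apply: eq_bigr => j _; ring.
Qed.

End Fiberwise.

Section RowMx.
Context {R : realType}.

Lemma derive_add_cst (V W : normedModType R) (f : V -> W) (c : W) x v :
  differentiable f x -> 'D_v (f + cst c) x = 'D_v f x.
Proof.
move=> df; have d1 : derivable f x v by exact: diff_derivable.
have d2 : derivable (cst c : V -> W) x v by exact: derivable_cst.
by rewrite deriveD// derive_cst addr0.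
Qed.

Lemma row_mx_is_linear k k' :
  linear (fun p : 'rV[R]_k * 'rV[R]_k' => row_mx p.1 p.2).
Proof. by move=> a u v /=; rewrite scale_row_mx add_row_mx. Qed.

Lemma lsubmx_is_linear k k' : linear (fun w : 'rV[R]_(k + k') => lsubmx w).
Proof. by move=> a u v; rewrite linearP. Qed.

Lemma rsubmx_is_linear k k' : linear (fun w : 'rV[R]_(k + k') => rsubmx w).
Proof. by move=> a u v; rewrite linearP. Qed.

Lemma smooth_on_row_mx (V : normedModType R) (O : set V) k k' (f : V -> 'rV[R]_k)
    (g : V -> 'rV[R]_k') : open O -> smooth_on O f -> smooth_on O g ->
  smooth_on O (fun z => row_mx (f z) (g z)).
Proof.
move=> oO sf sg.
apply: (smooth_on_compT (f := fun z => (f z, g z)) (g := fun p => row_mx p.1 p.2) _ oO).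
  exact: smooth_on_pair.
exact: smooth_on_linear (@row_mx_is_linear k k') setT.
Qed.

Lemma smooth_on_lsubmx (V : normedModType R) (O : set V) k k'
    (f : V -> 'rV[R]_(k + k')) : open O -> smooth_on O f ->
  smooth_on O (fun z => lsubmx (f z)).
Proof.
move=> oO sf; apply: (smooth_on_compT (g := fun w => lsubmx w) _ oO sf).
exact: smooth_on_linear (@lsubmx_is_linear k k') setT.
Qed.

Lemma smooth_on_rsubmx (V : normedModType R) (O : set V) k k'
    (f : V -> 'rV[R]_(k + k')) : open O -> smooth_on O f ->
  smooth_on O (fun z => rsubmx (f z)).
Proof.
move=> oO sf; apply: (smooth_on_compT (g := fun w => rsubmx w) _ oO sf).
exact: smooth_on_linear (@rsubmx_is_linear k k') setT.
Qed.

Lemma smooth_family_comp (V : normedModType R) n k k'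
    (F : 'rV[R]_n -> 'rV[R]_k -> V) (P : 'rV[R]_k' -> 'rV[R]_k) :
  smooth_family F -> smooth_on setT P -> smooth_family (fun x w => F x (P w)).
Proof.
move=> /smooth_onT sF sP; apply/smooth_onT.
apply: (smooth_comp (f := fun z : 'rV[R]_n * 'rV[R]_k' => (z.1, P z.2))
  (g := fun z => F z.1 z.2) _); last exact: sF.
apply: (smooth_on_pair openT); first exact: smooth_on_fst.
by apply: (smooth_comp _ _ sP); exact: smooth_on_snd.
Qed.

Lemma smooth_lsubmx k k' : smooth_on setT (fun w : 'rV[R]_(k + k') => lsubmx w).
Proof. exact: smooth_on_linear (@lsubmx_is_linear k k') setT. Qed.

Lemma smooth_rsubmx k k' : smooth_on setT (fun w : 'rV[R]_(k + k') => rsubmx w).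
Proof. exact: smooth_on_linear (@rsubmx_is_linear k k') setT. Qed.

Lemma diff_row_mx (V : normedModType R) k k' (f : V -> 'rV[R]_k)
    (g : V -> 'rV[R]_k') x v : differentiable f x -> differentiable g x ->
  'd (fun z => row_mx (f z) (g z)) x v = row_mx ('d f x v) ('d g x v).
Proof.
move=> df dg.
have dp : differentiable (fun z => (f z, g z)) x by exact: differentiable_pair.
have dl : differentiable (fun p : 'rV[R]_k * 'rV[R]_k' => row_mx p.1 p.2) (f x, g x).
  exact: (smooth_diff (smooth_on_linear (@row_mx_is_linear k k') setT) (f x, g x)).
rewrite (@diff_compE _ _ _ _ (fun z => (f z, g z)) (fun p => row_mx p.1 p.2) x v dp dl).
by rewrite (diff_linear (@row_mx_is_linear k k')) diff_pairE.
Qed.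

Lemma lsubmx_diff k k' (w : 'rV[R]_(k + k')) : differentiable (fun w => lsubmx w) w.
Proof. exact: (smooth_diff (smooth_on_linear (@lsubmx_is_linear k k') setT) w). Qed.

Lemma rsubmx_diff k k' (w : 'rV[R]_(k + k')) : differentiable (fun w => rsubmx w) w.
Proof. exact: (smooth_diff (smooth_on_linear (@rsubmx_is_linear k k') setT) w). Qed.

Lemma row_mx_eq0 k k' (a : 'rV[R]_k) (b : 'rV[R]_k') : row_mx a b = 0 <-> a = 0 /\ b = 0.
Proof.
split=> [|[-> ->]]; last by rewrite row_mx0.
by rewrite -row_mx0 => /eq_row_mx.
Qed.

End RowMx.

Section Stabilize.
Context {R : realType}.
Variables (n k k' : nat) (F : 'rV[R]_n -> 'rV[R]_k -> R) (A : 'M[R]_k').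
Hypotheses (sF : smooth_family F) (nA : nondegenerate_mx A).
Let G (x : 'rV[R]_n) (w : 'rV[R]_(k + k')) := F x (lsubmx w) + quad A (rsubmx w).

Lemma stabilize_smooth : smooth_family G.
Proof.
apply/smooth_onT; apply: (smooth_onD openT).
  by apply/smooth_onT; apply: (smooth_family_comp sF); exact: smooth_lsubmx.
apply: (smooth_comp (g := quad A) _); last exact: smooth_quad.
apply: (smooth_on_rsubmx openT); exact: smooth_on_snd.
Qed.
Let sG := stabilize_smooth.

Let dquad w : differentiable (quad A) w.
Proof. exact: (smooth_diff (smooth_quad A) w). Qed.

Let deriv_w x w v : 'D_v (G x) w =
  'D_(lsubmx v) (F x) (lsubmx w) + 2 * (rsubmx w *m A *m (rsubmx v)^T) 0 0.
Proof.
have d1 : differentiable (fun w => F x (lsubmx w)) w.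
  exact: (@differentiable_comp _ _ _ _ (fun w : 'rV[R]_(k + k') => lsubmx w) (F x) w (lsubmx_diff w) (gf_diff_w sF x _)).
have d2 : differentiable (fun w => quad A (rsubmx w)) w.
  exact: (@differentiable_comp _ _ _ _ (fun w : 'rV[R]_(k + k') => rsubmx w) (quad A) w (rsubmx_diff w) (dquad _)).
have -> : 'D_v (G x) w = 'D_v (fun w => F x (lsubmx w)) w + 'D_v (fun w => quad A (rsubmx w)) w.
  by apply: (deriveD (diff_derivable d1) (diff_derivable d2)).
rewrite (deriveE _ d1) (deriveE _ d2).
rewrite (@diff_compE _ _ _ _ (fun w : 'rV[R]_(k + k') => lsubmx w) (F x) w v (lsubmx_diff w) (gf_diff_w sF x _)).
rewrite (@diff_compE _ _ _ _ (fun w : 'rV[R]_(k + k') => rsubmx w) (quad A) w v (rsubmx_diff w) (dquad _)).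
rewrite -(deriveE _ (gf_diff_w sF x _)) -(deriveE _ (dquad _)).
rewrite (diff_linear (@lsubmx_is_linear R k k')) (diff_linear (@rsubmx_is_linear R k k')).
by rewrite derive_quad//; case: nA.
Qed.

Lemma stabilize_dw x w : gf_dw (F := GF G) (x, w) =
  row_mx (gf_dw (F := GF F) (x, lsubmx w)) (2 *: (rsubmx w *m A)).
Proof.
apply/rowP => i; rewrite [LHS]mxE deriv_w -(splitK i).
case: (fintype.split i) => j /=.
  rewrite row_mxEl [RHS]mxE.
  have -> : delta_mx 0 (lshift k' j) = row_mx (delta_mx 0 j) 0 :> 'rV[R]_(k + k').
    apply/rowP => m; rewrite -(splitK m); case: (fintype.split m) => m' /=.
      by rewrite row_mxEl !mxE (inj_eq (@lshift_inj _ _)).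
    by rewrite row_mxEr !mxE eq_rlshift andbF.
  by rewrite row_mxKl row_mxKr trmx0 mulmx0 mxE mulr0 addr0.
rewrite row_mxEr [RHS]mxE.
have -> : delta_mx 0 (rshift k j) = row_mx 0 (delta_mx 0 j) :> 'rV[R]_(k + k').
  apply/rowP => m; rewrite -(splitK m); case: (fintype.split m) => m' /=.
    by rewrite row_mxEl !mxE eq_lrshift andbF.
  by rewrite row_mxEr !mxE (inj_eq (@rshift_inj _ _)).
by rewrite row_mxKl row_mxKr deriveE ?linear0 ?add0r ?trmx_delta -?colE ?mxE//; exact: gf_diff_w.
Qed.

Let crit x w : gf_dw (F := GF G) (x, w) = 0 <->
  gf_dw (F := GF F) (x, lsubmx w) = 0 /\ rsubmx w = 0.
Proof.
rewrite stabilize_dw row_mx_eq0; split => -[-> h]; split => //.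
  apply: (nondegenerate_ker nA) => v.
  have -> : rsubmx w *m A = 0.
    by move/(congr1 (fun M => 2^-1 *: M)): h; rewrite scalerA mulVf ?scale1r ?scaler0.
  by rewrite mul0mx mxE.
by rewrite h mul0mx scaler0.
Qed.

Lemma stabilize_contour (D : set 'rV[R]_n) : contour D (GF G) = contour D (GF F).
Proof.
apply/seteqP; split => -[[u x] y] [/= Dx [w [/= cw uE yE]]]; split => //=.
  exists (lsubmx w); move/crit: cw => [cw rw]; split => //=.
    by rewrite uE /G rw quad0 addr0.
  rewrite yE; apply/rowP => i; rewrite !mxE.
  rewrite (_ : G^~ w = (F^~ (lsubmx w)) + cst (quad A (rsubmx w)))//.
  by rewrite (derive_add_cst _ _ (gf_diff_x sF x _)).
exists (row_mx w 0); split => /=.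
- by apply/crit; rewrite row_mxKl row_mxKr.
- by rewrite /G row_mxKl row_mxKr quad0 addr0.
rewrite yE; apply/rowP => i; rewrite !mxE.
rewrite (_ : G^~ (row_mx w 0) = (F^~ w) + cst (quad A 0)); last first.
  by apply/funext => x'; rewrite /G row_mxKl row_mxKr.
by rewrite (derive_add_cst _ _ (gf_diff_x sF x _)).
Qed.

Let ddw x w a b : 'd (@gf_dw _ _ (GF G)) (x, w) (a, b) =
  row_mx ('d (@gf_dw _ _ (GF F)) (x, lsubmx w) (a, lsubmx b)) (2 *: (rsubmx b *m A)).
Proof.
pose V := ('rV[R]_n * 'rV[R]_(k + k'))%type.
pose p (z : V) := (z.1, lsubmx z.2); pose q (z : V) := 2 *: (rsubmx z.2 *m A).
have lp : linear p.
  by move=> c z1 z2; rewrite /p /=; apply/pair_equal_spec; split => //=; rewrite linearP.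
have lq : linear q.
  move=> c z1 z2; rewrite /q /= linearP mulmxDl -scalemxAl scalerDr.
  by rewrite !scalerA mulrC.
have dp z : differentiable p z.
  exact: (smooth_diff (smooth_on_linear lp setT) z).
have dq z : differentiable q z.
  exact: (smooth_diff (smooth_on_linear lq setT) z).
have df z : differentiable (@gf_dw _ _ (GF F)) z.
  exact: (smooth_diff (smooth_gf_dw sF) z).
have dfp z : differentiable (fun z => gf_dw (F := GF F) (p z)) z.
  exact: (@differentiable_comp _ _ _ _ p (@gf_dw _ _ (GF F)) z (dp z) (df _)).
rewrite (_ : @gf_dw _ _ (GF G) = fun z : V => row_mx (gf_dw (F := GF F) (p z)) (q z)); last first.
  by apply/funext => -[x' w']; rewrite stabilize_dw.
rewrite (diff_row_mx _ (dfp _) (dq _)) (diff_linear lq).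
by rewrite (@diff_compE _ _ _ _ p (@gf_dw _ _ (GF F)) _ _ (dp _) (df _)) (diff_linear lp).
Qed.

(** The derivative splits into that of [gf_dw F] and the map b |-> 2 b A, which is onto. *)
Lemma stabilize_regular (D : set 'rV[R]_n) : is_gf D (GF G) <-> is_gf D (GF F).
Proof.
split=> /regularP[_ reg]; apply/regularP; split; [exact: sF| |exact: sG|].
  move=> x w Dx cw y.
  have [|[a b] E] := reg x (row_mx w 0) Dx _ (row_mx y 0).
    by apply/crit; rewrite row_mxKl row_mxKr.
  exists (a, lsubmx b); move: E; rewrite ddw row_mxKl => /eq_row_mx[-> //].
move=> x w Dx /crit[cw rw] y.
have [[a b] E] := reg x (lsubmx w) Dx cw (lsubmx y).
exists (a, row_mx b (2^-1 *: (rsubmx y *m invmx A))).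
rewrite ddw row_mxKl row_mxKr E -scalemxAl mulmxKV; last by case: nA.
by rewrite scalerA divff ?scale1r ?hsubmxK.
Qed.

End Stabilize.

(** * Invariants of the equivalence *)

Section Invariance.
Context {R : realType}.
Implicit Types (n : nat).

Lemma rst_ind_equiv T (r P : T -> T -> Prop) :
  (forall x, P x x) -> (forall x y, P x y -> P y x) ->
  (forall x y z, P x y -> P y z -> P x z) ->
  (forall x y, r x y -> P x y) ->
  forall x y, clos_refl_sym_trans _ r x y -> P x y.
Proof.
move=> h1 h2 h3 h4 x y; elim=> {x y} [a b ab|a|a b _ ab|a b c _ ab _ bc].
- exact: h4.
- exact: h1.
- exact: h2.
- exact: h3 ab bc.
Qed.

(** An equivalence relation that contains the elementary steps contains [gf_sim], by passing through
    the common ancestor. *)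
Lemma gf_equiv_ind n (D : set 'rV[R]_n) (P : gf R n -> gf R n -> Prop) :
  (forall x, P x x) -> (forall x y, P x y -> P y x) ->
  (forall x y z, P x y -> P y z -> P x z) ->
  (forall x y, gf_step D x y -> P x y) ->
  forall x y, gf_equiv D x y -> P x y.
Proof.
move=> h1 h2 h3 h4; apply: rst_ind_equiv => // x y [F0 [a b]].
have H u v : clos_refl_trans _ (gf_step D) u v -> P u v.
  elim=> {u v} [s t st|s|s t w _ st _ tw]; [exact: h4|exact: h1|].
  exact: h3 st tw.
by apply: (h3 _ F0); [exact/h2/H|exact: H].
Qed.

Lemma gf_equiv_refl n (D : set 'rV[R]_n) F : gf_equiv D F F.
Proof. exact: rst_refl. Qed.
Lemma gf_equiv_sym n (D : set 'rV[R]_n) F G : gf_equiv D F G -> gf_equiv D G F.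
Proof. exact: rst_sym. Qed.
Lemma gf_equiv_trans n (D : set 'rV[R]_n) F G H :
  gf_equiv D F G -> gf_equiv D G H -> gf_equiv D F H.
Proof. exact: rst_trans. Qed.
Lemma gf_equiv_step n (D : set 'rV[R]_n) F G : gf_step D F G -> gf_equiv D F G.
Proof.
move=> s; apply: rst_step; exists F; split; first exact: rt_refl.
exact: rt_step.
Qed.

Lemma gf_equiv_morph n m (D : set 'rV[R]_n) (D' : set 'rV[R]_m) (op : gf R n -> gf R m) :
  (forall F G, gf_step D F G -> gf_equiv D' (op F) (op G)) ->
  forall F G, gf_equiv D F G -> gf_equiv D' (op F) (op G).
Proof.
move=> h; apply: (gf_equiv_ind (P := fun F G => gf_equiv D' (op F) (op G))) => //.
- by move=> x; exact: gf_equiv_refl.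
- by move=> x y; exact: gf_equiv_sym.
- by move=> x y z; exact: gf_equiv_trans.
Qed.

Lemma gf_equiv_smooth n (D : set 'rV[R]_n) F G : gf_equiv D F G ->
  (smooth_family F <-> smooth_family G).
Proof.
apply: (gf_equiv_ind (P := fun F G : gf R n => smooth_family F <-> smooth_family G)).
- by [].
- by move=> x y [h1 h2].
- by move=> x y z [h1 h2] [h3 h4]; split => h; [exact/h3/h1|exact/h2/h4].
- by move=> x y []; split.
Qed.

(** Over the whole base the defining equations of a step are equalities of functions. A fibrewise
    diffeomorphism is handled in one direction only: F is in turn the pullback of G by psi, which
    gives the converse. *)
Lemma gf_step_invariant n (F G : gf R n) : gf_step setT F G ->
  contour setT F = contour setT G /\ (is_gf setT F <-> is_gf setT G).
Proof.
case=> [k k' F' A G' sF sG nA GE|k F' G' phi psi sF sG sphi spsi can GE].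
  have -> : G' = fun x w => F' x (lsubmx w) + quad A (rsubmx w).
    by apply/funext => x; apply/funext => w; exact: GE.
  by split; [rewrite stabilize_contour|rewrite stabilize_regular].
have can1 x : cancel (phi x) (psi x) by case: (can x I).
have can2 x : cancel (psi x) (phi x) by case: (can x I).
have GE' : G' = fun x w => F' x (phi x w).
  by apply/funext => x; apply/funext => w; exact: GE.
have FE' : F' = fun x w => G' x (psi x w).
  by apply/funext => x; apply/funext => w; rewrite GE' can2.
have c1 x w : gf_dw (F := GF F') (x, phi x w) = 0 -> gf_dw (F := GF G') (x, w) = 0.
  by rewrite [in X in _ -> X]GE'; exact: fiberwise_crit.
have c2 x w : gf_dw (F := GF G') (x, w) = 0 -> gf_dw (F := GF F') (x, phi x w) = 0.
  have := @fiberwise_crit R n k G' psi sG spsi x (phi x w).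
  by rewrite can1 -FE'.
have c3 x w : gf_dw (F := GF F') (x, w) = 0 -> gf_dw (F := GF G') (x, psi x w) = 0.
  by have := c1 x (psi x w); rewrite can2.
split.
  apply/seteqP; split.
    rewrite [X in _ `<=` contour _ (GF X)]GE'; exact: fiberwise_contour can2 _.
  rewrite [X in _ `<=` contour _ (GF X)]FE'; exact: fiberwise_contour can1 _.
split.
  rewrite [X in _ -> is_gf _ (GF X)]GE'.
  apply: (fiberwise_regular sF sphi spsi can1 can2) => x w _.
  by rewrite -GE'; exact: c2.
rewrite [X in _ -> is_gf _ (GF X)]FE'.
apply: (fiberwise_regular sG spsi sphi can2 can1) => x w _.
by rewrite -FE'; exact: c3.
Qed.

Lemma gf_equiv_invariant n (F G : gf R n) : gf_equiv setT F G ->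
  contour setT F = contour setT G /\ (is_gf setT F <-> is_gf setT G).
Proof.
apply: (gf_equiv_ind (P := fun F G : gf R n =>
  contour setT F = contour setT G /\ (is_gf setT F <-> is_gf setT G))).
- by [].
- by move=> x y [-> [h1 h2]].
- by move=> x y z [-> [h1 h2]] [-> [h3 h4]]; split => //; split => h; [exact/h3/h1|exact/h2/h4].
- exact: gf_step_invariant.
Qed.

End Invariance.

(** * Operations that respect equivalence *)

Section Congruence.
Context {R : realType}.
Implicit Types (n m k : nat).

Definition gf_pull n m (h : 'rV[R]_m -> 'rV[R]_n) (F : gf R n) : gf R m :=
  GF (fun x => F (h x)).

Lemma gf_pull_smooth n m k (h : 'rV[R]_m -> 'rV[R]_n) (V : normedModType R)
    (F : 'rV[R]_n -> 'rV[R]_k -> V) :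
  smooth_on setT h -> smooth_family F -> smooth_family (fun x => F (h x)).
Proof.
move=> sh /smooth_onT sF; apply/smooth_onT.
apply: (smooth_on_compT (f := fun z : 'rV[R]_m * 'rV[R]_k => (h z.1, z.2))
  (g := fun z => F z.1 z.2) _ openT); last exact: sF.
apply: (smooth_on_pair openT); last exact: smooth_on_snd.
apply: (smooth_comp (g := h) _); last exact: sh.
exact: smooth_on_fst.
Qed.

(** Slices, translations and the mirror are all pullbacks along maps of the base, so this makes each
    of them well defined on classes. *)
Lemma gf_pull_equiv n m (D : set 'rV[R]_n) (D' : set 'rV[R]_m) h :
  smooth_on setT h -> (forall x, D' x -> D (h x)) ->
  forall F G, gf_equiv D F G -> gf_equiv D' (gf_pull h F) (gf_pull h G).
Proof.
move=> sh hD; apply: gf_equiv_morph => F G s; apply: gf_equiv_step.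
case: s => [k k' F' A G' sF sG nA GE|k F' G' phi psi sF sG sphi spsi can GE].
  apply: Stabilization nA _ => //; [exact: gf_pull_smooth sF|exact: gf_pull_smooth sG|].
  by move=> x w /hD; exact: GE.
apply: (@FiberwiseDiffeo _ _ _ k (fun x => F' (h x)) (fun x => G' (h x))
  (fun x => phi (h x)) (fun x => psi (h x))).
- exact: gf_pull_smooth sF.
- exact: gf_pull_smooth sG.
- exact: gf_pull_smooth sphi.
- exact: gf_pull_smooth spsi.
- by move=> x /hD; exact: can.
- by move=> x w /hD; exact: GE.
Qed.

Lemma gf_stab_equiv n (D : set 'rV[R]_n) k k' (F : 'rV[R]_n -> 'rV[R]_k -> R)
    (A : 'M[R]_k') : smooth_family F -> nondegenerate_mx A ->
  gf_equiv D (GF F)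
    (GF (fun x (w : 'rV[R]_(k + k')) => F x (lsubmx w) + quad A (rsubmx w))).
Proof.
move=> sF nA; apply: gf_equiv_step; apply: Stabilization nA _ => //.
exact: stabilize_smooth.
Qed.

(** The fibre dimensions only have to be provably equal, as with [k + k'] and [k' + k]; permuting
    blocks of coordinates then involves no casts. *)
Lemma gf_reindex_equiv n (D : set 'rV[R]_n) k k' (F : 'rV[R]_n -> 'rV[R]_k -> R)
    (G : 'rV[R]_n -> 'rV[R]_k' -> R) (P : 'rV[R]_k' -> 'rV[R]_k) P' :
  k = k' -> smooth_family F -> smooth_on setT P -> smooth_on setT P' ->
  cancel P P' -> cancel P' P -> (forall x w, G x w = F x (P w)) ->
  gf_equiv D (GF F) (GF G).
Proof.
move=> e; case: _ / e G P P' => G P P' sF sP sP' c1 c2 GE.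
have sc (Q : 'rV[R]_k -> 'rV[R]_k) : smooth_on setT Q ->
    smooth_family (fun (_ : 'rV[R]_n) => Q).
  move=> sQ; apply/smooth_onT; apply: (smooth_comp (g := Q) _) => //.
  exact: smooth_on_snd.
apply: gf_equiv_step.
apply: (FiberwiseDiffeo (phi := fun=> P) (psi := fun=> P')) => //; [|exact: sc|exact: sc].
rewrite (_ : G = fun x w => F x (P w)).
  apply: (@fiberwise_smooth _ _ _ F (fun=> P)) => //; exact: sc.
by apply/funext => x; apply/funext => w; exact: GE.
Qed.

Lemma gf_sum_smooth n (F G : gf R n) : smooth_family F -> smooth_family G ->
  smooth_family (fun x (w : 'rV[R]_(gf_dim F + gf_dim G)) =>
    F x (lsubmx w) + G x (rsubmx w)).
Proof.
move=> sF sG; apply/smooth_onT; apply: (smooth_onD openT); apply/smooth_onT.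
  by apply: (smooth_family_comp sF); exact: smooth_lsubmx.
by apply: (smooth_family_comp sG); exact: smooth_rsubmx.
Qed.

Local Ltac smooth_rows := repeat first
  [ apply: (smooth_on_row_mx openT) | apply: (smooth_on_lsubmx openT)
  | apply: (smooth_on_rsubmx openT) | exact: smooth_on_id ].

Lemma gf_sum_comm (F G : gf R 1) : smooth_family F -> smooth_family G ->
  gf_equiv setT (gf_sum F G) (gf_sum G F).
Proof.
move=> sF sG.
apply: (@gf_reindex_equiv _ _ _ _ _ _ (fun w => row_mx (rsubmx w) (lsubmx w))
  (fun w => row_mx (rsubmx w) (lsubmx w))); first exact: addnC.
- exact: gf_sum_smooth.
- by smooth_rows.
- by smooth_rows.
- by move=> w; rewrite row_mxKl row_mxKr hsubmxK.
- by move=> w; rewrite row_mxKl row_mxKr hsubmxK.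
- by move=> x w; rewrite row_mxKl row_mxKr addrC.
Qed.

Lemma gf_sum_equivl (F F' G : gf R 1) : smooth_family G ->
  gf_equiv setT F F' -> gf_equiv setT (gf_sum F G) (gf_sum F' G).
Proof.
move=> sG; apply: (@gf_equiv_morph _ _ _ _ _ (fun F => gf_sum F G)) => {F F'} F F'.
case=> [k k' F1 A G1 sF1 sG1 nA GE|k F1 G1 phi psi sF1 sG1 sphi spsi can GE].
  have -> : G1 = fun x w => F1 x (lsubmx w) + quad A (rsubmx w).
    by apply/funext => x; apply/funext => w; exact: GE.
  have sS := gf_sum_smooth (F := GF F1) sF1 sG.
  apply: gf_equiv_trans (gf_stab_equiv setT sS nA) _.
  (* The permutation moves the coordinates of the added quadratic form from the last block to the
     middle one. *)
  apply: (@gf_reindex_equiv _ _ _ _ _ _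
    (fun w => row_mx (row_mx (lsubmx (lsubmx w)) (rsubmx w)) (rsubmx (lsubmx w)))
    (fun w => row_mx (row_mx (lsubmx (lsubmx w)) (rsubmx w)) (rsubmx (lsubmx w)))).
  - by rewrite /= addnAC.
  - exact: (stabilize_smooth A sS).
  - by smooth_rows.
  - by smooth_rows.
  - by move=> w; rewrite !row_mxKl !row_mxKr !hsubmxK.
  - by move=> w; rewrite !row_mxKl !row_mxKr !hsubmxK.
  - by move=> x w; rewrite /= !row_mxKl !row_mxKr addrAC.
have can1 x : cancel (phi x) (psi x) by case: (can x I).
have can2 x : cancel (psi x) (phi x) by case: (can x I).
have sext (q : 'rV[R]_1 -> 'rV[R]_k -> 'rV[R]_k) : smooth_family q ->
    smooth_family (fun x (w : 'rV[R]_(k + gf_dim G)) => row_mx (q x (lsubmx w)) (rsubmx w)).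
  move=> sq; apply/smooth_onT; apply: (smooth_on_row_mx openT); last first.
    by apply: (smooth_on_rsubmx openT); exact: smooth_on_snd.
  by apply/smooth_onT; apply: (smooth_family_comp sq); exact: smooth_lsubmx.
apply: gf_equiv_step.
apply: (FiberwiseDiffeo (phi := fun x w => row_mx (phi x (lsubmx w)) (rsubmx w))
  (psi := fun x w => row_mx (psi x (lsubmx w)) (rsubmx w))).
- exact: (gf_sum_smooth (F := GF F1)).
- exact: (gf_sum_smooth (F := GF G1)).
- exact: sext.
- exact: sext.
- by move=> x _; split => w; rewrite row_mxKl row_mxKr ?can1 ?can2 hsubmxK.
- by move=> x w _; rewrite row_mxKl row_mxKr /= GE.
Qed.

Lemma gf_sum_equiv (F F' G G' : gf R 1) : smooth_family F -> smooth_family G ->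
  gf_equiv setT F F' -> gf_equiv setT G G' ->
  gf_equiv setT (gf_sum F G) (gf_sum F' G').
Proof.
move=> sF sG FF GG; have sF' := (gf_equiv_smooth FF).1 sF.
have sG' := (gf_equiv_smooth GG).1 sG.
apply: gf_equiv_trans (gf_sum_equivl sG FF) _.
apply: gf_equiv_trans (gf_sum_comm sF' sG) _.
apply: gf_equiv_trans (gf_sum_equivl sF' GG) _.
exact: gf_sum_comm.
Qed.

(** Each non-degenerate form is a stabilization of the zero function on a 0-dimensional fibre. *)
Lemma gf_quad_equiv n (D : set 'rV[R]_n) k k' (A : 'M[R]_k) (B : 'M[R]_k') :
  nondegenerate_mx A -> nondegenerate_mx B ->
  gf_equiv D (GF (fun _ w => quad A w)) (GF (fun _ w => quad B w)).
Proof.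
pose Z := @GF R n 0 (fun _ _ => 0).
suff H m (C : 'M[R]_m) : nondegenerate_mx C -> gf_equiv D Z (GF (fun _ w => quad C w)).
  by move=> /H h1 /H h2; apply: gf_equiv_trans h2; exact: gf_equiv_sym.
move=> nC; have sZ : smooth_family Z by apply/smooth_onT; exact: smooth_on_cst.
have := gf_stab_equiv D sZ nC.
have -> // : (fun (x : 'rV[R]_n) (w : 'rV[R]_(0 + m)) =>
    (fun _ _ => 0) x (lsubmx w : 'rV[R]_0) + quad C (rsubmx w)) = (fun _ w => quad C w).
apply/funext => x; apply/funext => w; rewrite add0r; congr quad.
by apply/rowP => j; rewrite mxE; congr (w _ _); exact: val_inj.
Qed.

Lemma gf_class_eq n (D : set 'rV[R]_n) F G : gf_equiv D F G -> gf_class D F = gf_class D G.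
Proof.
move=> FG; apply/seteqP; split => H /=; last exact: gf_equiv_trans.
by apply: gf_equiv_trans; exact: gf_equiv_sym.
Qed.

Lemma class_map_class n m (D : set 'rV[R]_n) (D' : set 'rV[R]_m) op F :
  (forall G, gf_equiv D F G -> gf_equiv D' (op F) (op G)) ->
  class_map D' op (gf_class D F) = gf_class D' (op F).
Proof.
move=> h; apply/seteqP; split => G /=.
  by move=> [F' /h FF' F'G]; exact: gf_equiv_trans FF' F'G.
by move=> FG; exists F => //; exact: gf_equiv_refl.
Qed.

Lemma class_map2_class n m (D : set 'rV[R]_n) (D' : set 'rV[R]_m) op F F' :
  (forall G G', gf_equiv D F G -> gf_equiv D F' G' -> gf_equiv D' (op F F') (op G G')) ->
  class_map2 D' op (gf_class D F) (gf_class D F') = gf_class D' (op F F').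
Proof.
move=> h; apply/seteqP; split => G /=.
  by move=> [G1 [G2 [h1 h2 h3]]]; exact: gf_equiv_trans (h _ _ h1 h2) h3.
by move=> FG; exists F, F'; split => //; exact: gf_equiv_refl.
Qed.

End Congruence.

(** * Pulling a knot back along a function *)

Section Chi.
Context {R : realType}.

(* A smooth even function with chi q = |q| for 1 <= |q|. *)
Definition chi (q : R) : R := q * (2 * sstep ((q + 1) / 2) - 1).
Definition dchi : R -> R := 'D_1 chi.

Lemma chi_smooth : smooth_on setT chi.
Proof.
rewrite /chi; smooth_arith.
apply: (smooth_comp _ _ (@smooth_sstep R)); smooth_arith.
Qed.

Lemma dchi_smooth : smooth_on setT dchi.
Proof. exact: smooth_on_D chi_smooth. Qed.

Lemma chi_ge1 q : 1 <= q -> chi q = q.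
Proof. by move=> h; rewrite /chi sstep1; [ring|rewrite ler_pdivlMr; lra]. Qed.

Lemma chi_leN1 q : q <= -1 -> chi q = - q.
Proof. by move=> h; rewrite /chi sstep0; [ring|rewrite ler_pdivrMr; lra]. Qed.

Lemma chi_norm q : 1 <= `|q| -> chi q = `|q|.
Proof.
have [h|h] := leP 0 q; first by rewrite ger0_norm//; exact: chi_ge1.
by rewrite ltr0_norm// => h1; rewrite chi_leN1//; lra.
Qed.

Lemma chi_abs q : `|chi q| <= `|q|.
Proof.
rewrite /chi normrM ler_piMr// ler_norml.
have := sstep_ge0 ((q + 1) / 2); have := sstep_le1 ((q + 1) / 2) => h1 h2.
by apply/andP; split; lra.
Qed.

Lemma chi_small q : `|q| <= 1 -> -1 <= chi q <= 1.
Proof. by move=> h; rewrite -ler_norml; apply: le_trans (chi_abs q) h. Qed.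

Lemma chi_geN1 q : -1 <= chi q.
Proof.
have [h|h] := leP `|q| 1; first by case/andP: (chi_small h).
by rewrite chi_norm ?ltW//; have := normr_ge0 q; lra.
Qed.

Lemma chi_lt a q : 1 < a -> (chi q < a) = (`|q| < a).
Proof.
move=> a1; have [h|h] := leP `|q| 1; last by rewrite chi_norm// ltW.
have /andP[_ h1] := chi_small h.
by rewrite (le_lt_trans h1 a1) (le_lt_trans h a1).
Qed.

Lemma chi_le a q : 1 < a -> (chi q <= a) = (`|q| <= a).
Proof.
move=> a1; have [h|h] := leP `|q| 1; last by rewrite chi_norm// ltW.
have /andP[_ h1] := chi_small h.
by rewrite (le_trans h1 (ltW a1)) (le_trans h (ltW a1)).
Qed.

Lemma dchi_gt1 q : 1 < q -> dchi q = 1.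
Proof.
move=> h; rewrite /dchi (@near_eq_derive _ _ _ _ id).
  by rewrite derive_id.
by near=> y; rewrite chi_ge1//; apply: ltW; near: y; exact: lt_nbhsr.
Unshelve. all: by end_near. Qed.

Lemma dchi_ltN1 q : q < -1 -> dchi q = -1.
Proof.
move=> h; rewrite /dchi (@near_eq_derive _ _ _ _ -%R).
  by have [_ ->] := is_deriveNid q (1:R).
by near=> y; rewrite chi_leN1//; apply: ltW; near: y; exact: lt_nbhsl.
Unshelve. all: by end_near. Qed.

Lemma dchi_sqr q : 1 < `|q| -> dchi q * dchi q = 1.
Proof.
have [h|h] := leP 0 q; first by rewrite ger0_norm// => /dchi_gt1 ->; rewrite mulr1.
by rewrite ltr0_norm// => h1; rewrite dchi_ltN1; [ring|lra].
Qed.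

End Chi.

Section PullbackLine.
Context {R : realType}.
Variables (m k : nat) (F : 'rV[R]_1 -> 'rV[R]_k -> R) (h : 'rV[R]_m -> R).
Hypotheses (sF : smooth_family F) (sh : smooth_on setT h).
Let H (x : 'rV[R]_m) : 'rV[R]_1 := const_mx (h x).

Lemma smooth_pull_line : smooth_on setT H.
Proof. exact: (smooth_on_const_mx _ openT sh). Qed.

Let dh x : differentiable h x.
Proof. exact: (smooth_diff sh x). Qed.
Let dH x : differentiable H x.
Proof. exact: (smooth_diff smooth_pull_line x). Qed.

Let dHE x a : 'd H x a = const_mx ('d h x a).
Proof.
apply/rowP => i; rewrite (diff_coordE _ _ (dH x)) mxE.
by rewrite (_ : (fun x => H x 0 i) = h)//; apply/funext => y; rewrite mxE.
Qed.

(** The fibre critical points over x are those of F over h x, and by the chain rule the base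
    derivative there is that of F times grad h. *)
Lemma pull_line_contour (D : set 'rV[R]_m) :
  contour D (gf_pull H (GF F)) = [set z | D z.1.2 /\
    exists p, contour setT (GF F) (jpt z.1.1 (h z.1.2) p) /\ z.2 = p *: grad h z.1.2].
Proof.
have E w x : grad (fun x => F (H x) w) x = (grad (F^~ w) (H x) 0 0) *: grad h x.
  apply/rowP => i; rewrite !mxE.
  have dF : differentiable (F^~ w) (H x) by exact: gf_diff_x.
  have dFH : differentiable (fun x => F (H x) w) x.
    exact: (@differentiable_comp _ _ _ _ H (F^~ w) x (dH x) dF).
  rewrite (deriveE _ dFH) (@diff_compE _ _ _ _ H (F^~ w) x _ (dH x) dF) dHE.
  rewrite -(deriveE _ dF) (gradE _ dF) big_ord1 mxE [grad _ _ _ _]mxE mulrC.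
  by rewrite -(deriveE _ (dh x)).
apply/seteqP; split => -[[u x] y] [/= Dx].
  move=> [w [/= cw uE yE]]; split => //; exists (grad (F^~ w) (H x) 0 0).
  split; last by rewrite yE -E.
  split => //=; exists w; split => //=.
  by apply/rowP => i; rewrite ord1 mxE.
move=> [p [[/= _ [w [/= cw uE yE]]] yE']]; split => //=; exists w; split => //=.
by rewrite yE' E -yE mxE.
Qed.

(** Where dh is nonzero, tangent vectors of the line lift and regularity of F is inherited. The
    alternative is for points where chi is not a submersion: there the pullback is locally a fixed
    non-degenerate form. *)
Lemma pull_line_regular (D : set 'rV[R]_m) (A : 'M[R]_k) : nondegenerate_mx A ->
  is_gf setT (GF F) ->
  (forall x, D x -> (exists a, 'd h x a = 1) \/
     (\forall y \near x, forall w, F (H y) w = quad A w)) ->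
  is_gf D (gf_pull H (GF F)).
Proof.
move=> nA /regularP[_ reg] hD; apply/regularP.
have sP : smooth_family (fun x => F (H x)).
  exact: gf_pull_smooth smooth_pull_line sF.
split => // x w Dx cw y.
have [[a ha]|triv] := hD x Dx.
  have [[v1 v2] E] := reg (H x) w I cw y.
  pose V := ('rV[R]_m * 'rV[R]_k)%type; pose P (z : V) := (H z.1, z.2).
  have dP1 (z : V) : differentiable (fun z : V => H z.1) z.
    have d1 : differentiable (fun z : V => z.1) z.
      exact: (smooth_diff (@smooth_on_fst _ _ _ setT) z).
    exact: (@differentiable_comp _ _ _ _ (fun z : V => z.1) H z d1 (dH _)).
  have dP2 (z : V) : differentiable (fun z : V => z.2) z.
    exact: (smooth_diff (@smooth_on_snd _ _ _ setT) z).
  have dP (z : V) : differentiable P z by exact: differentiable_pair.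
  have dF1 z : differentiable (@gf_dw _ _ (GF F)) z.
    exact: (smooth_diff (smooth_gf_dw sF) z).
  exists (v1 0 0 *: a, v2).
  change ('d (fun z : V => gf_dw (F := GF F) (P z)) (x, w) (v1 0 0 *: a, v2) = y).
  rewrite (@diff_compE _ _ _ _ P (@gf_dw _ _ (GF F)) _ _ (dP _) (dF1 _)) -E.
  congr ('d _ _ _); rewrite (diff_pairE _ (dP1 _) (dP2 _)).
  have d1 (z : V) : differentiable (fun z : V => z.1) z.
    exact: (smooth_diff (@smooth_on_fst _ _ _ setT) z).
  rewrite (@diff_compE _ _ _ _ (fun z : V => z.1) H _ _ (d1 _) (dH _)).
  rewrite (@diff_linear _ _ _ _ (fun z : V => z.1)) => [|c z1 z2//].
  rewrite (@diff_linear _ _ _ _ (fun z : V => z.2)) => [|c z1 z2//].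
  by rewrite /= dHE linearZ /= ha [_ *: _]mulr1 -rV1E.
pose V := ('rV[R]_m * 'rV[R]_k)%type; pose q (z : V) := 2 *: (z.2 *m A).
have lq : linear q.
  move=> c z1 z2; rewrite /q /= mulmxDl -scalemxAl scalerDr.
  by rewrite !scalerA mulrC.
exists (0, 2^-1 *: (y *m invmx A)).
have near_q : \forall z \near ((x, w) : V), q z = gf_dw (F := gf_pull H (GF F)) z.
  have h1 : \forall z \near ((x, w) : V), forall w, F (H z.1) w = quad A w.
    by apply: (@cvg_fst _ _ (nbhs x) (nbhs w) _) triv.
  apply: filterS h1 => -[x' w'] /= e.
  apply/rowP => i; rewrite !mxE /= (_ : F (H x') = quad A); last exact/funext.
  rewrite derive_quad; last by case: nA.
  by congr (2 * _); rewrite trmx_delta -colE !mxE.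
have dq : differentiable q (x, w).
  exact: (smooth_diff (smooth_on_linear lq setT) (x, w)).
have dG : differentiable (@gf_dw _ _ (gf_pull H (GF F))) (x, w).
  exact: (smooth_diff (smooth_gf_dw sP) (x, w)).
rewrite -(deriveE _ dG) -(near_eq_derive _ near_q) (deriveE _ dq) (diff_linear lq).
rewrite /q /= -scalemxAl mulmxKV; last by case: nA.
by rewrite scalerA divff ?scale1r.
Qed.

End PullbackLine.

(** * Knots generated by f + Q *)

Section KnotData.
Context {R : realType}.

Definition fq n k (f : 'rV[R]_n -> 'rV[R]_k -> R) (A : 'M[R]_k) x w := f x w + quad A w.

Lemma smooth_fq n k (f : 'rV[R]_n -> 'rV[R]_k -> R) (A : 'M[R]_k) :
  smooth_family f -> smooth_family (fq f A).
Proof.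
move=> /smooth_onT sf; apply/smooth_onT; apply: (smooth_onD openT); first exact: sf.
apply: (smooth_comp (g := quad A) _); last exact: smooth_quad.
exact: smooth_on_snd.
Qed.

Lemma grad_quad0 k (A : 'M[R]_k) w : nondegenerate_mx A -> grad (quad A) w = 0 <-> w = 0.
Proof.
move=> nA; have [sA _] := nA.
have d : differentiable (quad A) w by exact: (smooth_diff (smooth_quad A) w).
split => [/(grad0P d) h|->].
  apply: (nondegenerate_ker nA) => v; have := h v; rewrite derive_quad// => /eqP.
  by rewrite mulf_eq0 pnatr_eq0 /= => /eqP.
by apply/rowP => i; rewrite !mxE derive_quad// !mul0mx mxE mulr0.
Qed.

(** Near such a base point the generating function is Q for all parameters, with the single critical
    point 0 and no dependence on x. *)
Lemma contour_trivial k (f : 'rV[R]_1 -> 'rV[R]_k -> R) (A : 'M[R]_k) (M : R) (z : J1 R 1) :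
  nondegenerate_mx A -> (forall (x : 'rV[R]_1) w, M < `|x 0 0| -> f x w = 0) ->
  M < `|qcoord z| -> (contour setT (GF (fq f A)) z <-> zero_section z).
Proof.
move=> nA hf; case: z => -[u x] y; rewrite /qcoord /= => Mx.
have E (y' : 'rV[R]_1) w : M < `|y' 0 0| -> fq f A y' w = quad A w by move=> h; rewrite /fq hf// add0r.
have Ex : fq f A x = quad A by apply/funext => w; exact: E.
have n0 : {near x, forall y' : 'rV[R]_1, M < `|y' 0 0|}.
  have c : {for x, continuous (fun y' : 'rV[R]_1 => `|y' 0 0|)}.
    apply: continuous_comp; last exact: norm_continuous.
    exact: coord_continuous.
  by apply: (c [set t | M < t]); exact: lt_nbhsr.
have gx w : grad ((fq f A)^~ w) x = 0.
  apply/rowP => i; rewrite !mxE (@near_eq_derive _ _ _ _ (cst (quad A w))).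
    exact: derive_cst.
  by apply: filterS n0 => y' hy'; rewrite /= E.
split => [[_ [w [cw uE yE]]]|[/= u0 y0]].
  have {}cw : grad (fq f A x) w = 0 by exact: cw.
  have {}uE : u = fq f A x w by exact: uE.
  have {}yE : y = grad ((fq f A)^~ w) x by exact: yE.
  move: cw uE; rewrite Ex => /(grad_quad0 _ nA) ->; rewrite quad0 => uE.
  by split => //=; rewrite yE gx.
split => //; exists 0; split.
- change (grad (fq f A x) 0 = 0); rewrite Ex; exact/(grad_quad0 _ nA).
- by change (u = fq f A x 0); rewrite Ex quad0.
- by change (y = grad ((fq f A)^~ 0) x); rewrite gx.
Qed.

(* (u, x, p) parametrizes the knot generated by f + quad A, with left inverse
   delta; over M <= |q| it is the zero section. *)
Record knot_data k (f : 'rV[R]_1 -> 'rV[R]_k -> R) (A : 'M[R]_k) (M : R)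
    (u x p : R -> R) (delta : J1 R 1 -> R) : Prop := KnotData {
  kd_sf : smooth_family f;
  kd_A : nondegenerate_mx A;
  kd_M : 0 <= M;
  kd_fw : exists B : R, forall x (w : 'rV[R]_k), B < `|w| -> f x w = 0;
  kd_fx : forall (x : 'rV[R]_1) w, M < `|x 0 0| -> f x w = 0;
  kd_reg : is_gf setT (GF (fq f A));
  kd_su : smooth_on setT u;
  kd_sx : smooth_on setT x;
  kd_sp : smooth_on setT p;
  kd_sdelta : smooth_on setT delta;
  kd_in : forall s, contour setT (GF (fq f A)) (jpt (u s) (x s) (p s));
  kd_delta : forall s, delta (jpt (u s) (x s) (p s)) = s;
  kd_surj : forall u0 q p0, contour setT (GF (fq f A)) (jpt u0 q p0) ->
    exists s, [/\ u s = u0, x s = q & p s = p0];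
  kd_end : forall s, M <= `|s| -> [/\ u s = 0, x s = s & p s = 0];
  kd_triv : forall u0 q p0, M <= `|q| ->
    (contour setT (GF (fq f A)) (jpt u0 q p0) <-> u0 = 0 /\ p0 = 0);
  kd_der : forall s, is_derive s (1:R) u (p s * 'D_1 x s) }.

Definition fq_knot k (f : 'rV[R]_1 -> 'rV[R]_k -> R) (A : 'M[R]_k) : equipped R 1 :=
  (contour setT (GF (fq f A)), gf_class setT (GF (fq f A))).

(** One bound on the compact set K confines the support of f in both factors, since the norm of a
    product is the maximum. *)
Lemma knot_data_exists (X : equipped R 1) : gfqi_equipped_knot X ->
  exists k (f : 'rV[R]_1 -> 'rV[R]_k -> R) A M u x p delta,
    knot_data f A M u x p delta /\ X = fq_knot f A.
Proof.
case: X => L C [/= leg con [F [[regF [k [f [A [K [sf cK fK nA FF]]]]]] cL ->]]].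
have [cF rF] := gf_equiv_invariant FF.
have [B0 hB] : exists B : R, forall z : 'rV[R]_1 * 'rV[R]_k, K z -> `|z| <= B.
  have [B [_ hB]] := compact_bounded cK.
  by exists (B + 1) => z Kz; apply: (hB (B + 1)) => //; lra.
have hx (x : 'rV[R]_1) w : B0 < `|x 0 0| -> f x w = 0.
  move=> h; apply: fK => // /hB; rewrite leNgt; apply/negP; rewrite negbK.
  apply: lt_le_trans h _; rewrite (_ : `|(x, w)| = Num.max `|x| `|w|)//.
  rewrite le_max; apply/orP; left.
  by rewrite {1}(rV1E x) mxE [leRHS]mx_normrE; apply: (le_bigmax _ _ (ord0, ord0)).
have hw (x : 'rV[R]_1) w : B0 < `|w| -> f x w = 0.
  move=> h; apply: fK => // /hB; rewrite leNgt; apply/negP; rewrite negbK.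
  apply: lt_le_trans h _; rewrite (_ : `|(x, w)| = Num.max `|x| `|w|)//.
  by rewrite le_max lexx orbT.
have cE : contour setT (GF (fq f A)) = L by rewrite -cL cF.
have ends z : B0 < `|qcoord z| -> (L z <-> zero_section z).
  by move=> h; rewrite -cE; exact: contour_trivial hx h.
have [u [x [p [delta [M [[su sx sp sd] [inL can sur] [BM He Ht] der]]]]]] :=
  knot_param leg con ends.
exists k, f, A, (`|M|), u, x, p, delta; split; last first.
  by rewrite /fq_knot cE; congr pair; exact: gf_class_eq.
have hM := ler_norm M.
split => //.
- by exists B0.
- by move=> y w h; apply: hx; lra.
- by apply/rF.
- by move=> s; rewrite cE.
- by move=> u0 q p0; rewrite cE; exact: sur.
- by move=> s h; apply: He; lra.
- by move=> u0 q p0 h; rewrite cE; apply: Ht; lra.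
Qed.

Section Mirror.
Variables (k : nat) (f : 'rV[R]_1 -> 'rV[R]_k -> R) (A : 'M[R]_k) (M : R).
Variables (u x p : R -> R) (delta : J1 R 1 -> R).
Hypothesis K : knot_data f A M u x p delta.

(** Negation in the form [const_mx (h y)] expected by the lemmas on pullbacks to the line. *)
Let neg (y : 'rV[R]_1) : 'rV[R]_1 := const_mx (- y 0 0).
Let negE y : neg y = - y.
Proof. by apply/rowP => i; rewrite !mxE ord1. Qed.
Let sneg : smooth_on setT (fun x : 'rV[R]_1 => - x 0 0).
Proof. smooth_arith. Qed.
Let mirE : GF (fq (fun x => f (- x)) A) = gf_pull neg (GF (fq f A)).
Proof. by congr GF; apply/funext => y; apply/funext => w; rewrite negE. Qed.

Let lneg : linear (fun x : 'rV[R]_1 => - x 0 0 : R).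
Proof. by move=> a v w; rewrite !mxE opprD -mulrN. Qed.
Let gneg y : grad (fun x : 'rV[R]_1 => - x 0 0) y = const_mx (-1).
Proof.
apply/rowP => i; rewrite !mxE deriveE.
  by rewrite (diff_linear lneg) !mxE ord1 eqxx.
exact: (smooth_diff sneg y).
Qed.

Lemma mirror_contour u0 q p0 : contour setT (GF (fq (fun x => f (- x)) A)) (jpt u0 q p0) <->
  contour setT (GF (fq f A)) (jpt u0 (- q) (- p0)).
Proof.
rewrite mirE (pull_line_contour (smooth_fq A (kd_sf K)) sneg) /= mxE gneg.
split => [[_ [p1 [h /rowP/(_ 0)]]]|h].
  by rewrite !mxE mulrN1 => ->; rewrite opprK.
by split => //; exists (- p0); split => //; apply/rowP => i; rewrite !mxE; ring.
Qed.

Lemma mirror_fq_knot : mirror (fq_knot f A) = fq_knot (fun x => f (- x)) A.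
Proof.
rewrite /mirror /fq_knot /=; congr pair.
  apply/seteqP; split => [_ [[[u0 q] p0] /= h <-]|z].
    rewrite (jptE (_, _, _)) /=; apply/mirror_contour.
    by rewrite !mxE !opprK -(jptE (u0, q, p0)).
  rewrite (jptE z) => /mirror_contour h; exists (jpt z.1.1 (- z.1.2 0 0) (- z.2 0 0)) => //.
  rewrite /jpt /=; congr (_, _, _); apply/rowP => i; by rewrite !mxE opprK.
apply: (class_map_class (op := gf_mirror) (F := GF (fq f A))).
apply: (@gf_pull_equiv R 1 1 setT setT -%R) => //.
apply: (smooth_onN openT); exact: smooth_on_id.
Qed.

(** The parameter is reversed too, so that the mirrored curve again runs from left to right, with x
    s = s at its ends. *)
Lemma mirror_knot_data : knot_data (fun x => f (- x)) A M (fun s => u (- s))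
  (fun s => - x (- s)) (fun s => - p (- s))
  (fun z => - delta (jpt z.1.1 (- z.1.2 0 0) (- z.2 0 0))).
Proof.
have sN (V : normedModType R) (g : R -> V) : smooth_on setT g -> smooth_on setT (fun s => g (- s)).
  move=> sg; apply: (smooth_comp _ _ sg).
  smooth_arith.
have sN1 : smooth_on setT (fun x : 'rV[R]_1 => - x).
  by smooth_arith.
split.
- exact: (gf_pull_smooth sN1 (kd_sf K)).
- exact: (kd_A K).
- exact: (kd_M K).
- by have [B hB] := kd_fw K; exists B => y w; exact: hB.
- by move=> y w h; apply: (kd_fx K); rewrite mxE normrN.
- rewrite mirE; apply: (pull_line_regular (smooth_fq A (kd_sf K)) sneg (kd_A K) (kd_reg K)).
  move=> y _; left; exists (const_mx (-1)).
  by rewrite (diff_linear lneg) mxE opprK.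
- exact: sN (kd_su K).
- by apply: (smooth_onN openT); exact: sN (kd_sx K).
- by apply: (smooth_onN openT); exact: sN (kd_sp K).
- apply: (smooth_onN openT); apply: (smooth_comp (g := delta) _); last exact: (kd_sdelta K).
  apply: (smooth_on_pair openT).
    apply: (smooth_on_pair openT); first exact: (@smooth_u R 1).
    apply: (smooth_on_const_mx _ openT); apply: (smooth_onN openT); exact: (@smooth_q R 1 0).
  apply: (smooth_on_const_mx _ openT); apply: (smooth_onN openT); exact: (@smooth_p R 1 0).
- by move=> s; apply/mirror_contour; rewrite !opprK; exact: (kd_in K).
- by move=> s; rewrite /jpt /= !mxE !opprK (kd_delta K) opprK.
- move=> u0 q p0 /mirror_contour/(kd_surj K)[s [h1 h2 h3]]; exists (- s).
  by rewrite opprK h1 h2 h3 !opprK.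
- move=> s; rewrite -normrN => /(kd_end K)[-> -> ->].
  by rewrite opprK oppr0.
- move=> u0 q p0 h; rewrite mirror_contour (kd_triv K); last by rewrite normrN.
  split=> -[-> h2]; split => //; last by rewrite h2 oppr0.
  by rewrite -(opprK p0) h2 oppr0.
- move=> s.
  have dN : is_derive s (1:R) (fun s : R => - s) (-1).
    by have := is_deriveNid s (1:R).
  have dx : is_derive (- s) (1:R) x ('D_1 x (- s)).
    apply/derivableP; apply: diff_derivable; exact: (smooth_diff (kd_sx K) (- s)).
  have dxN := is_deriveN (is_derive1_comp dx dN).
  have -> : 'D_1 (fun s => - x (- s)) s = 'D_1 x (- s).
    have [_ E] := dxN; rewrite -[LHS]/('D_1 (- (x \o (fun s => - s))) s) E.
    by rewrite mulrN1 opprK.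
  apply: is_derive_eq (is_derive1_comp (kd_der K (- s)) dN) _; ring.
Qed.

End Mirror.
End KnotData.

(** * Parametrizing a pulled back Legendrian *)

Section Spun.
Context {R : realType}.

Lemma legendrian_of_diffeo n (D : set 'rV[R]_n) (L : set (J1 R n)) phi psi :
  diffeo_between D L phi psi -> (forall z, L z -> D z.1.2) ->
  (forall a, D a -> (interior D a <-> interior D (phi a).1.2)) ->
  (forall a v, D a -> ('D_v phi a).1.1 = ((phi a).2 *m ('D_v phi a).1.2^T) 0 0) ->
  legendrian D L.
Proof.
move=> dif LD int tan; split => // z Lz; exists setT, setT, phi, psi.
split => //; [exact: openT|exact: openT|by rewrite !setTI|].
by move=> a _ Da; split; [exact: int|move=> v; exact: tan].
Qed.

Variables (k : nat) (f : 'rV[R]_1 -> 'rV[R]_k -> R) (A : 'M[R]_k) (M : R).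
Variables (u x p : R -> R) (delta : J1 R 1 -> R).
Hypothesis K : knot_data f A M u x p delta.
Let L := contour setT (GF (fq f A)).

(* The points of the pulled back Legendrian over the point of L with parameter r
   form the level set {h = x r}; X maps the level set {s = r} onto it, with
   inverse W r.  The function pi reads the coefficient p off p *: grad h. *)
Section Generic.
Variables (n : nat) (D : set 'rV[R]_n) (h s : 'rV[R]_n -> R).
Variables (X : 'rV[R]_n -> 'rV[R]_n) (W : R -> 'rV[R]_n -> 'rV[R]_n) (pi : J1 R n -> R).
Hypotheses (sh : smooth_on setT h) (ss : smooth_on setT s) (sX : smooth_on setT X).
Hypothesis sW : smooth_on setT (fun z : R * 'rV[R]_n => W z.1 z.2).
Hypothesis spi : smooth_on setT pi.
Hypothesis xs : forall v, x (s v) = h (X v).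
Let phi (v : 'rV[R]_n) : J1 R n := (u (s v), X v, p (s v) *: grad h (X v)).
Let psi (z : J1 R n) := W (delta (jpt z.1.1 (h z.1.2) (pi z))) z.1.2.
Hypothesis WX : forall v, D v -> W (s v) (X v) = v.
Hypothesis DX : forall v, D v -> D (X v).
Hypothesis XW : forall y r, D y -> x r = h y ->
  [/\ D (W r y), s (W r y) = r & X (W r y) = y].
Hypothesis pip : forall v, D v -> pi (phi v) = p (s v).

Let smooth_grad : smooth_on setT (fun y => grad h y).
Proof.
apply: (smooth_on_row openT) => i.
apply: (smooth_on_eq openT (f := 'D_(delta_mx 0 i) h)); last exact: smooth_on_D.
by move=> y _; rewrite mxE.
Qed.

Let sphi : smooth_on setT phi.
Proof.
apply: (smooth_on_pair openT).
  apply: (smooth_on_pair openT) => //.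
  exact: (smooth_comp _ ss (kd_su K)).
apply: (smooth_onZ openT); first exact: (smooth_comp _ ss (kd_sp K)).
exact: (smooth_comp _ sX smooth_grad).
Qed.

Let spsi : smooth_on setT psi.
Proof.
apply: (smooth_on_compT (f := fun z : J1 R n => (delta (jpt z.1.1 (h z.1.2) (pi z)), z.1.2))
  (g := fun w => W w.1 w.2) _ openT); last exact: sW.
apply: (smooth_on_pair openT); last exact: smooth_base.
apply: (smooth_comp (g := delta) _); last exact: (kd_sdelta K).
apply: (smooth_on_pair openT).
  apply: (smooth_on_pair openT); first exact: smooth_u.
  apply: (smooth_on_const_mx _ openT); exact: (smooth_comp _ (@smooth_base R n) sh).
exact: (smooth_on_const_mx _ openT spi).
Qed.

Definition spun : set (J1 R n) := [set z | D z.1.2 /\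
  exists p0, L (jpt z.1.1 (h z.1.2) p0) /\ z.2 = p0 *: grad h z.1.2].

(** A point over y with coefficient p0 determines the point (u, h y, p0) of L, whose parameter r is
    read off by [delta]; [W r] then returns from the level set {h = x r} to {s = r}. *)
Lemma spun_diffeo : diffeo_between D spun phi psi.
Proof.
split; [exact/smooth_onT|exact/smooth_onT| |].
  apply/seteqP; split => [_ [v Dv <-]|[[u0 y] q] [/= Dy [p0 [h1 h2]]]].
    split => /=; first exact: DX.
    by exists (p (s v)); rewrite -xs; split => //; exact: (kd_in K).
  have [r [ur xr pr]] := kd_surj K h1.
  have [h3 h4 h5] := XW Dy xr.
  by exists (W r y) => //; rewrite /phi h4 h5 ur pr h2.
move=> v; rewrite inE => Dv; rewrite /psi /= pip// -xs (kd_delta K); exact: WX.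
Qed.

(** From u' = p x' and [x \o s = h \o X] one gets d(u s) = p d(x s) = p d(h X), the pairing of p
    grad h with dX. *)
Lemma spun_tangent v a :
  ('D_a phi v).1.1 = ((phi v).2 *m ('D_a phi v).1.2^T) 0 0.
Proof.
have du : differentiable (fun v => u (s v)) v.
  exact: (smooth_diff (smooth_comp _ ss (kd_su K)) v).
have dX : differentiable X v by exact: (smooth_diff sX v).
have dg : differentiable (fun v => p (s v) *: grad h (X v)) v.
  apply: smooth_diff; apply: (smooth_onZ openT).
    exact: (smooth_comp _ ss (kd_sp K)).
  exact: (smooth_comp _ sX smooth_grad).
have dp : differentiable (fun v => (u (s v), X v)) v by exact: differentiable_pair.
have dphi : differentiable phi v by exact: differentiable_pair.
have E : 'd phi v a = ('d (fun v => u (s v)) v a, 'd X v a,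
    'd (fun v => p (s v) *: grad h (X v)) v a).
  by rewrite (diff_pairE _ dp dg) (diff_pairE _ du dX).
rewrite (deriveE _ dphi) E /=.
have ds : differentiable s v by exact: (smooth_diff ss v).
have dh : differentiable h (X v) by exact: (smooth_diff sh (X v)).
have dx : differentiable x (s v) by exact: (smooth_diff (kd_sx K) (s v)).
have du1 : differentiable u (s v) by exact: (smooth_diff (kd_su K) (s v)).
have chain (g : R -> R) : differentiable g (s v) ->
    'd (fun v => g (s v)) v a = 'd s v a * 'D_1 g (s v).
  move=> dg1; apply: (etrans (@diff_compE _ _ _ _ s g v a ds dg1)).
  by rewrite -(deriveE _ dg1) (deriveR1 _ dg1).
have e1 := chain u du1; have [_ du'] := kd_der K (s v).
rewrite du' in e1.
have e2 : 'd s v a * 'D_1 x (s v) = 'd h (X v) ('d X v a).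
  apply: (etrans (esym (chain x dx))).
  apply: (etrans _ (@diff_compE _ _ _ _ X h v a dX dh)).
  by rewrite (_ : (fun v => h (X v)) = fun v => x (s v))//; apply/funext => w; rewrite xs.
rewrite e1 mulrCA e2 -(deriveE _ dh) (gradE _ dh) mxE mulr_sumr.
by apply: eq_bigr => i _; rewrite [in RHS]mxE [X in _ = _ * X]mxE -mulrA [grad _ _ _ _ * _]mulrC.
Qed.

End Generic.
End Spun.

Section Strip.
Context {R : realType}.

Lemma at_t0 (y : 'rV[R]_1) t : at_t y t 0 0 = y 0 0.
Proof.
have <- := row_mxEl y (const_mx t : 'rV[R]_1) 0 0.
by rewrite /at_t; congr (row_mx _ _ _ _); exact: val_inj.
Qed.

Lemma at_t1 (y : 'rV[R]_1) t : at_t y t 0 1 = t.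
Proof.
have := row_mxEr y (const_mx t : 'rV[R]_1) 0 0; rewrite [in X in _ = X]mxE => E.
rewrite -[RHS]E.
by rewrite /at_t; congr (row_mx _ _ _ _); exact: val_inj.
Qed.

Lemma rV2P (v w : 'rV[R]_2) : v 0 0 = w 0 0 -> v 0 1 = w 0 1 -> v = w.
Proof.
move=> h0 h1; apply/rowP => i; case: i => -[|[|//]] hi.
  by rewrite (_ : Ordinal hi = 0)//; exact: val_inj.
by rewrite (_ : Ordinal hi = 1)//; exact: val_inj.
Qed.

Lemma at_tE (v : 'rV[R]_2) : v = at_t (const_mx (v 0 0)) (v 0 1).
Proof. by apply: rV2P; rewrite ?at_t0 ?at_t1 ?mxE. Qed.

Lemma smooth_on_at_t (V : normedModType R) (O : set V) (a b : V -> R) : open O ->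
  smooth_on O a -> smooth_on O b -> smooth_on O (fun z => at_t (const_mx (a z)) (b z)).
Proof.
move=> oO sa sb; apply: (smooth_on_row oO) => i.
case: i => -[|[|//]] hi.
  rewrite (_ : Ordinal hi = 0); last exact: val_inj.
  by under eq_fun do rewrite at_t0 mxE.
rewrite (_ : Ordinal hi = 1); last exact: val_inj.
by under eq_fun do rewrite at_t1.
Qed.

Lemma interior_strip (y : 'rV[R]_2) : interior strip y <-> 0 < y 0 1 < 1.
Proof.
have ct : {for y, continuous (fun y : 'rV[R]_2 => y 0 1 : R)} by exact: coord_continuous.
split=> [|/andP[h1 h2]]; last first.
  rewrite /interior /=.
  have n1 : {near y, forall z : 'rV[R]_2, 0 < z 0 1} by apply: (ct [set t | 0 < t]); exact: lt_nbhsr.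
  have n2 : {near y, forall z : 'rV[R]_2, z 0 1 < 1} by apply: (ct [set t | t < 1]); exact: lt_nbhsl.
  by apply: filterS2 n1 n2 => z /ltW a /ltW b; rewrite /strip /= a b.
move=> /nbhs_ballP[e /= e0 be].
have E t : `|t| < e -> 0 <= y 0 1 + t <= 1.
  move=> te; have : strip (at_t (const_mx (y 0 0)) (y 0 1 + t)).
    apply: be; rewrite mx_norm_ball /ball_ /=.
    apply: (@le_lt_trans _ _ `|t|) => //; rewrite [leLHS]/Num.Def.normr/= mx_normrE.
    apply: bigmax_le => // -[i j] _ /=; rewrite mxE [X in _ + X]mxE ord1.
    case: j => -[|[|//]] hj.
      rewrite (_ : Ordinal hj = 0); last exact: val_inj.
      by rewrite at_t0 mxE subrr normr0.
    rewrite (_ : Ordinal hj = 1); last exact: val_inj.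
    by rewrite at_t1 opprD addNKr normrN.
  by rewrite /strip /= at_t1.
have h1 : `|e / 2| < e by rewrite gtr0_norm; lra.
have h2 : `|- (e / 2)| < e by rewrite normrN.
have /andP[a b] := E _ h1; have /andP[a' b'] := E _ h2.
by apply/andP; split; lra.
Qed.

End Strip.

(** * The concordance *)

Section Rotation.
Context {R : realType}.

Lemma quad_rot k (A : 'M[R]_k) (c s : R) (v w : 'rV[R]_k) : c ^+ 2 + s ^+ 2 = 1 ->
  quad A (c *: v + s *: w) + quad A (- s *: v + c *: w) = quad A v + quad A w.
Proof.
pose B (a b : 'rV[R]_k) := (a *m A *m b^T) 0 0.
have Bl a b a' b' z : B (a *: b + a' *: b') z = a * B b z + a' * B b' z.
  by rewrite /B !mulmxDl -!scalemxAl mxE [X in X + _]mxE [X in _ + X]mxE.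
have Br a b a' b' z : B z (a *: b + a' *: b') = a * B z b + a' * B z b'.
  by rewrite /B linearD /= !linearZ /= mulmxDr -!scalemxAr mxE [X in X + _]mxE [X in _ + X]mxE.
have QB z : quad A z = B z z by [].
move=> cs; rewrite !QB !Bl !Br.
transitivity ((c ^+ 2 + s ^+ 2) * (B v v + B w w)); first by ring.
by rewrite cs mul1r.
Qed.

Variables (k : nat) (f : 'rV[R]_1 -> 'rV[R]_k -> R) (A : 'M[R]_k) (M T : R).
Hypothesis sf : smooth_family f.
Hypothesis nA : nondegenerate_mx A.
Hypothesis fM : forall (x : 'rV[R]_1) w, M < `|x 0 0| -> f x w = 0.
Hypothesis M0 : 0 <= M.
Hypothesis TM : M + 1 < T.

Let th (y : 'rV[R]_1) : R := (@trigo.pi R / 2) * sstep ((y 0 0 + 1) / 2).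
Let C y := cos (th y).
Let S y := sin (th y).

Let sth : smooth_on setT th.
Proof.
rewrite /th; smooth_arith; apply: (smooth_comp _ _ (@smooth_sstep R)).
smooth_arith.
Qed.
Let sC : smooth_on setT C.
Proof. by apply: (smooth_comp _ sth); case: (@smooth_cos_sin R). Qed.
Let sS : smooth_on setT S.
Proof. by apply: (smooth_comp _ sth); case: (@smooth_cos_sin R). Qed.
Let CS y : C y ^+ 2 + S y ^+ 2 = 1.
Proof. by rewrite /C /S cos2Dsin2. Qed.

Let thN (y : 'rV[R]_1) : y 0 0 <= -1 -> th y = 0.
Proof. by move=> h; rewrite /th sstep0 ?mulr0// ler_pdivrMr; lra. Qed.
Let thP (y : 'rV[R]_1) : 1 <= y 0 0 -> th y = @trigo.pi R / 2.
Proof. by move=> h; rewrite /th sstep1 ?mulr1// ler_pdivlMr; lra. Qed.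

Let rot (y : 'rV[R]_1) (w : 'rV[R]_(k + k)) : 'rV[R]_(k + k) :=
  row_mx (C y *: lsubmx w + S y *: rsubmx w) (- S y *: lsubmx w + C y *: rsubmx w).
Let tor (y : 'rV[R]_1) (w : 'rV[R]_(k + k)) : 'rV[R]_(k + k) :=
  row_mx (C y *: lsubmx w + - S y *: rsubmx w) (S y *: lsubmx w + C y *: rsubmx w).

Let combine (a b a' b' : 'rV[R]_1 -> R) :
  smooth_on setT a -> smooth_on setT b -> smooth_on setT a' -> smooth_on setT b' ->
  smooth_family (fun y (w : 'rV[R]_(k + k)) =>
    row_mx (a y *: lsubmx w + b y *: rsubmx w) (a' y *: lsubmx w + b' y *: rsubmx w)).
Proof.
move=> sa sb sa' sb'; apply/smooth_onT.
have sfst (e : 'rV[R]_1 -> R) : smooth_on setT e ->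
    smooth_on setT (fun z : 'rV[R]_1 * 'rV[R]_(k + k) => e z.1).
  move=> se; apply: (smooth_comp (g := e) _); last exact: se.
  exact: smooth_on_fst.
have sl : smooth_on setT (fun z : 'rV[R]_1 * 'rV[R]_(k + k) => lsubmx z.2).
  by apply: (smooth_on_lsubmx openT); exact: smooth_on_snd.
have sr : smooth_on setT (fun z : 'rV[R]_1 * 'rV[R]_(k + k) => rsubmx z.2).
  by apply: (smooth_on_rsubmx openT); exact: smooth_on_snd.
by apply: (smooth_on_row_mx openT); apply: (smooth_onD openT);
  apply: (smooth_onZ openT) => //; exact: sfst.
Qed.

Let sNS : smooth_on setT (fun y => - S y).
Proof. exact: (smooth_onN openT). Qed.

Let rotK y : cancel (rot y) (tor y).
Proof.
move=> w; rewrite /tor /rot row_mxKl row_mxKr -[RHS]hsubmxK; congr row_mx;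
  apply/rowP => i; rewrite !mxE;
  set a := w 0 (lshift k i); set b := w 0 (rshift k i).
  by rewrite -[RHS]mul1r -(CS y); ring.
by rewrite -[RHS]mul1r -(CS y); ring.
Qed.
Let torK y : cancel (tor y) (rot y).
Proof.
move=> w; rewrite /tor /rot row_mxKl row_mxKr -[RHS]hsubmxK; congr row_mx;
  apply/rowP => i; rewrite !mxE;
  set a := w 0 (lshift k i); set b := w 0 (rshift k i).
  by rewrite -[RHS]mul1r -(CS y); ring.
by rewrite -[RHS]mul1r -(CS y); ring.
Qed.

Definition spin_base (y : 'rV[R]_1) : 'rV[R]_1 := const_mx (chi (y 0 0) - T).

Lemma smooth_spin_base : smooth_on setT spin_base.
Proof.
apply: (smooth_on_const_mx _ openT); smooth_arith.
apply: (smooth_comp _ _ (@chi_smooth R)); exact: smooth_on_coord.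
Qed.

(* The rotation by th exchanges the two fibre factors between the left half
   line, where only the first summand of f is nonzero, and the right one; it
   preserves the sum of the quadratic forms. *)
Lemma connected_sum_gf_equiv :
  gf_equiv setT (gf_pull spin_base (GF (fq f A)))
    (gf_sum (gf_translate T (GF (fq (fun x => f (- x)) A)))
            (gf_translate (- T) (GF (fq f A)))).
Proof.
have hTM := TM; have hM0 := M0.
have sF := smooth_fq A sf.
have sG : smooth_family (fun y => fq f A (spin_base y)).
  exact: gf_pull_smooth smooth_spin_base sF.
apply: gf_equiv_trans (gf_stab_equiv setT sG nA) _.
apply: gf_equiv_step; apply: (FiberwiseDiffeo (phi := rot) (psi := tor)).
- exact: (stabilize_smooth A sG).
- apply: (gf_sum_smooth (F := gf_translate T (GF (fq (fun x => f (- x)) A)))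
    (G := gf_translate (- T) (GF (fq f A)))).
    apply: (gf_pull_smooth (h := fun y : 'rV[R]_1 => y + const_mx T)).
      by smooth_arith.
    apply: smooth_fq; apply: (gf_pull_smooth _ sf).
    by smooth_arith.
  apply: (gf_pull_smooth (h := fun y : 'rV[R]_1 => y + const_mx (- T))) => //.
  by smooth_arith.
- exact: combine.
- exact: combine.
- by move=> y _; split.
move=> y w _; rewrite /rot /fq /= row_mxKl row_mxKr.
rewrite -[RHS]addrA quad_rot//.
set l := lsubmx w; set r := rsubmx w.
(* The quadratic parts agree by [quad_rot]. What remains is checked in three zones: left of -1 only
   the mirror term survives, right of 1 only the other one. *)
suff -> : f (spin_base y) (C y *: l + S y *: r) = f (- (y + const_mx T)) l + f (y + const_mx (- T)) r.
  by ring.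
have f1 w' : - T + M < y 0 0 -> f (- (y + const_mx T)) w' = 0.
  move=> h; apply: fM; rewrite !mxE normrN ltr_normr; apply/orP; left; lra.
have f2 w' : y 0 0 < T - M -> f (y + const_mx (- T)) w' = 0.
  move=> h; apply: fM; rewrite !mxE ltr_normr; apply/orP; right; lra.
have [h|h] := leP (y 0 0) (-1).
  rewrite f2 ?addr0; last lra.
  rewrite /C /S thN// cos0 sin0 scale1r scale0r addr0; congr (f _ _).
  by apply/rowP => i; rewrite !mxE !ord1 chi_leN1//; ring.
have [h'|h'] := leP 1 (y 0 0).
  rewrite f1 ?add0r; last lra.
  rewrite /C /S thP// cos_pihalf sin_pihalf scale0r scale1r add0r; congr (f _ _).
  by apply/rowP => i; rewrite !mxE !ord1 chi_ge1.
(* In the zone where the angle varies all three terms vanish, since [chi - T] is below -M there. *)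
rewrite f1 ?f2 ?addr0; [|lra|lra].
apply: fM; rewrite mxE ltr_normr; apply/orP; right.
have /andP[_ c1] : -1 <= chi (y 0 0) <= 1 by apply: chi_small; rewrite ler_norml; apply/andP; split; lra.
lra.
Qed.

End Rotation.

(** * Rescaling the level sets *)

Section Core.
Context {R : realType}.
Variables (k : nat) (f : 'rV[R]_1 -> 'rV[R]_k -> R) (A : 'M[R]_k) (M T : R).
Variables (u x p : R -> R) (delta : J1 R 1 -> R).
Hypothesis K : knot_data f A M u x p delta.
Hypothesis TM : M + 1 < T.

(* Scaling by lam s maps {q | chi q - T = s} onto {q | chi q - T = x s}. *)
Definition lam (s : R) : R := 1 + (x s - s) / (s + T).

Lemma lam_out s : M <= `|s| -> lam s = 1.
Proof. by move=> /(kd_end K)[_ xs _]; rewrite /lam xs subrr mul0r addr0. Qed.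

(** Over a base point q with |q| >= M the knot has only the point of the zero section, and the
    parameter of that point is q itself. *)
Lemma core_x s : `|s| < M -> `|x s| < M.
Proof.
move=> sM; rewrite ltNge; apply/negP => xM.
have [u0 x0 p0] := kd_end K xM.
have [u1 p1] := (kd_triv K (u s) (p s) xM).1 (kd_in K s).
have : jpt (u s) (x s) (p s) = jpt (u (x s)) (x (x s)) (p (x s)).
  by rewrite u0 x0 p0 u1 p1.
move/(congr1 delta); rewrite !(kd_delta K) => e.
by move: sM; rewrite e ltNge xM.
Qed.

Lemma lam_in s : `|s| < M -> [/\ 1 < s + T, 1 < x s + T & lam s = (x s + T) / (s + T)].
Proof.
move=> sM; have := core_x sM; move: (sM); rewrite !ltr_norml => /andP[h1 h2] /andP[h3 h4].
have a : 1 < s + T by move: TM => h; lra.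
have b : 1 < x s + T by move: TM => h; lra.
split => //; rewrite /lam.
have n0 : s + T != 0 by rewrite gt_eqF//; lra.
by rewrite -[X in X + _](divff n0) -mulrDl; congr (_ / _); ring.
Qed.

Lemma lam_gt0 s : 0 < lam s.
Proof.
have [h|h] := leP M `|s|; first by rewrite lam_out.
have [a b ->] := lam_in h; apply: divr_gt0; lra.
Qed.

(** The line is covered by s > -T, where the denominator is positive, and s < -M, where lam is
    constantly 1. *)
Lemma smooth_lam : smooth_on setT lam.
Proof.
have hT := TM; have M0 := kd_M K.
apply: smooth_on_local => s _; have [h|h] := ltP (- T) s.
  exists [set r | - T < r]; first by split => //; exact: open_gt.
  have oO : open [set r : R | - T < r] by exact: open_gt.
  have sub (g : R -> R) : smooth_on setT g -> smooth_on [set r : R | - T < r] g.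
    exact: smooth_on_sub.
  apply: (smooth_onD oO); first exact: smooth_on_cst.
  apply: (smooth_onM oO).
    apply: (smooth_onB oO); last exact: smooth_on_id.
    exact: sub (kd_sx K).
  apply: (smooth_onV oO); first by move=> r /= hr; rewrite gt_eqF//; lra.
  by apply: (smooth_onD oO); [exact: smooth_on_id|exact: smooth_on_cst].
exists [set r | r < - M]; first by split; [exact: open_lt|rewrite /=; lra].
have oN : open [set r : R | r < - M] by exact: open_lt.
apply: (@smooth_on_eq _ _ R _ (fun=> 1) lam oN); last exact: smooth_on_cst.
by move=> r /= hr; rewrite lam_out// ltr0_norm; lra.
Qed.

Lemma norm_mul_lam s q : `|s| < M -> `|q * lam s| = `|q| * ((x s + T) / (s + T)).
Proof.
move=> h; have [a b lE] := lam_in h.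
by rewrite normrM (gtr0_norm (lam_gt0 s)) lE.
Qed.

(** For |s| < M both s + T and x s + T exceed 1. Against such thresholds chi compares like |q|, and
    lam s is the ratio of the two thresholds. *)
Lemma core_lt s q : (chi q - T < s) = (chi (q * lam s) - T < x s).
Proof.
have [h|h] := leP M `|s|.
  by have [_ -> _] := kd_end K h; rewrite lam_out// mulr1.
have [a b lE] := lam_in h.
rewrite !ltrBlDr chi_lt// chi_lt// norm_mul_lam//.
have a0 : 0 < s + T by lra.
have b0 : 0 < x s + T by lra.
by rewrite mulrA ltr_pdivrMr// [in RHS]mulrC ltr_pM2l.
Qed.

Lemma core_le s q : (chi q - T <= s) = (chi (q * lam s) - T <= x s).
Proof.
have [h|h] := leP M `|s|.
  by have [_ -> _] := kd_end K h; rewrite lam_out// mulr1.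
have [a b lE] := lam_in h.
rewrite !lerBlDr chi_le// chi_le// norm_mul_lam//.
have a0 : 0 < s + T by lra.
have b0 : 0 < x s + T by lra.
by rewrite mulrA ler_pdivrMr// [in RHS]mulrC ler_pM2l.
Qed.

Lemma core_eq s q : (chi q - T == s) = (chi (q * lam s) - T == x s).
Proof. by rewrite !eq_le core_le !leNgt core_lt. Qed.

(** The upper edge lies above all values below M, since chi >= -1 and c > M + T + 1. So for |s| < M
    the rescaling cannot affect on which side of it a point lies. *)
Lemma core_upper c s q : M + T + 1 < c -> `|s| < M ->
  s < chi q - T + c /\ x s < chi (q * lam s) - T + c.
Proof.
move=> hc h; have := core_x h; move: h; rewrite !ltr_norml => /andP[h1 h2] /andP[h3 h4].
have := chi_geN1 q; have := chi_geN1 (q * lam s); split; lra.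
Qed.

Lemma core_upper_lt c s q : M + T + 1 < c ->
  (s < chi q - T + c) = (x s < chi (q * lam s) - T + c).
Proof.
move=> hc; have [h|h] := leP M `|s|.
  by have [_ -> _] := kd_end K h; rewrite lam_out// mulr1.
by have [-> ->] := core_upper q hc h.
Qed.

Lemma core_upper_le c s q : M + T + 1 < c ->
  (s <= chi q - T + c) = (x s <= chi (q * lam s) - T + c).
Proof.
move=> hc; have [h|h] := leP M `|s|.
  by have [_ -> _] := kd_end K h; rewrite lam_out// mulr1.
by have [h1 h2] := core_upper q hc h; rewrite (ltW h1) (ltW h2).
Qed.

End Core.

Section Supports.
Context {R : realType}.

Lemma supp_sub (L : set (J1 R 1)) (a b q : R) :
  (forall z, ~ (a < qcoord z < b) -> (L z <-> zero_section z)) ->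
  supp L q -> a < q < b.
Proof.
move=> h H; apply: (H [set r | a < r < b]); last by move=> z; exact: h.
  rewrite (_ : [set x | _] = [set x | a < x] `&` [set x | x < b]).
    by apply: openI; [exact: open_gt|exact: open_lt].
  by apply/seteqP; split => r /=; [move/andP|move=> [-> ->]].
apply/connected_intervalP => r1 r2 /= h1 h2 r3 h3; lra.
Qed.

Lemma supp_off (L : set (J1 R 1)) z : ~ supp L (qcoord z) -> (L z <-> zero_section z).
Proof.
move=> /existsNP[U /not_implyP[oU /not_implyP[cU /not_implyP[tU Uz]]]].
exact: tU.
Qed.

(** Off its support each Legendrian is the zero section, so the three-case definition reduces to a
    cut at q = 0. *)
Lemma concatE (L L' : set (J1 R 1)) z : (forall q, supp L q -> q < 0) ->
  (forall q, supp L' q -> 0 < q) ->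
  concat L L' z <-> (if qcoord z < 0 then L z else L' z).
Proof.
move=> hL hL'; rewrite /concat /=; case: ifPn => [q0|].
  have n' : ~ supp L' (qcoord z) by move=> /hL'; rewrite ltNge (ltW q0).
  split=> [[[]|[]|[n1 _ /(supp_off n1)]]//|Lz].
  have [s|s] := pselect (supp L (qcoord z)); first by apply: Or31.
  by apply: Or33; split => //; exact/(supp_off s).
rewrite -leNgt => q0.
have n' : ~ supp L (qcoord z) by move=> /hL; rewrite ltNge q0.
split=> [[[]|[]|[_ n1 /(supp_off n1)]]//|Lz].
have [s|s] := pselect (supp L' (qcoord z)); first by apply: Or32.
by apply: Or33; split => //; exact/(supp_off s).
Qed.

End Supports.

Lemma connected_range (R : realType) (V : normedModType R) (phi : 'rV[R]_1 -> V) :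
  smooth phi -> connected (phi @` setT).
Proof.
move=> /smooth_onT sphi.
have sc : smooth_on setT (fun t : R => const_mx t : 'rV[R]_1).
  by apply: (@smooth_on_const_mx R R setT 1%N (fun s => s) openT); exact: smooth_on_id.
have -> : phi @` setT = (fun t : R => phi (const_mx t)) @` setT.
  apply/seteqP; split => _ [v _ <-]; last by exists (const_mx v).
  by exists (v 0 0) => //; rewrite -rV1E.
apply: connected_continuous_connected; first by apply/connected_intervalP.
apply: continuous_subspaceT => t.
exact: (smooth_on_cont (smooth_comp _ sc sphi) (I : setT t)).
Qed.

Section GradChi.
Context {R : realType}.

Lemma diff_chi_coord n (i : 'I_n) (y : 'rV[R]_n) :
  differentiable (fun y : 'rV[R]_n => chi (y 0 i)) y.
Proof.
apply: smooth_diff.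
apply: (smooth_comp _ _ (@chi_smooth R)); exact: smooth_on_coord.
Qed.

Lemma diff_chi_coordE n (i : 'I_n) (y a : 'rV[R]_n) :
  'd (fun y : 'rV[R]_n => chi (y 0 i)) y a = a 0 i * dchi (y 0 i).
Proof.
have dc : differentiable (fun y : 'rV[R]_n => y 0 i : R) y by exact: differentiable_coord.
have dchi' : differentiable (@chi R) (y 0 i).
  exact: (smooth_diff (@chi_smooth R) (y 0 i)).
apply: (etrans (@diff_compE _ _ _ _ (fun y : 'rV[R]_n => y 0 i : R) chi y a dc dchi')).
rewrite (diff_linear (coord_is_linear 0 i)) -(deriveE _ dchi') (deriveR1 _ dchi') //.
Qed.

Definition profile1 (T : R) (y : 'rV[R]_1) : R := chi (y 0 0) - T.
Definition profile2 (T c : R) (y : 'rV[R]_2) : R := chi (y 0 0) - T + c * y 0 1.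

Lemma smooth_profile1 T : smooth_on setT (profile1 T).
Proof.
rewrite /profile1; smooth_arith.
apply: (smooth_comp _ _ (@chi_smooth R)); exact: smooth_on_coord.
Qed.

Lemma smooth_profile2 T c : smooth_on setT (profile2 T c).
Proof.
rewrite /profile2; smooth_arith.
apply: (smooth_comp _ _ (@chi_smooth R)); exact: smooth_on_coord.
Qed.

Lemma diff_profile1 T y a : 'd (profile1 T) y a = a 0 0 * dchi (y 0 0).
Proof.
have d1 := diff_chi_coord 0 y.
have -> : profile1 T = (fun y => chi (y 0 0)) - cst T by [].
apply: (etrans (congr1 (@^~ a) (diffB d1 (differentiable_cst T y)))).
apply: (etrans (congr2 (fun s t => s - t) (diff_chi_coordE 0 y a) (diff_cstE T y a))).
by rewrite subr0.
Qed.

Lemma diff_profile2 T c y a : 'd (profile2 T c) y a = a 0 0 * dchi (y 0 0) + c * a 0 1.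
Proof.
have d1 := diff_chi_coord 0 y.
pose l (y : 'rV[R]_2) : R := c * y 0 1.
have ll : linear l by move=> b v w; rewrite /l !mxE mulrDr mulrCA.
have dl : differentiable l y by exact: (smooth_diff (smooth_on_linear ll setT) y).
pose g : 'rV[R]_2 -> R := (fun y : 'rV[R]_2 => chi (y 0 0)) - cst T.
have dB : differentiable g y by apply: differentiableB => //; exact: differentiable_cst.
have gE : 'd g y a = a 0 0 * dchi (y 0 0).
  apply: (etrans (congr1 (@^~ a) (diffB d1 (differentiable_cst T y)))).
  apply: (etrans (congr2 (fun s t => s - t) (diff_chi_coordE 0 y a) (diff_cstE T y a))).
  by rewrite subr0.
rewrite (_ : profile2 T c = g + l)//.
apply: (etrans (congr1 (@^~ a) (diffD dB dl))).
exact: (congr2 (fun s t => s + t) gE (diff_linear ll y a)).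
Qed.

Lemma grad_profile1 T y : grad (profile1 T) y = const_mx (dchi (y 0 0)).
Proof.
apply/rowP => i; rewrite !mxE deriveE; first by rewrite diff_profile1 ord1 mxE !eqxx mul1r.
exact: (smooth_diff (smooth_profile1 T) y).
Qed.

Lemma grad_profile2 T c y : grad (profile2 T c) y = at_t (const_mx (dchi (y 0 0))) c.
Proof.
have d : differentiable (profile2 T c) y by exact: (smooth_diff (smooth_profile2 T c) y).
apply: rV2P.
  by rewrite at_t0 [RHS]mxE mxE (deriveE _ d) diff_profile2 !mxE /= mulr0 addr0 mul1r.
by rewrite at_t1 mxE (deriveE _ d) diff_profile2 !mxE /= mul0r add0r mulr1.
Qed.

End GradChi.

Section ZeroKnot.
Context {R : realType}.
Variables (k : nat) (A : 'M[R]_k).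
Hypothesis nA : nondegenerate_mx A.

Lemma zero_section_contour : contour setT (GF (fun (_ : 'rV[R]_1) w => quad A w)) = @zero_section R 1.
Proof.
have -> : (fun (_ : 'rV[R]_1) w => quad A w) = fq (fun _ _ => 0) A.
  by apply/funext => y; apply/funext => w; rewrite /fq add0r.
(* With f = 0 the bound may be taken to be -1, which is below |q| for every q. *)
apply/seteqP; split => z.
  by move/(contour_trivial (M := -1) nA); apply => //; apply: lt_le_trans (normr_ge0 _).
by move=> h; apply/(contour_trivial (M := -1) nA) => //; apply: lt_le_trans (normr_ge0 _).
Qed.

Lemma zero_knotE : zero_knot = (contour setT (GF (fun (_ : 'rV[R]_1) w => quad A w)),
   gf_class setT (GF (fun (_ : 'rV[R]_1) w => quad A w))).
Proof.
rewrite zero_section_contour /zero_knot; congr pair; apply/seteqP; split => G /=.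
  move=> [k' [A' [nA' h]]]; apply: gf_equiv_trans h.
  exact: gf_quad_equiv.
by move=> h; exists k, A.
Qed.

Lemma zero_section_diffeo : diffeo_between setT (@zero_section R 1)
  (fun v => (0, v, 0)) (fun z => z.1.2).
Proof.
split.
- apply/smooth_onT; apply: (smooth_on_pair openT); last exact: smooth_on_cst.
  by apply: (smooth_on_pair openT); smooth_arith.
- by apply/smooth_onT; exact: (@smooth_base R 1).
- by apply/seteqP; split => [_ [v _ <-]|[[u q] p] [/= -> ->]] //; exists q.
- by move=> v _.
Qed.

Lemma zero_knot_equipped : gfqi_equipped_knot (@zero_knot R).
Proof.
have [sphi _ rphi _] := zero_section_diffeo.
rewrite zero_knotE; split => /=.
- rewrite zero_section_contour; apply: (legendrian_of_diffeo zero_section_diffeo) => //.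
  move=> v a _; rewrite [RHS](_ : _ = 0); last by rewrite /= mul0mx mxE.
  pose phi (v : 'rV[R]_1) : J1 R 1 := (0, v, 0).
  have d : differentiable phi v.
    exact: (smooth_diff ((smooth_onT _).1 sphi) v).
  have d0 : differentiable (fun _ : 'rV[R]_1 => 0 : R) v by exact: differentiable_cst.
  have d1 : differentiable (fun w : 'rV[R]_1 => w) v by exact: differentiable_id.
  have d2 : differentiable (fun _ : 'rV[R]_1 => 0 : 'rV[R]_1) v by exact: differentiable_cst.
  have d01 : differentiable (fun w : 'rV[R]_1 => (0 : R, w)) v by exact: differentiable_pair.
  rewrite (deriveE _ d) /phi (diff_pairE _ d01 d2) (diff_pairE _ d0 d1) /=.
  exact: diff_cstE.
- by rewrite zero_section_contour -rphi; exact: connected_range.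
set Q := fun (_ : 'rV[R]_1) w => quad A w.
(* Regularity is inherited from the form on the 0-dimensional fibre, where every map is onto. *)
have regQ : is_gf setT (GF Q).
  pose B : 'M[R]_0 := 0.
  have nB : nondegenerate_mx B.
    by split; [rewrite [LHS]flatmx0 [RHS]flatmx0|rewrite unitmxE det_mx00 unitr1].
  have [_ h] := gf_equiv_invariant (gf_quad_equiv (n := 1) setT nB nA).
  apply/h; split.
    apply/smooth_onT; apply: (smooth_on_eq openT (f := fun=> 0)).
      by move=> z _; rewrite /= /quad [z.2]thinmx0 !mul0mx mxE.
    exact: smooth_on_cst.
  move=> z _ _; apply/seteqP; split => // y _; exists 0 => //.
  by rewrite [y]thinmx0 [LHS]thinmx0.
exists (GF Q); split => //; split => //.
exists k, (fun _ _ => 0), A, set0; split => //.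
- by apply/smooth_onT; exact: smooth_on_cst.
- exact: compact0.
- rewrite (_ : (fun _ w => _) = Q); first exact: gf_equiv_refl.
  by apply/funext => y; apply/funext => w; rewrite add0r.
Qed.

End ZeroKnot.

(** * The connected sum, the cobordism and their parametrizations *)

Section Cobordism.
Context {R : realType}.
Variables (k : nat) (f : 'rV[R]_1 -> 'rV[R]_k -> R) (A : 'M[R]_k) (M T : R).
Variables (u x p : R -> R) (delta : J1 R 1 -> R).
Hypothesis K : knot_data f A M u x p delta.
Hypothesis TM : M + 3 < T.

Let TM1 : M + 1 < T. Proof. by move: TM => h; lra. Qed.
Let M0 : 0 <= M := kd_M K.
Let L := contour setT (GF (fq f A)).
Let lm := lam T x.
Let sF := smooth_fq A (kd_sf K).
Let lm0 s : lm s != 0. Proof. by rewrite gt_eqF//; exact: (lam_gt0 K TM1). Qed.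
Let slm : smooth_on setT lm. Proof. exact: (smooth_lam K TM1). Qed.
Let slmV : smooth_on setT (fun s => (lm s)^-1).
Proof. by apply: (smooth_onV openT). Qed.

Let G0 := gf_pull (fun y => const_mx (profile1 T y)) (GF (fq f A)).

Let Ltriv u0 q p0 : M <= `|q| -> (L (jpt u0 q p0) <-> u0 = 0 /\ p0 = 0).
Proof. exact: (kd_triv K). Qed.

Let trivial_fq (r : R) w : M < `|r| -> fq f A (const_mx r) w = quad A w.
Proof. by move=> h; rewrite /fq (kd_fx K) ?add0r// mxE. Qed.

Let trivial_small q : `|q| <= 1 -> M < `|chi q - T|.
Proof.
move=> /chi_small/andP[_ h]; rewrite ltr_normr; apply/orP; right.
by move: TM => h'; lra.
Qed.

(** Where |h| > M the pullback of f vanishes. Locally this gives regularity without a submersion;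
    outside a ball it bounds the support of the pullback in the base. *)
Lemma pull_gfqi m (D : set 'rV[R]_m) (h : 'rV[R]_m -> R) : smooth_on setT h ->
  (forall y, D y -> (exists a, 'd h y a = 1) \/ M < `|h y|) ->
  (exists B, forall y, D y -> B < `|y| -> M < `|h y|) ->
  is_gfqi D (gf_pull (fun y => const_mx (h y)) (GF (fq f A))).
Proof.
move=> sh reg [B hB]; split.
  apply: (pull_line_regular sF sh (kd_A K) (kd_reg K)) => y Dy.
  have [|hy] := reg y Dy; [by left|right].
  have ch : {for y, continuous (fun y => `|h y|)}.
    by apply: continuous_comp; [exact: (smooth_on_cont sh)|exact: norm_continuous].
  have n0 : \forall z \near y, M < `|h z|.
    by apply: (ch [set t | M < t]); exact: lt_nbhsr.
  by apply: filterS n0 => z hz w; exact: trivial_fq.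
have [B' hB'] := kd_fw K.
have cball m' (b : R) : compact [set y : 'rV[R]_m' | `|y| <= b].
  apply: bounded_closed_compact.
    exists b; split; first exact: num_real.
    by move=> b' bb' y /= yb; exact: le_trans yb (ltW bb').
  apply: (closed_comp (f := fun y : 'rV[R]_m' => `|y|) (D := [set t | t <= b])) => [y _|].
    exact: norm_continuous.
  exact: closed_le.
exists k, (fun y => f (const_mx (h y))), A,
  ([set y | `|y| <= B] `*` [set w | `|w| <= B']); split.
- exact: (gf_pull_smooth (smooth_on_const_mx _ openT sh) (kd_sf K)).
- exact: compact_setX.
- move=> y w Dy /not_andP[|] /negP; rewrite -ltNge => hb; last exact: hB'.
  by apply: (kd_fx K); rewrite mxE; exact: hB.
- exact: (kd_A K).
- exact: gf_equiv_refl.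
Qed.

Let s1 := profile1 T.
Let X1 (v : 'rV[R]_1) : 'rV[R]_1 := const_mx (v 0 0 * lm (s1 v)).
Let W1 (r : R) (y : 'rV[R]_1) : 'rV[R]_1 := const_mx (y 0 0 * (lm r)^-1).
(** For |q| > 1 the derivative of chi is a sign, so multiplying by it recovers p from p dchi. Over
    |q| <= 1 the curve is on the zero section, where p = 0. *)
Let pi1 (z : J1 R 1) : R := dchi (z.1.2 0 0) * z.2 0 0.

Let xs1 v : x (s1 v) = profile1 T (X1 v).
Proof.
apply/esym/eqP; rewrite /profile1 /X1 mxE -(core_eq K TM1).
by rewrite /s1 /profile1.
Qed.

Let sX1 : smooth_on setT X1.
Proof.
apply: (smooth_on_const_mx _ openT); apply: (smooth_onM openT).
  exact: smooth_on_coord.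
exact: (smooth_comp _ (smooth_profile1 T) slm).
Qed.

Let sW1 : smooth_on setT (fun z : R * 'rV[R]_1 => W1 z.1 z.2).
Proof.
apply: (smooth_on_const_mx _ openT); apply: (smooth_onM openT).
  apply: (smooth_comp (g := fun y : 'rV[R]_1 => y 0 0 : R) _).
    exact: smooth_on_snd.
  exact: smooth_on_coord.
apply: (smooth_comp (g := fun r => (lm r)^-1) _); last exact: slmV.
exact: smooth_on_fst.
Qed.

Let spi1 : smooth_on setT pi1.
Proof.
apply: (smooth_onM openT); last exact: (@smooth_p R 1 0).
exact: (smooth_comp _ (@smooth_q R 1 0) (@dchi_smooth R)).
Qed.

Let WX1 v : setT v -> W1 (s1 v) (X1 v) = v.
Proof. by move=> _; rewrite /W1 /X1 mxE mulfK// -rV1E. Qed.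

Let XW1 y r : setT y -> x r = profile1 T y ->
  [/\ setT (W1 r y), s1 (W1 r y) = r & X1 (W1 r y) = y].
Proof.
move=> _ xr.
have sE : s1 (W1 r y) = r.
  by apply/eqP; rewrite /s1 /profile1 /W1 mxE (core_eq K TM1) -/lm mulfVK// xr.
by split => //; rewrite /X1 sE /W1 mxE mulfVK// -rV1E.
Qed.

Let pip1 v : setT v ->
  pi1 (u (s1 v), X1 v, p (s1 v) *: grad (profile1 T) (X1 v)) = p (s1 v).
Proof.
have e : (p (s1 v) *: grad (profile1 T) (X1 v)) 0 0 = p (s1 v) * dchi (X1 v 0 0).
  by rewrite grad_profile1 mxE; congr (_ * _); rewrite mxE.
move=> _; rewrite /pi1 /= e mulrCA.
have [h|h] := leP `|X1 v 0 0| 1; last by rewrite dchi_sqr// mulr1.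
have [h'|h'] := leP M `|s1 v|.
  by have [_ _ ->] := kd_end K h'; rewrite mul0r.
have := core_x K h'; rewrite xs1 /profile1 => h3.
by have := trivial_small h; rewrite ltNge (ltW h3).
Qed.

Let dif1 := spun_diffeo K (smooth_profile1 T) (smooth_profile1 T) sX1 sW1 spi1
  xs1 WX1 (fun v _ => I) XW1 pip1.

Let spunE m (D : set 'rV[R]_m) h : smooth_on setT h ->
  contour D (gf_pull (fun y => const_mx (h y)) (GF (fq f A))) = spun f A D h.
Proof. by move=> sh; exact: pull_line_contour. Qed.

Lemma spun_knot : gfqi_equipped_knot (contour setT G0, gf_class setT G0).
Proof.
have cE : contour setT G0 = spun f A setT (profile1 T) by exact: spunE (smooth_profile1 T).
split => /=.
- rewrite cE; apply: (legendrian_of_diffeo dif1) => //.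
    by move=> a _; split => _; rewrite interiorT.
  move=> a v _; exact: (spun_tangent K (smooth_profile1 T) (smooth_profile1 T) sX1 xs1).
- by rewrite cE; have [sphi _ <- _] := dif1; exact: connected_range.
exists G0; split => //; apply: pull_gfqi (smooth_profile1 T) _ _.
  (* For |q| <= 1 the profile is below -M; elsewhere dchi is a sign, so its value on the vector dchi
     is 1. *)
  move=> y _; have [h|h] := leP `|y 0 0| 1; first by right; exact: trivial_small.
  left; exists (const_mx (dchi (y 0 0))); rewrite diff_profile1 mxE.
  exact: dchi_sqr.
exists (M + T) => y _ hy.
have {}hy : M + T < `|y 0 0|.
  apply: lt_le_trans hy _; rewrite [leLHS]/Num.Def.normr/= mx_normrE.
  by apply: bigmax_le => // -[i j] _ /=; rewrite !ord1.
have hT := TM; have hM := M0.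
rewrite /profile1 chi_norm; last lra.
by rewrite ltr_normr; apply/orP; left; lra.
Qed.

(** chi q - T is -(q + T) left of -1 and q - T right of 1, so the pullback restricts to the
    translated mirror and to the translated knot. The momentum of the former changes sign through
    dchi = -1. *)
Lemma connected_sum_eq :
  connected_sum T (fq_knot (fun x => f (- x)) A) (fq_knot f A) =
  (contour setT G0, gf_class setT G0) /\
  supports_separated T (fq_knot (fun x => f (- x)) A).1 (fq_knot f A).1.
Proof.
have hT := TM; have hM := M0.
have tl z : translate T (contour setT (GF (fq (fun x => f (- x)) A))) z <->
    L (jpt z.1.1 (- (qcoord z + T)) (- z.2 0 0)).
  have e : (z.1.1, z.1.2 + const_mx T, z.2) = jpt z.1.1 (qcoord z + T) (z.2 0 0).
    by rewrite (jptE (_, _, _)) /= mxE [const_mx _ _ _]mxE.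
  by rewrite /translate /= e; exact: mirror_contour K _ _ _.
have tr z : translate (- T) L z <-> L (jpt z.1.1 (qcoord z - T) (z.2 0 0)).
  have e : (z.1.1, z.1.2 + const_mx (- T), z.2) = jpt z.1.1 (qcoord z - T) (z.2 0 0).
    by rewrite (jptE (_, _, _)) /= mxE [const_mx _ _ _]mxE.
  by rewrite /translate /= e.
have zE (z : J1 R 1) : zero_section z <-> z.1.1 = 0 /\ z.2 0 0 = 0.
  split=> [[-> h]|[h1 h2]]; first by rewrite h mxE.
  by split => //; rewrite (rV1E z.2) h2; apply/rowP => i; rewrite !mxE.
have tl0 z : M <= `|qcoord z + T| ->
    (translate T (contour setT (GF (fq (fun x => f (- x)) A))) z <-> zero_section z).
  move=> h; rewrite tl Ltriv; last by rewrite normrN.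
  rewrite zE; split => -[-> e]; split => //; last by rewrite e oppr0.
  by rewrite -(opprK (z.2 0 0)) e oppr0.
have tr0 z : M <= `|qcoord z - T| -> (translate (- T) L z <-> zero_section z).
  by move=> h; rewrite tr Ltriv// zE.
have sl q : supp (translate T (contour setT (GF (fq (fun x => f (- x)) A)))) q -> q < 0.
  move=> /(supp_sub (a := - T - M) (b := - T + M)) h.
  have /andP[_ h'] : - T - M < q < - T + M; last lra.
  apply: h => z hz; apply: tl0; rewrite leNgt; apply/negP; rewrite ltr_norml => hz'.
  by apply: hz; lra.
have sr q : supp (translate (- T) L) q -> 0 < q.
  move=> /(supp_sub (a := T - M) (b := T + M)) h.
  have /andP[h' _] : T - M < q < T + M; last lra.
  apply: h => z hz; apply: tr0; rewrite leNgt; apply/negP; rewrite ltr_norml => hz'.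
  by apply: hz; lra.
split; last first.
  by move=> q q' /sl h /sr h'; exact: lt_trans h h'.
rewrite /connected_sum /fq_knot /=; congr pair.
  have -> : contour setT G0 = spun f A setT (profile1 T) by exact: spunE (smooth_profile1 T).
  have sp (z : J1 R 1) : spun f A setT (profile1 T) z <-> exists p0,
      L (jpt z.1.1 (chi (qcoord z) - T) p0) /\ z.2 0 0 = p0 * dchi (qcoord z).
    split=> [[_ [p0 [a ->]]]|[p0 [a b]]].
      by exists p0; split => //; rewrite grad_profile1 mxE; congr (_ * _); rewrite mxE.
    split => //; exists p0; split => //; rewrite grad_profile1 (rV1E z.2) b.
    by apply/rowP => i; rewrite !mxE.
  have key z : (if qcoord z < 0 then
      translate T (contour setT (GF (fq (fun x => f (- x)) A))) z
      else translate (- T) L z) <-> spun f A setT (profile1 T) z.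
    (* On |q| <= 1 both descriptions give the zero section, T being large compared with M. *)
    rewrite sp; have [h|h] := leP `|qcoord z| 1.
      have e : (if qcoord z < 0 then
          translate T (contour setT (GF (fq (fun x => f (- x)) A))) z
          else translate (- T) L z) <-> zero_section z.
        move: h; rewrite ler_norml => /andP[ha hb]; case: ifP => _.
          by apply: tl0; rewrite ler_normr; apply/orP; left; lra.
        by apply: tr0; rewrite ler_normr; apply/orP; right; lra.
      rewrite e zE; have hc := ltW (trivial_small h); split.
        by move=> [e1 e2]; exists 0; rewrite Ltriv// mul0r.
      by move=> [p0 []]; rewrite Ltriv// => -[-> ->]; rewrite mul0r.
    move: h; rewrite ltr_normr => /orP[h|h].
      have -> : (qcoord z < 0) = false by apply/negbTE; rewrite -leNgt; lra.
      rewrite tr dchi_gt1// chi_ge1; last lra.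
      split=> [a|[p0 [a ->]]]; last by rewrite mulr1.
      by exists (z.2 0 0); rewrite mulr1.
    have -> : qcoord z < 0 by lra.
    have e : chi (qcoord z) - T = - (qcoord z + T) by rewrite chi_leN1; lra.
    rewrite tl dchi_ltN1 ?e; last lra.
    split=> [a|[p0 [a ->]]]; last by rewrite mulrN1 opprK.
    by exists (- z.2 0 0); rewrite mulrN1 opprK.
  by apply/seteqP; split => z; rewrite /= (concatE _ sl sr) -/L; [move/key|move/key].
rewrite (class_map2_class (F := GF (fq (fun x => f (- x)) A)) (F' := GF (fq f A))).
  apply/esym/gf_class_eq.
  exact: (connected_sum_gf_equiv (kd_sf K) (kd_A K) (kd_fx K) M0 TM1).
have st t : smooth_on setT (fun y : 'rV[R]_1 => y + const_mx t).
  by smooth_arith.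
move=> F F' FF1 FF2; apply: gf_sum_equiv.
- apply: (gf_pull_smooth (st T)); apply: smooth_fq; apply: (gf_pull_smooth _ (kd_sf K)).
  by smooth_arith.
- exact: (gf_pull_smooth (st (- T)) sF).
- exact: (gf_pull_equiv (D := setT) (D' := setT) (st T)).
- exact: (gf_pull_equiv (D := setT) (D' := setT) (st (- T))).
Qed.

(** As chi >= -1, this puts chi q - T + c at M + 1 or more on the edge t = 1. *)
Let c := M + T + 2.
Let cM : M + T + 1 < c. Proof. by rewrite /c; lra. Qed.
Let cp : 0 < c. Proof. by move: TM M0 => hT hM; rewrite /c; lra. Qed.
Let c0 : c != 0. Proof. by rewrite gt_eqF. Qed.
Let FF := gf_pull (fun y => const_mx (profile2 T c y)) (GF (fq f A)).
Let Q := GF (fun (_ : 'rV[R]_1) w => quad A w).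

Let s2 := profile2 T c.
(** The coordinate q is rescaled by lam, and t is then solved from h = x s, which is affine in t
    with slope c. *)
Let X2 (v : 'rV[R]_2) : 'rV[R]_2 := at_t (const_mx (v 0 0 * lm (s2 v)))
  ((x (s2 v) - chi (v 0 0 * lm (s2 v)) + T) * c^-1).
Let W2 (r : R) (y : 'rV[R]_2) : 'rV[R]_2 := at_t (const_mx (y 0 0 * (lm r)^-1))
  ((r - chi (y 0 0 * (lm r)^-1) + T) * c^-1).
(** The t-derivative of the profile is the constant c, so p is the t-momentum divided by c. *)
Let pi2 (z : J1 R 2) : R := z.2 0 1 * c^-1.

Let profile2_at_t (a : R) b : profile2 T c (at_t (const_mx a) b) = chi a - T + c * b.
Proof. by rewrite /profile2 at_t0 at_t1 mxE. Qed.

Let cancel_c (a b : R) : a - T + c * ((b - a + T) * c^-1) = b.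
Proof. by rewrite mulrCA divff// mulr1; ring. Qed.

Let xs2 (v : 'rV[R]_2) : x (s2 v) = profile2 T c (X2 v).
Proof. by rewrite profile2_at_t cancel_c. Qed.

Let sX2 : smooth_on setT X2.
Proof.
have sq : smooth_on setT (fun v : 'rV[R]_2 => v 0 0 * lm (s2 v)).
  apply: (smooth_onM openT); first exact: smooth_on_coord.
  exact: (smooth_comp _ (smooth_profile2 T c) slm).
apply: (smooth_on_at_t openT) => //.
smooth_arith; first exact: (smooth_comp _ (smooth_profile2 T c) (kd_sx K)).
exact: (smooth_comp _ sq (@chi_smooth R)).
Qed.

Let sW2 : smooth_on setT (fun z : R * 'rV[R]_2 => W2 z.1 z.2).
Proof.
have sr : smooth_on setT (fun z : R * 'rV[R]_2 => z.1) by exact: smooth_on_fst.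
have sq : smooth_on setT (fun z : R * 'rV[R]_2 => z.2 0 0 * (lm z.1)^-1).
  apply: (smooth_onM openT).
    apply: (smooth_comp (g := fun y : 'rV[R]_2 => y 0 0 : R) _).
      exact: smooth_on_snd.
    exact: smooth_on_coord.
  exact: (smooth_comp (g := fun r => (lm r)^-1) _ sr slmV).
apply: (smooth_on_at_t openT) => //.
smooth_arith; exact: (smooth_comp _ sq (@chi_smooth R)).
Qed.

Let spi2 : smooth_on setT pi2.
Proof.
apply: (smooth_onM openT); last exact: smooth_on_cst.
exact: smooth_p.
Qed.

Let WX2 (v : 'rV[R]_2) : strip v -> W2 (s2 v) (X2 v) = v.
Proof.
move=> _; rewrite [RHS]at_tE /W2 /X2 at_t0 mxE mulfK//; congr at_t.
by rewrite /s2 /profile2; field.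
Qed.

Let s2_ge (v : 'rV[R]_2) : (0 <= v 0 1) = (chi (v 0 0) - T <= s2 v).
Proof. by rewrite /s2 /profile2 lerDl pmulr_rge0. Qed.
Let s2_gt (v : 'rV[R]_2) : (0 < v 0 1) = (chi (v 0 0) - T < s2 v).
Proof. by rewrite /s2 /profile2 ltrDl pmulr_rgt0. Qed.
Let s2_le (v : 'rV[R]_2) : (v 0 1 <= 1) = (s2 v <= chi (v 0 0) - T + c).
Proof. by rewrite /s2 /profile2 lerD2l -{2}[c]mulr1 ler_pM2l. Qed.
Let s2_lt (v : 'rV[R]_2) : (v 0 1 < 1) = (s2 v < chi (v 0 0) - T + c).
Proof. by rewrite /s2 /profile2 ltrD2l -{2}[c]mulr1 ltr_pM2l. Qed.

Let X20 (v : 'rV[R]_2) : X2 v 0 0 = v 0 0 * lm (s2 v).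
Proof. by rewrite /X2 at_t0 mxE. Qed.

Let s2X (v : 'rV[R]_2) : s2 (X2 v) = x (s2 v). Proof. by rewrite xs2. Qed.

(** The conditions 0 <= t and t <= 1 compare s with the values of the profile on the two edges; the
    rescaling preserves both comparisons. *)
Let stripX (v : 'rV[R]_2) : strip (X2 v) <-> strip v.
Proof.
rewrite /strip /= !s2_ge !s2_le X20.
rewrite s2X (core_le K TM1 (s2 v) (v 0 0)) (core_upper_le K (s2 v) (v 0 0) cM).
exact: iff_refl.
Qed.

Let istripX (v : 'rV[R]_2) : interior strip v <-> interior strip (X2 v).
Proof.
rewrite !interior_strip !s2_gt !s2_lt X20.
rewrite s2X (core_lt K TM1 (s2 v) (v 0 0)) (core_upper_lt K (s2 v) (v 0 0) cM).
exact: iff_refl.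
Qed.

Let DX2 (v : 'rV[R]_2) : strip v -> strip (X2 v). Proof. by move/stripX. Qed.

Let XW2 (y : 'rV[R]_2) r : strip y -> x r = profile2 T c y ->
  [/\ strip (W2 r y), s2 (W2 r y) = r & X2 (W2 r y) = y].
Proof.
move=> Dy xr; have sE : s2 (W2 r y) = r by rewrite /s2 profile2_at_t cancel_c.
have XE : X2 (W2 r y) = y.
  rewrite [RHS]at_tE /X2 sE /W2 at_t0 mxE mulfVK//; congr at_t.
  by rewrite xr /profile2; field.
by split => //; apply/stripX; rewrite XE.
Qed.

Let pip2 (v : 'rV[R]_2) : strip v ->
  pi2 (u (s2 v), X2 v, p (s2 v) *: grad (profile2 T c) (X2 v)) = p (s2 v).
Proof.
have e : (p (s2 v) *: grad (profile2 T c) (X2 v)) 0 1 = p (s2 v) * c.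
  by rewrite grad_profile2 mxE at_t1.
by move=> _; rewrite /pi2 /= e mulfK.
Qed.

Let dif2 := spun_diffeo K (smooth_profile2 T c) (smooth_profile2 T c) sX2 sW2 spi2 xs2 WX2 DX2 XW2 pip2.

Let spunE2 : contour strip FF = spun f A strip (profile2 T c).
Proof. exact: (pull_line_contour (smooth_fq A (kd_sf K)) (smooth_profile2 T c)). Qed.

Let at_t_smooth t : smooth_on setT (fun y : 'rV[R]_1 => at_t y t).
Proof.
apply: (smooth_on_eq openT (f := fun y : 'rV[R]_1 => at_t (const_mx (y 0 0)) t)).
  by move=> y _; rewrite -rV1E.
by apply: (smooth_on_at_t openT); [exact: smooth_on_coord|exact: smooth_on_cst].
Qed.

Lemma spinning_cobordism :
  gfqi_cobordism (contour setT G0, gf_class setT G0) (contour setT Q, gf_class setT Q)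
    (contour strip FF, gf_class strip FF).
Proof.
have hT := TM; have hM := M0.
have sl0 : gf_slice 0 FF = G0.
  congr GF; apply/funext => y; congr (fq f A (const_mx _)).
  by rewrite /profile2 at_t0 at_t1 mulr0 addr0.
have c1 q : M <= `|chi q - T + c|.
  rewrite ler_normr; apply/orP; left; have := chi_geN1 q; rewrite /c; lra.
(* On the edge t = 1 the profile exceeds M, so f drops out and only the quadratic form is left. *)
have sl1 : gf_slice 1 FF = Q.
  congr GF; apply/funext => y; apply/funext => w.
  rewrite /FF /= /fq (kd_fx K) ?add0r// mxE /profile2 at_t0 at_t1 mulr1 ltr_normr.
  by apply/orP; left; have := chi_geN1 (y 0 0); rewrite /c; lra.
split => /=.
- rewrite spunE2; apply: (legendrian_of_diffeo dif2).
  + by move=> z [].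
  + by move=> a _; exact: istripX.
  + move=> a v _; exact: (spun_tangent K (smooth_profile2 T c) (smooth_profile2 T c) sX2 xs2).
- exists FF; split => //; apply: pull_gfqi (smooth_profile2 T c) _ _.
    move=> y _; left; exists (at_t 0 c^-1).
    by rewrite diff_profile2 at_t0 at_t1 mxE mul0r add0r divff.
  (* Since t <= 1, a norm beyond this bound is attained by q, and then h is at least |q| - T > M. *)
  exists (M + T + 1) => y; rewrite /strip /= => /andP[y0 y1] hy.
  have {}hy : M + T + 1 < `|y 0 0|.
    move: hy; rewrite [ltRHS]/Num.Def.normr/= mx_normrE => hy.
    rewrite ltNge; apply/negP => h; move: hy; rewrite ltNge => /negP; apply.
    apply: bigmax_le => [|[i j] _ /=]; first lra.
    rewrite ord1; case: j => -[|[|//]] hj.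
      by rewrite (_ : Ordinal hj = 0)//; exact: val_inj.
    rewrite (_ : Ordinal hj = 1); last exact: val_inj.
    by rewrite ger0_norm//; lra.
  rewrite /profile2 chi_norm; last lra.
  have : 0 <= c * y 0 1 by apply: mulr_ge0 => //; exact: ltW.
  by move=> h; rewrite ltr_normr; apply/orP; left; lra.
- split.
    rewrite spunE2.
    rewrite [RHS](pull_line_contour (smooth_fq A (kd_sf K)) (smooth_profile1 T)).
    have e y : profile2 T c (at_t y 0) = profile1 T y by rewrite /profile2 at_t0 at_t1 mulr0 addr0.
    apply/seteqP; split => [z [s [_ /= [p0 [a b]]]]|z [_ [p0 [a b]]]].
      split => //; exists p0; rewrite -e; split => //.
      rewrite grad_profile1 (rV1E z.2); apply/rowP => i; rewrite !mxE.
      by have /(congr1 (fun v : 'rV[R]_2 => v 0 0)) := b; rewrite at_t0 grad_profile2 mxE !at_t0 mxE.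
    (* The t-momentum is the second component of p0 grad h. *)
    exists (p0 * c); split => /=; first by rewrite /strip /= at_t1 lexx ler01.
    exists p0; rewrite e; split => //.
    rewrite grad_profile2 b grad_profile1 at_t0; apply: rV2P.
      by rewrite at_t0 [RHS]mxE at_t0 !mxE.
    by rewrite at_t1 [RHS]mxE at_t1.
  rewrite spunE2 /Q zero_section_contour; last exact: (kd_A K).
  have e y : profile2 T c (at_t y 1) = chi (y 0 0) - T + c by rewrite /profile2 at_t0 at_t1 mulr1.
  apply/seteqP; split => [z [s [_ /= [p0 []]]]|z [z1 z2]].
    rewrite e => /(Ltriv _ _ (c1 _))[z0 ->]; rewrite scale0r => b; split => //.
    rewrite (rV1E z.2); apply/rowP => i; rewrite !mxE.
    by have := congr1 (fun v : 'rV[R]_2 => v 0 0) b; rewrite at_t0 mxE.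
  exists 0; split => /=; first by rewrite /strip /= at_t1 lexx ler01.
  exists 0; rewrite e z1 z2; split; first exact/(Ltriv _ _ (c1 _)).
  by rewrite scale0r; apply: rV2P; rewrite ?at_t0 ?at_t1 !mxE.
- have D t : 0 <= t <= 1 ->
      class_map setT (gf_slice t) (gf_class strip FF) = gf_class setT (gf_slice t FF).
    move=> t01; apply: class_map_class => G.
    apply: (gf_pull_equiv (h := fun y : 'rV[R]_1 => at_t y t) (at_t_smooth t)).
    by move=> y _; rewrite /strip /= at_t1.
  by rewrite !D ?lexx ?ler01// sl0 sl1.
Qed.

Lemma spinning_strip : diffeomorphic strip (contour strip FF).
Proof. by rewrite spunE2; eexists; eexists; exact: dif2. Qed.

End Cobordism.

Lemma mirror_sum_zero (R : realType) k (f : 'rV[R]_1 -> 'rV[R]_k -> R) A M u x p delta :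
  knot_data f A M u x p delta ->
  class_sum_eq (fq_knot (fun x => f (- x)) A) (fq_knot f A) zero_knot.
Proof.
move=> K; near=> T; have TM : M + 3 < T by near: T; apply: nbhs_pinfty_gt; exact: num_real.
have [e sep] := connected_sum_eq K TM; split => //.
split; [by rewrite e; exact: (spun_knot K TM)|exact: zero_knot_equipped (kd_A K)|].
rewrite e (zero_knotE (kd_A K)).
exact: ex_intro2 (spinning_cobordism K TM) (spinning_strip K TM).
Unshelve. all: by end_near.
Qed.

Theorem theorem2p10 (R : realType) (X : equipped R 1)
    (hX : gfqi_equipped_knot X) :
  class_sum_eq (mirror X) X zero_knot /\ class_sum_eq X (mirror X) zero_knot.
Proof.
have [k [f [A [M [u [x [p [delta [K ->]]]]]]]]] := knot_data_exists hX.
rewrite (mirror_fq_knot K); split; first exact: mirror_sum_zero K.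
(* The first statement for the mirrored data; its mirror is the original knot because - (- x) =
   x. *)
have := mirror_sum_zero (mirror_knot_data K).
by under eq_fun do rewrite opprK.
Qed.
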